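(* Let $H^L,H^R,u_0,A_0$ satisfy the standing assumptions on the Hamiltonians and the initial condition listed in the context. Let $\tilde\psi:\mathbb R\times[0,T]\times\mathbb R\times[A_0,0]\to\mathbb R$ be measurable and bounded, with compact support, continuous in the last two variables, and convex in the last variable. For measurable $A:(0,T)\to[A_0,0]$ put $$\mathcal J(A)=\int_0^T\int_{\mathbb R}\tilde\psi\big(x,t,u^A_x(x,t),A(t)\big)\,dx\,dt .$$ Then the problem $$\min\{\mathcal J(A):\ A:(0,T)\to[A_0,0]\ \text{measurable}\}$$ admits at least one solution.
   Context: Standing assumptions and notation. Fix $T>0$. $H^L,H^R:\mathbb R\to\mathbb R$ are uniformly convex and of class $C^2$, and $R^L,R^R>0$ satisfy $H^L(-R^L)=H^L(0)=0=H^R(-R^R)=H^R(0)$. The function $u_0:\mathbb R\to\mathbb R$ is Lipschitz continuous with derivative $u_{0,x}\in(-R^L,0)$ (a.e.) on $(-\infty,0)$ and $u_{0,x}\in(-R^R,0)$ (a.e.) on $(0,\infty)$. Set $A_0=\max\{\min_p H^L(p),\min_p H^R(p)\}$. The Lagrangians are $L^L(\alpha)=\sup_{p\in[-R^L,0]}\{\alpha p-H^L(p)\}$ and $L^R(\alpha)=\sup_{p\in[-R^R,0]}\{\alpha p-H^R(p)\}$, $\alpha\in\mathbb R$. For a measurable control $A:[0,T]\to[A_0,0]$, $t\in(0,T]$ and $\gamma\in H^1(0,t)$, put $$J^A(\gamma)=\int_0^t\big(L^R(\dot\gamma(s))\mathbf 1_{\{\gamma(s)>0\}}+L^L(\dot\gamma(s))\mathbf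 1_{\{\gamma(s)<0\}}-A(s)\mathbf 1_{\{\gamma(s)=0\}}\big)ds+u_0(\gamma(0)),$$ and $u^A(x,t)=\inf\{J^A(\gamma):\gamma\in H^1(0,t),\ \gamma(t)=x\}$, with $u^A(x,0)=u_0(x)$. The function $u^A$ is Lipschitz continuous, so $u^A_x$ (its derivative in $x$) exists a.e. *)

(* Defs.v *)
From HB Require Import structures.
From mathcomp Require Import all_boot all_order all_algebra.
From mathcomp Require Import all_classical all_reals all_analysis.
From mathcomp Require Import measurable_realfun.

Set Implicit Arguments.
Unset Strict Implicit.
Unset Printing Implicit Defensive.

Import Order.TTheory GRing.Theory Num.Theory.
Import numFieldNormedType.Exports.

Local Open Scope classical_set_scope.
Local Open Scope ring_scope.

(* R equipped with the sigma-algebra of Lebesgue measurable sets. *)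
Notation lebR R :=
  (caratheodory_type (mu_ext (@wlength R idfun))).

(* "Measurable" and "almost everywhere" are meant in the sense of Lebesgue: all
   integrals below are taken with respect to the complete Lebesgue measure. *)
Notation leb := completed_lebesgue_measure.

Definition lebesgue_measurable_fun (R : realType) (D : set R) (f : R -> R) :=
  measurable_fun (D : set (lebR R)) (f : lebR R -> measurableTypeR R).

Definition lebesgue4 (R : realType) :
    set (measurableTypeR R * measurableTypeR R * measurableTypeR R
         * measurableTypeR R) -> \bar R :=
  (((@lebesgue_measure R \x @lebesgue_measure R) \x @lebesgue_measure R)
     \x @lebesgue_measure R)%E.

(* Lebesgue measurable subsets of R^4 are those of the form A `|` N, with A
   Borel and N negligible. *)
Definition lebesgue4_measurable_fun (R : realType) (D : set (R * R * R * R))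
    (f : R * R * R * R -> R) :=
  forall Y : set (measurableTypeR R), measurable Y ->
    completed_algebra_gen (@lebesgue4 R) (D `&` f @^-1` Y).

Definition C1 (R : realType) (f : R -> R) :=
  (forall x, derivable f x 1) /\ continuous (derive1 f).

Definition C2 (R : realType) (f : R -> R) :=
  (forall x, derivable f x 1) /\ C1 (derive1 f).

(* Uniform convexity of a C^2 function. *)
Definition uniformly_convex (R : realType) (f : R -> R) :=
  exists2 c : R, 0 < c & forall x, c <= derive1 (derive1 f) x.

Definition closed_support (T : topologicalType) (R : realType) (D : set T)
    (f : T -> R) : set T :=
  closure [set x | D x /\ f x != 0].

Definition C1_compact_support (R : realType) (a b : R) (phi : R -> R) :=
  [/\ C1 phi, compact (closed_support setT phi)
    & closed_support setT phi `<=` `]a, b[].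

Definition L2 (R : realType) (a b : R) (f : R -> R) :=
  lebesgue_measurable_fun `]a, b[ f /\
  (\int[leb]_(s in `]a, b[) ((f s) ^+ 2)%:E < +oo)%E.

(* g is the weak derivative of gamma on ]a, b[. *)
Definition weak_derivative (R : realType) (a b : R) (gamma g : R -> R) :=
  forall phi, C1_compact_support a b phi ->
    \int[leb]_(s in `]a, b[) (gamma s * derive1 phi s) =
    - \int[leb]_(s in `]a, b[) (g s * phi s).

(* gamma is (the continuous representative of) an element of H^1(a, b), and g is
   its derivative.  Pointwise values of gamma, in particular at the end points,
   refer to the continuous representative. *)
Definition H1_with_derivative (R : realType) (a b : R) (gamma g : R -> R) :=
  [/\ {within `[a, b], continuous gamma}, L2 a b gamma, L2 a b g
    & weak_derivative a b gamma g].

(* Supremum over a compact interval, finite when H is continuous. *)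
Definition lagrangian (R : realType) (H : R -> R) (r alpha : R) : R :=
  sup [set alpha * p - H p | p in `[- r, 0]].

(* A uniformly convex function attains its infimum. *)
Definition flux_min (R : realType) (HL HR : R -> R) : R :=
  Num.max (inf (range HL)) (inf (range HR)).

Definition control (R : realType) (T A0 : R) (A : R -> R) :=
  lebesgue_measurable_fun `]0, T[ A /\
  (forall t, t \in `]0, T[ -> A t \in `[A0, 0]).

(* g stands for the derivative of gamma. *)
Definition action (R : realType) (HL HR : R -> R) (RL RR : R) (u0 A : R -> R)
    (t : R) (gamma g : R -> R) : \bar R :=
  (\int[leb]_(s in `]0%R, t[)
     (lagrangian HR RR (g s) * (0 < gamma s)%R%:R
      + lagrangian HL RL (g s) * (gamma s < 0)%R%:R
      - A s * (gamma s == 0)%:R)%:E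
   + (u0 (gamma 0))%:E)%E.

(* Under the assumptions of the theorem the infimum is finite. *)
Definition value (R : realType) (HL HR : R -> R) (RL RR : R) (u0 A : R -> R)
    (x t : R) : R :=
  if t == 0 then u0 x else
  fine (ereal_inf
    [set y | exists gamma g : R -> R,
       [/\ H1_with_derivative 0 t gamma g, gamma t = x
         & y = action HL HR RL RR u0 A t gamma g]]).

Definition cost (R : realType) (T : R) (HL HR : R -> R) (RL RR : R)
    (u0 : R -> R) (psi : R * R * R * R -> R) (A : R -> R) : \bar R :=
  (\int[leb]_(t in `]0%R, T[) \int[leb]_x
     (psi (x, t, derive1 (fun y => value HL HR RL RR u0 A y t) x, A t)%R)%:E)%E.

(* Main.v *)
(* After convexity reductions, a path ending at [x <> 0] may be taken to be either a
   straight line on one side of the interface [{0}], or to go straight to [0], stay there,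
   and then go straight to [x]: an excursion away from [0] has mean velocity zero, so it
   costs at least [- min H >= - A] per unit of time and is never better than waiting.
   Hence the value function depends on the control [A] only through its primitive [F], it
   is 2-Lipschitz in [F] for the uniform norm, and off the interface it is semiconcave in
   [x] with a constant independent of [A]. Therefore, if primitives converge uniformly, the
   gradients of the value functions converge almost everywhere.

   The primitives of a minimising sequence of controls are equi-Lipschitz and have a
   cluster point [F]; let [p] be the gradient of the value function associated with [F].
   The controls [B] whose primitive is within [1 / j] of [F] and for which the integral of
   [psi (x, t, p, B)] is at most [inf + 1 / j] form nonempty, nested, convex sets.
   By the parallelogram identity, elements of almost minimal [L^2] norm in them converge
   almost everywhere to a control [A]. Its primitive is [F], so the gradient of its value
   function is [p], and dominated convergence shows that [A] is optimal. *)

Require Import Defs.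
From HB Require Import structures.
From mathcomp Require Import all_boot all_order all_algebra.
From mathcomp Require Import all_classical all_reals all_analysis.
From mathcomp Require Import measurable_realfun.
From mathcomp Require Import ring lra.

Set Implicit Arguments.
Unset Strict Implicit.
Unset Printing Implicit Defensive.

Import Order.TTheory GRing.Theory Num.Theory.
Import numFieldNormedType.Exports.

Local Open Scope classical_set_scope.
Local Open Scope ring_scope.

(** The cost is not convex in the control, because [A] also acts through the gradient, nonlinearly.
    Convexity of [psi] in its last argument helps only with the gradient frozen at its limit [p];
    closeness of the primitives to [F] is what makes the limit control reproduce that [p]. Almost
    minimal elements of nested convex sets take the place of weak compactness and Mazur's lemma, and
    give almost everywhere convergence directly.

    The delicate estimate is the semiconcavity constant. If [H] has convexity modulus [c], the cost
    of a displacement in time [tau] is semiconcave with constant [1 / (4 c tau)], which explodes for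
    short final legs. But momenta are confined to [[- r, 0]], so beyond the speed [m], a Lipschitz
    constant of [H], the cost is linear in the displacement. A leg ending at distance [delta] from
    the interface thus meets that constant only for [tau >= delta / m].

    Controls, velocities and integrand are merely Lebesgue measurable; they are traded for Borel
    representatives, and the iterated integrals of the cost for one product integral. *)

Notation plane R := (measurableTypeR R * measurableTypeR R)%type.
Notation borel f := (measurable_fun setT (f : measurableTypeR _ -> measurableTypeR _)).
Notation borel2 f := (measurable_fun setT (f : plane _ -> measurableTypeR _)).
Notation integrable_itv a b f := (lebesgue_measure.-integrable `]a, b[ (EFin \o f)).

(** * Truncation, and Borel representatives modulo null sets *)

Lemma aeS d (T : measurableType d) (R : realType) (m : {measure set T -> \bar R})
    (P Q : T -> Prop) :
  (forall x, P x -> Q x) -> {ae m, forall x, P x} -> {ae m, forall x, Q x}.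
Proof. exact: filterS. Qed.

Lemma aeS2 d (T : measurableType d) (R : realType) (m : {measure set T -> \bar R})
    (P Q S : T -> Prop) : (forall x, P x -> Q x -> S x) ->
  {ae m, forall x, P x} -> {ae m, forall x, Q x} -> {ae m, forall x, S x}.
Proof. exact: filterS2. Qed.

Section clamp.
Context {R : realType}.
Implicit Types (a b x y : R).

Definition clamp a b x : R := Num.max a (Num.min x b).

Lemma clamp_in a b x : a <= b -> a <= clamp a b x <= b.
Proof. by move=> ab; rewrite /clamp le_max lexx ge_max ab ge_min lexx orbT. Qed.

Lemma clamp_id a b x : a <= x <= b -> clamp a b x = x.
Proof. by move=> /andP[ax xb]; rewrite /clamp (min_idPl xb) (max_idPr ax). Qed.

Lemma clamp_lip a b x y : `|clamp a b x - clamp a b y| <= `|x - y|.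
Proof.
have maxl (u v : R) : `|Num.max a u - Num.max a v| <= `|u - v|.
  have h1 := ler_norm (u - v); have h2 := ler_norm (v - u); rewrite distrC in h2.
  rewrite ler_norml; have [?|?] := leP a u; have [?|?] := leP a v; apply/andP; split; lra.
have minl (u v : R) : `|Num.min u b - Num.min v b| <= `|u - v|.
  have h1 := ler_norm (u - v); have h2 := ler_norm (v - u); rewrite distrC in h2.
  rewrite ler_norml; have [?|?] := leP u b; have [?|?] := leP v b; apply/andP; split; lra.
exact: le_trans (maxl _ _) (minl _ _).
Qed.

Lemma clamp_continuous a b : continuous (clamp a b).
Proof.
move=> x; apply/cvgrPdist_lt => e e0; near=> y.
by rewrite (le_lt_trans (clamp_lip a b x y))//; near: y; exact: cvgr_dist_lt.
Unshelve. all: by end_near. Qed.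

End clamp.

(** Rays with rational end point generate the Borel sets and are countably many, so the null errors
    of their preimages fit into one null set [N]; off [N] all these preimages are Borel. *)
Lemma completed_measurable_ae_eq d (T : measurableType d) (R : realType)
    (mu : {measure set T -> \bar R}) (D : set T) (f : T -> R) :
  measurable D ->
  (forall Y : set (measurableTypeR R), measurable Y ->
     completed_algebra_gen mu (D `&` f @^-1` Y)) ->
  exists N, [/\ measurable N, mu N = 0 &
    measurable_fun setT ((f \_ (D `\` N)) : T -> measurableTypeR R)].
Proof.
move=> mD cf.
have H (q : rat) : exists AM : set T * set T, [/\ measurable AM.1, measurable AM.2,
    mu AM.2 = 0, AM.1 `<=` D `&` f @^-1` `]ratr q, +oo[
    & D `&` f @^-1` `]ratr q, +oo[ `<=` AM.1 `|` AM.2].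
  have [//|A mA [N [M [mM M0 NM]] AN]] := cf `]ratr q, +oo[%classic.
  by exists (A, M); split => //=; rewrite -AN => x; [left|move=> [|/NM]; [left|right]].
have [AM HAM] := choice H.
pose enum n : rat := odflt 0 (pickle_inv n).
pose N := \bigcup_n (AM (enum n)).2.
have ratN q : (AM q).2 `<=` N.
  by move=> x xq; exists (pickle q) => //; rewrite /enum pickleK_inv.
have mN : measurable N.
  by apply: bigcupT_measurable => n; case: (HAM (enum n)).
exists N; split => //.
  apply/eqP; rewrite -measure_le0.
  have -> : 0%E = (\sum_(0 <= n <oo) mu (AM (enum n)).2)%E :> \bar R.
    by rewrite eseries0// => n _ _; case: (HAM (enum n)).
  by apply: measure_sigma_subadditive => //; move=> n; case: (HAM (enum n)).
have mDN : measurable (D `\` N) by exact: measurableD.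
apply/(measurable_restrictT _ mDN).
apply: (measurability _ (RGenOInfty.measurableE R)) => //.
move=> _ [_ [x ->] <-].
have -> : (D `\` N) `&` f @^-1` `]x, +oo[ =
    \bigcup_n (((AM (enum n)).1 `\` N) `&` (if x < ratr (enum n) then setT else set0)).
  apply/seteqP; split=> z /=.
    rewrite in_itv/= andbT => -[[Dz Nz] xfz].
    have [q] := rat_in_itvoo xfz; rewrite in_itv/= => /andP[xq qf].
    exists (pickle q) => //=; rewrite /enum pickleK_inv/= xq; split => //; split => //.
    have [_ _ _ _ /(_ z)[]//] := HAM q; first by split => //=; rewrite in_itv/= qf.
    by move=> /ratN.
  move=> [n _ /= [[zn Nz]]]; case: ifPn => // xq _.
  have [_ _ _ /(_ _ zn)/= [Dz] + _] := HAM (enum n).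
  by rewrite !in_itv/= !andbT => /(lt_trans xq) ?.
apply: bigcupT_measurable => n; apply: measurableI.
  by apply: measurableD => //; case: (HAM (enum n)).
by case: ifP.
Qed.

(** * Borel and Lebesgue measurability *)

Section completed_lebesgue.
Context {R : realType}.
Notation mu := (@lebesgue_measure R).
Notation cmu := (@completed_lebesgue_measure R).

Lemma lebesgue_measurable_borel (A : set R) :
  measurable (A : set (measurableTypeR R)) -> measurable (A : set (lebR R)).
Proof. exact: sub_caratheodory. Qed.

Lemma borel_lebesgue_measurable_fun d (T : measurableType d) (D : set R) (f : R -> T) :
  measurable_fun (D : set (measurableTypeR R)) (f : measurableTypeR R -> T) ->
  measurable (D : set (measurableTypeR R)) ->
  measurable_fun (D : set (lebR R)) (f : lebR R -> T).
Proof.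
by move=> mf mD _ Y mY; apply: lebesgue_measurable_borel; exact: mf.
Qed.

(** A completed null set is a Borel set [X] plus a part [M] of a Borel null set [M']; enlarging [M]
    to [M'] gives a Borel null cover. *)
Lemma completed_lebesgue_negligible (N : set R) :
  cmu.-negligible (N : set (lebR R)) <-> mu.-negligible (N : set (measurableTypeR R)).
Proof.
split => [[A [mA A0 NA]]|[A [mA A0 NA]]]; last first.
  by exists A; split => //; exact: lebesgue_measurable_borel.
have : completed_algebra_gen mu A.
  by rewrite -g_sigma_completed_algebra_genE completed_caratheodory_measurable.
move=> -[X mX [M [M' [mM' M'0 MM']] XMA]].
exists (X `|` M'); split; first exact: measurableU.
  apply/eqP; rewrite -measure_le0; apply: le_trans (measureU2 _ _ _) _ => //=.
  rewrite [X in (_ + X)%E]M'0 adde0 -A0.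
  apply: le_outer_measure; rewrite -XMA; exact: subsetUl.
by move=> x /NA; rewrite -XMA => -[|/MM']; [left|right].
Qed.

Lemma completed_lebesgue_ae (P : R -> Prop) :
  {ae cmu, forall x : lebR R, P x} <-> {ae mu, forall x : measurableTypeR R, P x}.
Proof. exact: completed_lebesgue_negligible. Qed.

(** [mu] is the image of [cmu] under the identity, which is measurable from the larger sigma-algebra
    to the Borel one, so this is a change of variables. *)
Lemma integral_completed_lebesgue (D : set R) (f : R -> \bar R) :
  measurable (D : set (measurableTypeR R)) ->
  measurable_fun (D : set (measurableTypeR R)) (f : measurableTypeR R -> \bar R) ->
  (\int[cmu]_(x in D) f x = \int[mu]_(x in D) f x)%E.
Proof.
move=> mD mf.
have mid : measurable_fun setT (id : lebR R -> measurableTypeR R).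
  by move=> _ Y mY; rewrite setTI; exact: lebesgue_measurable_borel.
have nn (g : R -> \bar R) : measurable_fun (D : set (measurableTypeR R)) g ->
    (forall x, 0 <= g x)%E -> (\int[cmu]_(x in D) g x = \int[mu]_(x in D) g x)%E.
  move=> mg g0.
  rewrite -(@ge0_integral_pushforward _ _ _ _ _ _ mid cmu D g)//.
rewrite integralE [RHS]integralE !nn//; [exact: measurable_funeneg|exact: measurable_funepos].
Qed.

Lemma lebesgue_measurable_ae_borel (D : set R) (f : R -> R) :
  measurable (D : set (measurableTypeR R)) -> lebesgue_measurable_fun D f ->
  exists N, [/\ measurable (N : set (measurableTypeR R)), mu N = 0 &
    borel (f \_ (D `\` N))].
Proof.
move=> mD mf; apply: completed_measurable_ae_eq => // Y mY.
rewrite -g_sigma_completed_algebra_genE completed_caratheodory_measurable.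
by apply: mf => //; exact: lebesgue_measurable_borel.
Qed.

(** Nothing is assumed about the measurability of [f]: completeness of [cmu] transfers it from
    [g]. *)
Lemma ae_eq_integral_completed (D : set R) (f g : R -> \bar R) :
  measurable (D : set (measurableTypeR R)) ->
  measurable_fun (D : set (measurableTypeR R)) (g : measurableTypeR R -> \bar R) ->
  {ae mu, forall x : measurableTypeR R, D x -> f x = g x} ->
  (\int[cmu]_(x in D) f x = \int[mu]_(x in D) g x)%E.
Proof.
move=> mD mg fg; rewrite -integral_completed_lebesgue//.
have fg' : ae_eq cmu (D : set (lebR R)) g f.
  apply/completed_lebesgue_ae; apply: filterS fg => x H Dx; by rewrite H.
have mg' : measurable_fun (D : set (lebR R)) g.
  exact: borel_lebesgue_measurable_fun.
apply: ae_eq_integral => //; first exact: lebesgue_measurable_borel.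
  by apply: ae_measurable_fun fg' mg'; exact: completed_lebesgue_measure_is_complete.
by apply: filterS fg' => x H Dx; rewrite H.
Qed.

End completed_lebesgue.

(** * The Lagrangians *)

Section ell.
Context {R : realType}.
Implicit Types (H : R -> R) (r m c tau d p : R).

Let mem_itvP a b p : `[a, b]%classic p -> a <= p <= b.
Proof. by rewrite /= in_itv. Qed.

(** All that is used of a Hamiltonian, on [[- r, 0]] only. [c] is a modulus of strong convexity and
    [a0] will be [A0]; [ham_min] expresses that waiting at the interface, at a rate [- A <= - a0],
    is no dearer than resting beside it. *)
Record hamiltonian H (r m c a0 : R) : Prop := Hamiltonian {
  ham_r : 0 < r;
  ham_m : 0 < m;
  ham_c : 0 < c;
  ham_0 : H 0 = 0;
  ham_Nr : H (- r) = 0;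
  ham_lip : forall p q, - r <= p <= 0 -> - r <= q <= 0 ->
    `|H p - H q| <= m * `|p - q|;
  ham_convex : forall p q l, - r <= p <= 0 -> - r <= q <= 0 -> 0 <= l <= 1 ->
    H (l * p + (1 - l) * q) + c * (l * (1 - l)) * (p - q) ^+ 2 <=
    l * H p + (1 - l) * H q;
  ham_min : exists2 p, - r <= p <= 0 & H p <= a0 }.

(* The perspective [tau * L (d / tau)] of the Lagrangian: the cost of a displacement
   [d] in time [tau], which also makes sense for [tau = 0]. *)
Definition ell H r tau d : R := sup [set d * p - tau * H p | p in `[- r, 0]].

Lemma lagrangianE H r alpha : lagrangian H r alpha = ell H r 1 alpha.
Proof.
by rewrite /lagrangian /ell; congr sup; apply: eq_imagel => p _; rewrite mul1r.
Qed.

Context (H : R -> R) (r m c a0 : R) (hH : hamiltonian H r m c a0).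
Let r0 := ham_r hH.
Let m0 := ham_m hH.
Let c0 := ham_c hH.

Let Hbound p : - r <= p <= 0 -> `|H p| <= m * - p.
Proof.
move=> pr; have /(_ 0) := ham_lip hH pr; rewrite (ham_0 hH) !subr0 lexx oppr_le0 (ltW r0).
by move=> /(_ isT); case/andP: pr => _ p0; rewrite (ler0_norm p0).
Qed.

Let Hbound' p : - r <= p <= 0 -> `|H p| <= m * (p + r).
Proof.
move=> pr; have /(_ (- r)) := ham_lip hH pr; rewrite (ham_Nr hH) !subr0 lexx oppr_le0 (ltW r0).
move=> /(_ isT); case/andP: pr => p0 _; by rewrite opprK (ger0_norm (x := p + r))//; lra.
Qed.

Let ell_has_sup tau d : has_sup [set d * p - tau * H p | p in `[- r, 0]].
Proof.
split; first by exists (d * 0 - tau * H 0); exists 0 => //=; rewrite in_itv/= lexx oppr_le0 ltW.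
exists (`|d| * r + `|tau| * (m * r)) => _ [p /mem_itvP pr <-].
apply: (le_trans (ler_norm _)); apply: (le_trans (ler_normB _ _)).
rewrite !normrM; apply: lerD; apply: ler_wpM2l => //.
  by case/andP: pr => p1 p0; rewrite ler0_norm// lerNl.
apply: (le_trans (Hbound pr)); apply: ler_wpM2l; first exact: ltW.
by case/andP: pr; lra.
Qed.

Lemma ell_ge tau d p : - r <= p <= 0 -> d * p - tau * H p <= ell H r tau d.
Proof.
by move=> pr; apply: ub_le_sup; [case: (ell_has_sup tau d)|exists p => //=; rewrite in_itv].
Qed.

Lemma ell_le tau d C : (forall p, - r <= p <= 0 -> d * p - tau * H p <= C) ->
  ell H r tau d <= C.
Proof.
move=> Hp; apply: ge_sup; first by case: (ell_has_sup tau d).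
by move=> _ [p /mem_itvP pr <-]; exact: Hp.
Qed.

Lemma ell_adherent tau d e : 0 < e ->
  exists2 p, - r <= p <= 0 & ell H r tau d - e < d * p - tau * H p.
Proof.
move=> e0; have [_ [p /mem_itvP pr <-] ep] := sup_adherent e0 (ell_has_sup tau d).
by exists p.
Qed.

Let in0 : - r <= (0 : R) <= 0. Proof. by rewrite lexx oppr_le0 ltW. Qed.
Let inr : - r <= - r <= (0 : R). Proof. by rewrite lexx oppr_le0 ltW. Qed.

Lemma ell_ge0 tau d : 0 <= ell H r tau d.
Proof. by have := ell_ge tau d in0; rewrite (ham_0 hH) !mulr0 subr0. Qed.

Lemma ell_geN tau d : - (r * d) <= ell H r tau d.
Proof.
by have := ell_ge tau d inr; rewrite (ham_Nr hH) mulr0 subr0 mulrN mulrC.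
Qed.

Lemma ell_lip tau d tau' d' :
  ell H r tau d <= ell H r tau' d' + r * `|d - d'| + m * r * `|tau - tau'|.
Proof.
apply: ell_le => p pr; have := ell_ge tau' d' pr.
have h1 : (d - d') * p <= r * `|d - d'|.
  apply: (le_trans (ler_norm _)); rewrite normrM mulrC ler_wpM2r//.
  by case/andP: pr => p1 p0; rewrite ler0_norm// lerNl.
have h2 : (tau' - tau) * H p <= m * r * `|tau - tau'|.
  apply: (le_trans (ler_norm _)); rewrite normrM distrC mulrC ler_wpM2r//.
  apply: (le_trans (Hbound pr)); apply: ler_wpM2l; first exact: ltW.
  by case/andP: pr; lra.
move: h1 h2; lra.
Qed.

Lemma ell_hom k tau d : 0 <= k -> ell H r (k * tau) (k * d) = k * ell H r tau d.
Proof.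
rewrite le_eqVlt => /orP[/eqP<-|k0].
  rewrite !mul0r; apply/eqP; rewrite eq_le ell_ge0 andbT.
  by apply: ell_le => p _; rewrite !mul0r subr0.
apply/eqP; rewrite eq_le; apply/andP; split.
  apply: ell_le => p pr.
  have -> : k * d * p - k * tau * H p = k * (d * p - tau * H p) by ring.
  by rewrite ler_pM2l// ell_ge.
rewrite -ler_pdivlMl//; apply: ell_le => p pr; rewrite ler_pdivlMl//.
have -> : k * (d * p - tau * H p) = k * d * p - k * tau * H p by ring.
exact: ell_ge.
Qed.

Lemma ell_lagrangian tau d : 0 < tau -> tau * lagrangian H r (d / tau) = ell H r tau d.
Proof.
move=> t0; rewrite lagrangianE -ell_hom ?ltW// mulr1 mulrCA divff ?mulr1//.
by rewrite gt_eqF.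
Qed.

Lemma ell_wait tau : 0 <= tau -> - a0 * tau <= ell H r tau 0.
Proof.
move=> t0; have [p pr pa] := ham_min hH; have := ell_ge tau 0 pr.
by apply: le_trans; rewrite mul0r sub0r mulNr lerN2 mulrC ler_wpM2r.
Qed.

(** [H] vanishes at 0 and is [m]-Lipschitz, so [d * p - tau * H p <= (d - m * tau) * p <= 0], and
    the supremum sits at the end point [p = 0]. *)
Lemma ell_fast_right tau d : 0 <= tau -> m * tau <= d -> ell H r tau d = 0.
Proof.
move=> t0 td; apply/eqP; rewrite eq_le ell_ge0 andbT; apply: ell_le => p pr.
have h1 : - (tau * H p) <= tau * (m * - p).
  by rewrite -(mulrN tau); apply: ler_wpM2l => //; rewrite (le_trans (ler_norm _))// normrN Hbound.
have h2 : (d - m * tau) * p <= 0 by case/andP: pr => _ ?; nra.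
lra.
Qed.

(** The mirror image: the supremum now sits at the other zero [- r] of [H]. *)
Lemma ell_fast_left tau d : 0 <= tau -> d <= - (m * tau) -> ell H r tau d = - (r * d).
Proof.
move=> t0 td; apply/eqP; rewrite eq_le ell_geN andbT; apply: ell_le => p pr.
have h1 : - (tau * H p) <= tau * (m * (p + r)).
  by rewrite -(mulrN tau); apply: ler_wpM2l => //; rewrite (le_trans (ler_norm _))// normrN Hbound'.
have h2 : (d + m * tau) * (p + r) <= 0 by case/andP: pr => ? _; nra.
lra.
Qed.

(** The conjugate of a strongly convex function has a Lipschitz derivative. Here the supremum at the
    interpolated displacement is tested with the interpolated momentum; the loss
    [l * (1 - l) * (x - y) * (p - q)] is absorbed by strong convexity up to the quadratic term. *)
Lemma ell_semiconcave tau x y l : 0 < tau -> 0 <= l <= 1 ->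
  l * ell H r tau x + (1 - l) * ell H r tau y <=
  ell H r tau (l * x + (1 - l) * y) + (4 * c * tau)^-1 * (l * (1 - l)) * (x - y) ^+ 2.
Proof.
move=> t0 /andP[l0 l1]; set z := l * x + _; set K := (4 * c * tau)^-1.
have l1' : 0 <= 1 - l by lra.
have key p q : - r <= p <= 0 -> - r <= q <= 0 ->
    l * (x * p - tau * H p) + (1 - l) * (y * q - tau * H q) <=
    ell H r tau z + K * (l * (1 - l)) * (x - y) ^+ 2.
  move=> pr qr; have pqr : - r <= l * p + (1 - l) * q <= 0.
    by case/andP: pr => p1 p2; case/andP: qr => q1 q2; apply/andP; split; nra.
  have := ell_ge tau z pqr.
  have := ham_convex hH pr qr; move=> /(_ l); rewrite l0 l1 => /(_ isT) cv.
  (* Young's inequality: [K] is such that the square [K * (x - y - 2 * (c * tau) * (p - q)) ^+ 2]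
     has cross term exactly [- (x - y) * (p - q)]. *)
  have amgm : (x - y) * (p - q) <= tau * c * (p - q) ^+ 2 + K * (x - y) ^+ 2.
    have K0 : 0 < 4 * c * tau by rewrite !mulr_gt0.
    have KK : K * (4 * c * tau) = 1 by rewrite mulVf// gt_eqF.
    have K1 : 0 < K by rewrite invr_gt0.
    have : 0 <= K * (x - y - 2 * (c * tau) * (p - q)) ^+ 2.
      by rewrite mulr_ge0 ?sqr_ge0// ltW.
    have -> : K * (x - y - 2 * (c * tau) * (p - q)) ^+ 2 =
      K * (x - y) ^+ 2 - K * (4 * c * tau) * ((x - y) * (p - q)) +
      K * (4 * c * tau) * (c * tau * (p - q) ^+ 2) by ring.
    rewrite KK; lra.
  have := ler_wpM2l (ltW t0) cv.
  have := ler_wpM2l (mulr_ge0 l0 l1') amgm.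
  rewrite /z; set u := ell _ _ _ _; lra.
apply/ler_addgt0Pr => e e0.
have [p pr pe] := ell_adherent tau x e0.
have [q qr qe] := ell_adherent tau y e0.
have := key _ _ pr qr; have := ler_wpM2l l0 (ltW pe); have := ler_wpM2l l1' (ltW qe).
by set u := ell _ _ _ x; set v := ell _ _ _ y; set w := ell _ _ _ z; lra.
Qed.

(** Either [tau >= delta / m], which bounds the constant [(4 * c * tau)^-1], or both displacements
    are so fast that they lie where [ell] is linear. *)
Lemma ell_semiconcave_away delta tau x y l : 0 < delta -> 0 <= tau ->
  delta <= x /\ delta <= y \/ x <= - delta /\ y <= - delta -> 0 <= l <= 1 ->
  l * ell H r tau x + (1 - l) * ell H r tau y <=
  ell H r tau (l * x + (1 - l) * y) + m / (4 * c * delta) * (l * (1 - l)) * (x - y) ^+ 2.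
Proof.
move=> d0 t0 xy l01; have [l0 l1] := andP l01.
have ll : 0 <= l * (1 - l) by rewrite mulr_ge0// subr_ge0.
have K0 : 0 < m / (4 * c * delta) by rewrite divr_gt0// !mulr_gt0.
have rest0 : 0 <= m / (4 * c * delta) * (l * (1 - l)) * (x - y) ^+ 2.
  by rewrite mulr_ge0 ?sqr_ge0// mulr_ge0// ltW.
have [dt|dt] := leP delta (m * tau).
  have t1 : 0 < tau by rewrite -(pmulr_rgt0 _ m0); exact: lt_le_trans dt.
  apply: (le_trans (ell_semiconcave x y t1 l01)); rewrite lerD2l.
  rewrite ler_wpM2r ?sqr_ge0// ler_wpM2r//.
  rewrite ler_pdivlMr ?mulr_gt0// mulrC ler_pdivrMr ?mulr_gt0//.
  have := ler_wpM2l (ltW c0) dt; nra.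
case: xy => -[xd yd].
  rewrite !ell_fast_right ?(le_trans (ltW dt))//; last by nra.
  by rewrite !mulr0 !add0r.
rewrite !ell_fast_left//; [|nra..].
by rewrite -[X in X <= _]addr0 lerD//; lra.
Qed.

End ell.

(** * Uniformly convex functions of class C^2 *)

Section uniformly_convex_theory.
Context {R : realType}.

(** The mean value theorem twice: [derive1 f] grows at rate at least [k], so on either side of [x]
    the remainder [G], which vanishes at [x], has the sign of a square. *)
Lemma C2_tangent (f : R -> R) (k : R) : C2 f -> (forall x, k <= derive1 (derive1 f) x) ->
  forall x y, f x + derive1 f x * (y - x) + k / 2 * (y - x) ^+ 2 <= f y.
Proof.
move=> [df [ddf _]] kf.
have mono x y : x <= y -> k * (y - x) <= derive1 f y - derive1 f x.
  move=> xy.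
  have [||c _ ->] := @MVT_segment R (derive1 f) (derive1 (derive1 f)) x y xy.
  - by move=> z _; rewrite [X in is_derive _ _ _ X]derive1E; exact/derivableP/ddf.
  - by apply: continuous_subspaceT => z; exact/differentiable_continuous/derivable1_diffP/ddf.
  - by rewrite ler_wpM2r// subr_ge0.
move=> x y.
pose G (z : R) := f z - (f x + derive1 f x * (z - x) + k / 2 * (z - x) ^+ 2).
have dG (z : R) : is_derive z 1 G (derive1 f z - derive1 f x - k * (z - x)).
  have dfz : is_derive z 1 f (derive1 f z) by rewrite derive1E; exact/derivableP/df.
  rewrite /G; apply: is_derive_eq.
  by rewrite /GRing.scale /=; field.
have cG a b : {within `[a, b], continuous G}.
  by apply: continuous_subspaceT => z; exact/differentiable_continuous/derivable1_diffP.
have Gx : G x = 0 by rewrite /G; ring.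
suff : 0 <= G y by rewrite /G; lra.
have [xy|yx] := leP x y.
- have [c] := MVT_segment xy (fun z _ => dG z) (cG _ _).
  rewrite in_itv/= => /andP[xc cy]; rewrite Gx subr0 => ->.
  by have := mono _ _ xc; rewrite -subr_ge0 => h; apply: mulr_ge0; lra.
- have [c] := MVT_segment (ltW yx) (fun z _ => dG z) (cG _ _).
  rewrite in_itv/= => /andP[yc cx]; rewrite Gx sub0r => E.
  by have := mono _ _ cx; have := yx; nra.
Qed.

(** The quadratic lower bounds based at the intermediate point [z] are averaged: the slopes cancel
    and the squares add up to the stated term. *)
Lemma C2_strongly_convex (f : R -> R) (k : R) : C2 f ->
  (forall x, k <= derive1 (derive1 f) x) ->
  forall p q l, 0 <= l <= 1 ->
  f (l * p + (1 - l) * q) + k / 2 * (l * (1 - l)) * (p - q) ^+ 2 <=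
  l * f p + (1 - l) * f q.
Proof.
move=> f2 kf p q l /andP[l0 l1]; set z := l * p + _.
have tp := ler_wpM2l l0 (C2_tangent f2 kf z p).
have l1' : 0 <= 1 - l by rewrite subr_ge0.
have tq := ler_wpM2l l1' (C2_tangent f2 kf z q).
apply: le_trans (lerD tp tq).
rewrite -subr_ge0 le_eqVlt; apply/orP; left; apply/eqP; rewrite /z; field; exact: isT.
Qed.

Lemma uniformly_convex_hamiltonian (f : R -> R) (r : R) : C2 f -> uniformly_convex f ->
  0 < r -> f (- r) = 0 -> f 0 = 0 ->
  inf (range f) < 0 /\ exists m c, forall a0, inf (range f) <= a0 ->
    hamiltonian f r m c a0.
Proof.
move=> f2 [k k0 kf] r0 fNr f0.
have tg := C2_tangent f2 kf; have sc := C2_strongly_convex f2 kf.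
have tg1 x y : f x + derive1 f x * (y - x) <= f y.
  by apply: le_trans (tg x y); rewrite lerDl mulr_ge0 ?sqr_ge0// ltW// divr_gt0.
have cf : {within `[- r, 0], continuous f}.
  apply: continuous_subspaceT => z.
  by case: f2 => df _; exact/differentiable_continuous/derivable1_diffP/df.
have [|p + pmin] := @EVT_min R f (- r) 0 _ cf; first by rewrite oppr_le0 ltW.
rewrite in_itv/= => pr.
have d0 : 0 <= derive1 f 0.
  by have := tg1 0 (- r); rewrite f0 fNr add0r subr0 mulrN oppr_le0 pmulr_lge0.
have dr : derive1 f (- r) <= 0.
  by have := tg1 (- r) 0; rewrite f0 fNr add0r sub0r opprK pmulr_lle0.
(* The tangents at the two zeros, of slope nonpositive at [- r] and nonnegative at 0, keep [f]
   nonnegative outside [[- r, 0]]: the minimum over the segment is global. *)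
have fp x : f p <= f x.
  have fp0 : f p <= 0 by rewrite -f0; apply: pmin; rewrite in_itv/= lexx oppr_le0 ltW.
  have [xr|xr] := ltP x (- r).
    apply: (le_trans fp0); have := tg1 (- r) x; rewrite fNr; apply: le_trans; nra.
  have [x0|x0] := ltP 0 x.
    apply: (le_trans fp0); have := tg1 0 x; rewrite f0; apply: le_trans; nra.
  by apply: pmin; rewrite in_itv/= xr.
have fpinf : f p <= inf (range f).
  by apply: lb_le_inf; [exists (f p), p|move=> _ [x _ <-]].
split.
  (* Strong convexity makes [f] negative at the midpoint of its two zeros. *)
  apply: (@le_lt_trans _ _ (f (- (r / 2)))).
    by apply: ge_inf; [exists (f p) => _ [x _ <-]|exists (- (r / 2))].
  have H := sc (- r) 0 (1 / 2).
  rewrite fNr f0 !mulr0 !addr0 in H.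
  have E : 1 / 2 * - r = - (r / 2) by field.
  have h01 : (0 : R) <= (1 / 2 : R) <= (1 : R).
    by apply/andP; split; lra.
  have := H h01; rewrite E.
  have -> : k / 2 * (1 / 2 * (1 - 1 / 2)) * (- r - 0) ^+ 2 = k * r ^+ 2 / 8 by field.
  have : 0 < k * r ^+ 2 by rewrite mulr_gt0// exprn_gt0.
  lra.
(* [derive1 f] is monotone, so its end values bound it on [[- r, 0]]; adding 1 keeps [m]
   positive. *)
exists (`|derive1 f (- r)| + `|derive1 f 0| + 1), (k / 2) => a0 fa0.
have mono x y : x <= y -> derive1 f x <= derive1 f y.
  rewrite le_eqVlt => /predU1P[->//|xy].
  have := tg1 x y; have := tg1 y x => h1 h2.
  have : (derive1 f x - derive1 f y) * (y - x) <= 0 by lra.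
  by rewrite pmulr_lle0 ?subr_gt0// subr_le0.
split => //.
- by rewrite divr_gt0.
- have key x y : - r <= x <= 0 -> f x - f y <= 
    (`|derive1 f (- r)| + `|derive1 f 0| + 1) * `|x - y|.
    move=> /andP[rx x0]; have := tg1 x y => h.
    have : derive1 f x * (x - y) <= `|derive1 f x| * `|x - y|.
      by rewrite -normrM ler_norm.
    have : `|derive1 f x| <= `|derive1 f (- r)| + `|derive1 f 0| + 1.
      have := mono _ _ rx; have := mono _ _ x0 => h1 h2.
      have := ler_norm (derive1 f 0); have := ler_norm (- derive1 f (- r)).
      have := normr_ge0 (derive1 f 0); have := normr_ge0 (derive1 f (- r)).
      by rewrite normrN => *; rewrite ler_norml; lra.
    move=> /(ler_wpM2r (normr_ge0 (x - y))); lra.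
  move=> x y xr yr; rewrite ler_norml; apply/andP; split; last exact: key.
  by rewrite lerNl opprB distrC key.
- by move=> x y l _ _ ?; exact: sc.
- by exists p => //; exact: le_trans fa0.
Qed.

End uniformly_convex_theory.

(** * The value of the reduced problem *)

(** In other words, [f x - K * x ^+ 2] is concave. *)
Definition semiconcave {R : realType} (I : set R) (K : R) (f : R -> R) :=
  forall x y l, I x -> I y -> 0 <= l <= 1 ->
  l * f x + (1 - l) * f y <= f (l * x + (1 - l) * y) + K * (l * (1 - l)) * (x - y) ^+ 2.

Section value_formula.
Context {R : realType} (HL HR : R -> R) (RL RR mL mR cL cR a0 : R) (u0 : R -> R).
Context (hL : hamiltonian HL RL mL cL a0) (hR : hamiltonian HR RR mR cR a0).
Context (u0l : forall y, y <= 0 -> u0 0 <= u0 y)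
        (u0r : forall y, 0 <= y -> u0 0 - RR * y <= u0 y).
Implicit Types (F : R -> R) (x t y a b e : R).

(** For a starting point at 0 the choice of the side is harmless: waiting there at once costs no
    more than resting on either side. *)
Definition ell_at x := if 0 < x then ell HR RR else ell HL RL.

(* Costs of the candidate minimisers when [F] is a primitive of the control: straight
   lines on one side of the interface, and paths which reach it straight at time [a],
   wait until [b] and then go straight to [x]. *)
Definition configs F x t : set R := [set v |
  (exists y, 0 < y * x /\ v = ell_at x t (x - y) + u0 y) \/
  (exists a b y, [/\ 0 <= a, a <= b, b < t, 0 < a \/ y = 0 &
     v = ell_at y a (- y) + u0 y + (F a - F b) + ell_at x (t - b) x])].

Definition value_of F x t := inf (configs F x t).

Lemma ell_atP x : exists H r m c, hamiltonian H r m c a0 /\ ell_at x = ell H r.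
Proof.
rewrite /ell_at; case: ifPn => _; [by exists HR, RR, mR, cR|by exists HL, RL, mL, cL].
Qed.

Lemma ell_at_ge0 x tau d : 0 <= ell_at x tau d.
Proof. by have [H [r [m [c [hH ->]]]]] := ell_atP x; exact: (ell_ge0 hH). Qed.

Lemma ell_at_lip x : exists2 M, 0 < M & forall tau d tau' d',
  ell_at x tau d <= ell_at x tau' d' + M * (`|d - d'| + `|tau - tau'|).
Proof.
have [H [r [m [c [hH ->]]]]] := ell_atP x.
have r0 := ham_r hH; have m0 := ham_m hH.
exists (r + m * r) => [|tau d tau' d']; first by rewrite addr_gt0// mulr_gt0.
apply: (le_trans (ell_lip hH tau d tau' d')); rewrite -addrA lerD2l.
have := mulr_ge0 (ltW r0) (normr_ge0 (tau - tau')).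
have := mulr_ge0 (mulr_ge0 (ltW m0) (ltW r0)) (normr_ge0 (d - d')).
lra.
Qed.

(** The slope of [u0] enters here. To the left of 0 it is nonpositive; to the right its decrease, at
    rate at most [RR], is paid for by the cost, at least [RR * y], of coming back to 0. *)
Lemma start_ge y a : u0 0 <= ell_at y a (- y) + u0 y.
Proof.
rewrite /ell_at; case: ltP => y0.
  by have := ell_geN hR a (- y); have := u0r (ltW y0); lra.
by have := ell_ge0 hL a (- y); have := u0l y0; lra.
Qed.

(** A lower bound makes [inf] a genuine infimum; the last term bounds the waiting cost
    [F a - F b]. *)
Lemma configs_lb F CF x t v : (forall s, `|F s| <= CF) -> configs F x t v ->
  u0 0 - RR * `|x| - 2 * CF <= v.
Proof.
move=> FC.
have C0 : 0 <= CF by apply: le_trans (FC 0).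
have R0 := ham_r hR.
have rx : 0 <= RR * `|x| by rewrite mulr_ge0// ltW.
case=> [[y [yx ->]]|[a [b [y [_ _ _ _ ->]]]]].
  rewrite /ell_at; case: ltP => x0.
    move: yx; rewrite pmulr_lgt0// => y0.
    have := ell_geN hR t (x - y); have := u0r (ltW y0); rewrite gtr0_norm//; lra.
  have y0 : y <= 0 by rewrite leNgt; apply/negP => y0; move: yx; rewrite pmulr_rgt0//; lra.
  by have := ell_ge0 hL t (x - y); have := u0l y0; lra.
have := start_ge y a; have := ell_at_ge0 x (t - b) x.
by have := FC a; have := FC b; rewrite !ler_norml; lra.
Qed.

Lemma configs_nonempty F x t : 0 < t -> configs F x t !=set0.
Proof.
move=> t0; exists (ell_at 0 0 (- 0) + u0 0 + (F 0 - F 0) + ell_at x (t - 0) x).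
by right; exists 0, 0, 0; split => //; right.
Qed.

Lemma value_of_le F CF x t v : (forall s, `|F s| <= CF) -> configs F x t v ->
  value_of F x t <= v.
Proof.
move=> FC Fv; apply: ge_inf => //.
by exists (u0 0 - RR * `|x| - 2 * CF) => w; exact: configs_lb.
Qed.

Lemma value_of_ge F x t C : 0 < t -> (forall v, configs F x t v -> C <= v) ->
  C <= value_of F x t.
Proof. by move=> t0 CF; apply: lb_le_inf => //; exact: configs_nonempty. Qed.

Lemma value_of_adherent F CF x t e : 0 < t -> (forall s, `|F s| <= CF) -> 0 < e ->
  exists2 v, configs F x t v & v < value_of F x t + e.
Proof.
move=> t0 FC e0; apply: inf_adherent => //; split; first exact: configs_nonempty.
by exists (u0 0 - RR * `|x| - 2 * CF) => w; exact: configs_lb.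
Qed.

(** Both infima run over the same starts and waiting times, and [F] enters only through [F a - F b],
    whence the factor 2. *)
Lemma value_of_close F G CF CG x t e : 0 < t ->
  (forall s, `|F s| <= CF) -> (forall s, `|G s| <= CG) ->
  (forall s, 0 <= s <= t -> `|F s - G s| <= e) -> value_of F x t <= value_of G x t + 2 * e.
Proof.
move=> t0 FC GC FG.
have e0 : 0 <= e by apply: le_trans (FG 0 _) => //; rewrite lexx ltW.
rewrite -lerBlDr; apply: value_of_ge => // v [[y [yx ->]]|[a [b [y [a0' ab bt ay ->]]]]].
  rewrite lerBlDr (@le_trans _ _ (ell_at x t (x - y) + u0 y))//; last lra.
  by apply: (value_of_le FC); left; exists y.
rewrite lerBlDr.
have : value_of F x t <= ell_at y a (- y) + u0 y + (F a - F b) + ell_at x (t - b) x.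
  by apply: (value_of_le FC); right; exists a, b, y.
have /FG : 0 <= a <= t by rewrite a0' (le_trans ab (ltW bt)).
have /FG : 0 <= b <= t by rewrite (le_trans a0' ab) ltW.
by rewrite !ler_norml; lra.
Qed.

(** An infimum of functions with a common constant [K] is semiconcave: a configuration that reaches
    the intermediate point is reused, with the same start and waiting times, for both end points.
    [Isign] keeps it admissible, all end points being on one side. *)
Lemma value_of_semiconcave_on (I : set R) F CF t K : 0 < t -> (forall s, `|F s| <= CF) ->
  (forall x y, I x -> I y -> 0 < x * y) ->
  (forall x y l, I x -> I y -> 0 <= l <= 1 -> I (l * x + (1 - l) * y)) ->
  (forall x0 y, I x0 -> semiconcave I K (fun x => ell_at x0 t (x - y))) ->
  (forall x0 b, I x0 -> b < t -> semiconcave I K (fun x => ell_at x0 (t - b) x)) ->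
  semiconcave I K (value_of F ^~ t).
Proof.
move=> t0 FC Isign Iconv H1 H2 x y l Ix Iy l01; have Iz := Iconv _ _ _ Ix Iy l01.
have [l0 l1] := andP l01.
set z := l * x + _ in Iz *.
have Isign' w v : I w -> I v -> (0 < w) = (0 < v).
  move=> Iw Iv; have wv := Isign _ _ Iw Iv.
  by apply/idP/idP => h; [rewrite -(pmulr_rgt0 _ h)|rewrite -(pmulr_lgt0 _ h)].
have EI w v : I w -> I v -> ell_at w = ell_at v.
  by move=> Iw Iv; rewrite /ell_at (Isign' w v).
rewrite -lerBlDr; apply: value_of_ge => // v Fv; rewrite lerBlDr.
have l1' : 0 <= 1 - l by lra.
case: Fv => [[p [pz ->]]|[a [b [p [a0' ab bt ay ->]]]]].
  have pI w : I w -> value_of F w t <= ell_at z t (w - p) + u0 p.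
    move=> Iw; apply: (value_of_le FC); left; exists p; split; last by rewrite (EI w z).
    have zw := Isign _ _ Iz Iw.
    have [z0|z0] := ltP 0 z.
      move: pz zw; rewrite pmulr_lgt0// => p0; rewrite pmulr_rgt0// => w0.
      by rewrite mulr_gt0.
    have {}z0 : z < 0 by rewrite lt_neqAle z0 andbT; apply: contraTneq zw => ->; rewrite mul0r ltxx.
    by move: pz zw; rewrite nmulr_lgt0// => p0; rewrite nmulr_rgt0// => w0; rewrite nmulr_rgt0.
  have := H1 z p Iz x y l Ix Iy l01.
  have := ler_wpM2l l0 (pI _ Ix); have := ler_wpM2l l1' (pI _ Iy).
  rewrite -/z; lra.
have pI w : I w -> value_of F w t <= ell_at p a (- p) + u0 p + (F a - F b) + ell_at z (t - b) w.
  move=> Iw; apply: (value_of_le FC); right; exists a, b, p; split => //.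
  by rewrite (EI w z).
have := H2 z b Iz bt x y l Ix Iy l01.
have := ler_wpM2l l0 (pI _ Ix); have := ler_wpM2l l1' (pI _ Iy).
rewrite -/z; lra.
Qed.

(** A direct line takes the whole time [t] and has constant [(4 * c * t)^-1]; a final leg ends at
    distance [delta] from 0 and falls under [ell_semiconcave_away]. Adding the constants of both
    sides gives one [K], chosen before [F]. *)
Lemma value_of_semiconcave delta t : 0 < delta -> 0 < t -> exists K,
  forall F CF, (forall s, `|F s| <= CF) ->
  semiconcave [set x | delta < x] K (value_of F ^~ t) /\
  semiconcave [set x | x < - delta] K (value_of F ^~ t).
Proof.
move=> d0 t0.
have [? ? ? ?] := And4 (ham_c hL) (ham_c hR) (ham_m hL) (ham_m hR).
pose KL := (4 * cL * t)^-1 + mL / (4 * cL * delta).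
pose KR := (4 * cR * t)^-1 + mR / (4 * cR * delta).
have [L1 L2] : 0 < (4 * cL * t)^-1 /\ 0 < mL / (4 * cL * delta).
  by split; [rewrite invr_gt0|rewrite divr_gt0//]; rewrite !mulr_gt0.
have [R1 R2] : 0 < (4 * cR * t)^-1 /\ 0 < mR / (4 * cR * delta).
  by split; [rewrite invr_gt0|rewrite divr_gt0//]; rewrite !mulr_gt0.
have mono (k x y l : R) : k <= KL + KR -> 0 <= l <= 1 ->
    k * (l * (1 - l)) * (x - y) ^+ 2 <= (KL + KR) * (l * (1 - l)) * (x - y) ^+ 2.
  move=> kK /andP[l0 l1]; rewrite ler_wpM2r ?sqr_ge0// ler_wpM2r//.
  by rewrite mulr_ge0// subr_ge0.
have direct (I : set R) x0 y : semiconcave I (KL + KR) (fun x => ell_at x0 t (x - y)).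
  move=> p q l _ _ l01; have E : l * p + (1 - l) * q - y = l * (p - y) + (1 - l) * (q - y) by ring.
  have E2 : p - q = p - y - (q - y) by ring.
  rewrite E E2 /ell_at; case: ifPn => _.
    apply: (le_trans (ell_semiconcave hR (p - y) (q - y) t0 l01)).
    by rewrite lerD2l mono// /KL /KR; lra.
  apply: (le_trans (ell_semiconcave hL (p - y) (q - y) t0 l01)).
  by rewrite lerD2l mono// /KL /KR; lra.
have away (I : set R) x0 b : b < t ->
    (forall p q, I p -> I q -> delta <= p /\ delta <= q \/ p <= - delta /\ q <= - delta) ->
    semiconcave I (KL + KR) (fun x => ell_at x0 (t - b) x).
  move=> bt HI p q l Ip Iq l01.
  have tb : 0 <= t - b by rewrite subr_ge0 ltW.
  rewrite /ell_at; case: ifPn => _.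
    apply: (le_trans (ell_semiconcave_away hR d0 tb (HI _ _ Ip Iq) l01)).
    by rewrite lerD2l mono// /KL /KR; lra.
  apply: (le_trans (ell_semiconcave_away hL d0 tb (HI _ _ Ip Iq) l01)).
  by rewrite lerD2l mono// /KL /KR; lra.
exists (KL + KR) => F CF FC; split; apply: (value_of_semiconcave_on t0 FC) => //=.
- by move=> x y dx dy; rewrite mulr_gt0//; lra.
- move=> x y l dx dy /andP[l0]; rewrite le_eqVlt => /predU1P[->|l1]; nra.
- by move=> x0 b _ bt; apply: away => //= p q; left; split; apply: ltW.
- by move=> x y dx dy; rewrite nmulr_rgt0//; lra.
- move=> x y l dx dy /andP[l0]; rewrite le_eqVlt => /predU1P[->|l1]; nra.
- by move=> x0 b _ bt; apply: away => //= p q; right; split; apply: ltW.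
Qed.

(** An infimum of functions continuous in [(x, t)]: a configuration below [C] is kept and only its
    end is moved. This serves the Borel measurability of the value in [(x, t)]. *)
Lemma value_of_usc F CF x t C : x != 0 -> 0 < t -> (forall s, `|F s| <= CF) ->
  value_of F x t < C -> exists2 e, 0 < e & forall x' t', `|x' - x| < e -> `|t' - t| < e ->
    [/\ x' != 0, 0 < t' & value_of F x' t' < C].
Proof.
move=> x0 t0 FC VC.
have [|v Fv vC] := @value_of_adherent F CF x t (C - value_of F x t) t0 FC; first by rewrite subr_gt0.
rewrite subrKC in vC.
have [M M0 Mlip] := ell_at_lip x.
have near x' : `|x' - x| < `|x| -> [/\ x' != 0, 0 < x' * x & ell_at x' = ell_at x].
  move=> xx; have s : 0 < x' * x.
    have : 0 < `|x| by rewrite normr_gt0.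
    move: xx; rewrite ltr_norml; case: (ltP 0 x) => h; [rewrite gtr0_norm//|rewrite ler0_norm//]; nra.
  split => //; first by apply: contraTneq s => ->; rewrite mul0r ltxx.
  rewrite /ell_at; congr (if _ then _ else _); apply/idP/idP => h.
    by rewrite -(pmulr_rgt0 _ h).
  by rewrite -(pmulr_lgt0 _ h).
(* The first bound keeps [x'] on the side of [x], the second keeps the change of cost below
   [C - v]. *)
pose e1 := Num.min `|x| ((C - v) / (2 * M)).
have e10 : 0 < e1 by rewrite lt_min normr_gt0 x0 divr_gt0 ?mulr_gt0// subr_gt0.
have small x' t' : `|x' - x| < e1 -> `|t' - t| < e1 -> M * (`|x' - x| + `|t' - t|) < C - v.
  rewrite !lt_min => /andP[_]; rewrite ltr_pdivlMr ?mulr_gt0// => h1 /andP[_].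
  by rewrite ltr_pdivlMr ?mulr_gt0// => h2; lra.
case: Fv => [[y [yx vE]]|[a [b [y [a0' ab bt ay vE]]]]].
  exists (Num.min e1 t) => [|x' t']; first by rewrite lt_min e10.
  rewrite !(lt_min _ e1) => /andP[xe _] /andP[te tt].
  have xx : `|x' - x| < `|x| by move: xe; rewrite lt_min => /andP[].
  have [x'0 xx' Ex] := near _ xx.
  have t'0 : 0 < t' by move: tt; rewrite ltr_norml; lra.
  split => //; apply: (@le_lt_trans _ _ (ell_at x t' (x' - y) + u0 y)).
    apply: (value_of_le FC); left; exists y; rewrite Ex; split => //.
    have [h|h] := ltP 0 x.
      by rewrite mulr_gt0// -(pmulr_lgt0 _ h).
    have {}h : x < 0 by rewrite lt_neqAle x0.
    by rewrite nmulr_rgt0 -(nmulr_lgt0 _ h).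
  have := small _ _ xe te; have := Mlip t' (x' - y) t (x - y).
  have -> : x' - y - (x - y) = x' - x by ring.
  by rewrite vE; lra.
exists (Num.min e1 (t - b)) => [|x' t']; first by rewrite lt_min e10 subr_gt0.
rewrite !(lt_min _ e1) => /andP[xe _] /andP[te tt].
have xx : `|x' - x| < `|x| by move: xe; rewrite lt_min => /andP[].
have [x'0 xx' Ex] := near _ xx.
have bt' : b < t' by move: tt; rewrite ltr_norml; lra.
split => //; first by apply: le_lt_trans bt'; apply: le_trans ab.
apply: (@le_lt_trans _ _ (ell_at y a (- y) + u0 y + (F a - F b) + ell_at x (t' - b) x')).
  by apply: (value_of_le FC); right; exists a, b, y; rewrite Ex.
have := small _ _ xe te; have := Mlip (t' - b) x' (t - b) x.
have -> : t' - b - (t - b) = t' - t by ring.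
by rewrite vE; lra.
Qed.

End value_formula.

(** * Semiconcave functions *)

Section semiconcave_theory.
Context {R : realType}.
Implicit Types (f g : R -> R) (x y h e K : R).

Definition quotient f x h := (f (x + h) - f x) / h.

Lemma quotient_derivable f x D :
  (forall e, 0 < e -> exists2 d, 0 < d & forall h, h != 0 -> `|h| < d ->
     `|quotient f x h - D| < e) ->
  derivable f x 1 /\ derive1 f x = D.
Proof.
move=> H.
have cD : (fun h => h^-1 *: (f (h + x) - f x)) @ 0^' --> D.
  apply/cvgrPdist_lt => e e0; have [d d0 Hd] := H e e0.
  near=> h; rewrite distrC.
  have h0 : h != 0 by near: h; exact: nbhs_dnbhs_neq.
  have hd : `|h| < d by near: h; apply: dnbhs0_lt.
  by have := Hd h h0 hd; rewrite /quotient addrC (addrC h) [_ / h]mulrC addrC.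
split; last by rewrite /derive1; exact: cvg_lim cD.
apply/cvg_ex; exists D; rewrite /= (_ : (fun h => _) = (fun h => h^-1 *: (f (h + x) - f x)))//.
by apply/funext => h /=; rewrite /GRing.scale/= mulr1.
Unshelve. all: by end_near. Qed.

Lemma derivable_quotient f x : derivable f x 1 ->
  forall e, 0 < e -> exists2 d, 0 < d & forall h, h != 0 -> `|h| < d ->
     `|quotient f x h - derive1 f x| < e.
Proof.
move=> df e e0.
have cD : (fun h => h^-1 *: (f (h + x) - f x)) @ 0^' --> derive1 f x.
  move: df; rewrite /derivable /derive1/=.
  rewrite (_ : (fun h => _) = (fun h => h^-1 *: (f (h + x) - f x)))//.
  by apply/funext => h /=; rewrite /GRing.scale/= mulr1.
move/cvgrPdist_lt : cD => /(_ e e0); rewrite near_withinE => -[d /= d0 Hd].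
exists d => // h h0 hd; rewrite distrC.
have := Hd h; rewrite /= sub0r normrN => /(_ hd h0).
by rewrite /quotient addrC (addrC h) [_ / h]mulrC addrC.
Qed.

Context (I : set R) (Iint : forall x, I x -> exists2 d, 0 < d & forall y, `|y - x| < d -> I y).

Section one.
Context (K : R) (f : R -> R) (fK : semiconcave I K f).

(** Chord slopes of the concave [f x - K * x ^+ 2] decrease; the quadratic contributes
    [K * ((z + y) - (y + x))]. *)
Lemma semiconcave_chord x y z : I x -> I z -> x < y -> y < z ->
  (f z - f y) / (z - y) <= (f y - f x) / (y - x) + K * (z - x).
Proof.
move=> Ix Iz xy yz.
have zx : 0 < z - x by lra.
have zx0 : z - x != 0 by rewrite gt_eqF.
pose l := (z - y) / (z - x).
have l01 : 0 <= l <= 1.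
  by rewrite /l divr_ge0 ?ler_pdivrMr ?mul1r//; lra.
have := fK Ix Iz l01.
have -> : l * x + (1 - l) * z = y by rewrite /l; field.
have -> : K * (l * (1 - l)) * (x - z) ^+ 2 = K * (z - y) * (y - x) by rewrite /l; field.
have -> : l * f x + (1 - l) * f z = ((z - y) * f x + (y - x) * f z) / (z - x).
  by rewrite /l; field.
rewrite ler_pdivrMr// => H.
have yx0 : 0 < y - x by lra.
have yz0 : 0 < z - y by lra.
rewrite -subr_ge0.
have -> : (f y - f x) / (y - x) + K * (z - x) - (f z - f y) / (z - y) =
  ((f y + K * (z - y) * (y - x)) * (z - x) - ((z - y) * f x + (y - x) * f z)) /
  ((y - x) * (z - y)) by field; rewrite !gt_eqF.
by rewrite divr_ge0 ?subr_ge0// mulr_ge0// ltW.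
Qed.

(* Up to the constant [2 * K * x], the difference quotient of the concave function
   [f y - K * y ^+ 2]. *)
Let q x h := quotient f x h - K * h.

(** Three cases, according to the position of 0 with respect to [h] and [k]; each is one comparison
    of consecutive chords. *)
Let q_mono x h k : I x -> I (x + h) -> I (x + k) -> h != 0 -> k != 0 -> h <= k -> q x k <= q x h.
Proof.
move=> Ix Ih Ik h0 k0; rewrite le_eqVlt => /predU1P[->//|hk].
have [hn|hp] := ltP h 0.
  have [kn|kp] := ltP k 0.
    have xk : x + h < x + k by lra.
    have kx : x + k < x by lra.
    have := semiconcave_chord Ih Ix xk kx.
    have k0' : 0 < - k by lra.
    have hk0 : 0 < k - h by lra.
    set a := f (x + h); set b := f (x + k); set c := f x.
    rewrite /q /quotient -/a -/b -/c.
    have -> : x - (x + k) = - k by ring.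
    have -> : x + k - (x + h) = k - h by ring.
    have -> : x - (x + h) = - h by ring.
    move=> H; rewrite -subr_ge0.
    have -> : (a - c) / h - K * h - ((b - c) / k - K * k) =
       ((b - a) / (k - h) + K * - h - (c - b) / - k) * ((k - h) / - h).
      by field; rewrite k0 h0 gt_eqF.
    by rewrite mulr_ge0 ?subr_ge0// divr_ge0; lra.
  have {}kp : 0 < k by rewrite lt_neqAle eq_sym k0.
  have xh : x + h < x by lra.
  have xk : x < x + k by lra.
  have := semiconcave_chord Ih Ik xh xk.
  set a := f (x + h); set b := f (x + k); set c := f x.
  rewrite /q /quotient -/a -/b -/c.
  have -> : x + k - x = k by ring.
  have -> : x - (x + h) = - h by ring.
  have -> : x + k - (x + h) = k - h by ring.
  have -> : (a - c) / h = (c - a) / - h by field.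
  lra.
have {}hp : 0 < h by rewrite lt_neqAle eq_sym h0.
have xh : x < x + h by lra.
have hx : x + h < x + k by lra.
have := semiconcave_chord Ix Ik xh hx.
have hk0 : 0 < k - h by lra.
set a := f (x + h); set b := f (x + k); set c := f x.
rewrite /q /quotient -/a -/b -/c.
have -> : x + k - (x + h) = k - h by ring.
have -> : x + h - x = h by ring.
have -> : x + k - x = k by ring.
move=> H; rewrite -subr_ge0.
have -> : (a - c) / h - K * h - ((b - c) / k - K * k) =
   ((a - c) / h + K * k - (b - a) / (k - h)) * ((k - h) / k).
  by field; rewrite k0 h0 gt_eqF.
by rewrite mulr_ge0 ?subr_ge0// divr_ge0; lra.
Qed.

(** As [q x] is nonincreasing, [sup (right x)] and [inf (left x)] are the right and left derivatives
    of [f] at [x]. *)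
Let right x := [set q x h | h in [set h | 0 < h /\ I (x + h)]].
Let left x := [set q x h | h in [set h | h < 0 /\ I (x + h)]].

Let step x : I x -> exists2 h, 0 < h & forall k, `|k| <= h -> I (x + k).
Proof.
move=> /Iint[d d0 Hd]; exists (d / 2) => [|k kd]; first by rewrite divr_gt0.
by apply: Hd; rewrite addrAC subrr add0r (le_lt_trans kd)// ltr_pdivrMr// ltr_pMr// ltr1n.
Qed.

Let right_sup x : I x -> has_sup (right x).
Proof.
move=> Ix; have [h h0 Hh] := step Ix; split.
  by exists (q x h), h => //; split => //; apply: Hh; rewrite gtr0_norm.
exists (q x (- h)) => _ [k [k0 Ik] <-]; apply: q_mono => //.
- by apply: Hh; rewrite normrN gtr0_norm.
- by rewrite oppr_eq0 gt_eqF.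
- by rewrite gt_eqF.
- lra.
Qed.

Let left_inf x : I x -> has_inf (left x).
Proof.
move=> Ix; have [h h0 Hh] := step Ix; split.
  by exists (q x (- h)), (- h) => //; split; [rewrite oppr_lt0|apply: Hh; rewrite normrN gtr0_norm].
exists (q x h) => _ [k [k0 Ik] <-]; apply: q_mono => //.
- by apply: Hh; rewrite gtr0_norm.
- by rewrite lt_eqF.
- by rewrite gt_eqF.
- lra.
Qed.

Let derivable_at x : I x -> inf (left x) <= sup (right x) -> derivable f x 1.
Proof.
move=> Ix lr; apply: (proj1 (@quotient_derivable f x (sup (right x)) _)) => e e0.
have e2 : 0 < e / 2 by rewrite divr_gt0.
have [_ [h [h0 Ih] <-] hD] := sup_adherent e2 (right_sup Ix).
have [_ [k [k0 Ik] <-] kD] := inf_adherent e2 (left_inf Ix).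
have [d d0 Hd] := step Ix.
have Kp : 0 < `|K| + 1 by rewrite ltr_wpDl.
exists (Num.min d (Num.min h (Num.min (- k) (e / 2 / (`|K| + 1))))).
  by rewrite !lt_min d0 h0 oppr_gt0 k0 divr_gt0.
move=> t t0; rewrite !lt_min => /and4P[td th tk te].
have It : I (x + t) by apply: Hd; exact: ltW.
have Kt : `|K * t| <= e / 2.
  move: te; rewrite ltr_pdivlMr// normrM => te.
  by have := normr_ge0 t; lra.
have -> : quotient f x t - sup (right x) = q x t - sup (right x) + K * t by rewrite /q; ring.
move: Kt; rewrite ler_norml => /andP[Kt1 Kt2].
have [tn|tp] := ltP t 0.
  have q1 : q x t <= q x k.
    apply: q_mono => //; first by rewrite lt_eqF.
    by move: tk; rewrite ltr0_norm//; lra.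
  have q2 : inf (left x) <= q x t.
    by apply: ge_inf; [case: (left_inf Ix)|exists t].
  have q3 : sup (right x) <= q x t.
    apply: ge_sup; first by case: (right_sup Ix).
    by move=> _ [s [s0 Is] <-]; apply: q_mono => //; [rewrite gt_eqF|lra].
  by rewrite ltr_norml; apply/andP; split; lra.
have {}tp : 0 < t by rewrite lt_neqAle eq_sym t0.
have q1 : q x h <= q x t.
  apply: q_mono => //; first by rewrite gt_eqF.
  by move: th; rewrite gtr0_norm//; lra.
have q2 : q x t <= sup (right x).
  by apply: ub_le_sup; [case: (right_sup Ix)|exists t].
by rewrite ltr_norml; apply/andP; split; lra.
Qed.

(** At a kink the one-sided derivatives of the concave [f x - K * x ^+ 2] enclose a gap. Gaps at
    different points are disjoint, so a rational picked in each makes the kinks countable;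
    [2 * K * x] translates between [f] and that function. *)
Lemma semiconcave_derivable : countable [set x | I x /\ ~ derivable f x 1].
Proof.
have /choice[r Hr] : forall x, exists r : rat, I x /\ ~ derivable f x 1 ->
    sup (right x) < ratr r + 2 * K * x < inf (left x).
  move=> x; have [[Ix ndf]|nx] := pselect (I x /\ ~ derivable f x 1); last by exists 0.
  have : sup (right x) < inf (left x).
    by rewrite ltNge; apply/negP => /(derivable_at Ix).
  rewrite -(ltrD2r (- (2 * K * x))) => /rat_in_itvoo[r].
  by rewrite in_itv/= => rr; exists r => _; lra.
apply/countable_injP; exists (fun x => pickle (r x)) => x y /set_mem Ex /set_mem Ey rxy.
have {rxy}rxy : r x = r y by apply: (pcan_inj (@pickleK _)); exact: rxy.
have key u v : I u /\ ~ derivable f u 1 -> I v /\ ~ derivable f v 1 -> u < v -> r u = r v -> False.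
  move=> Eu Ev uv ruv; have /andP[u1 _] := Hr u Eu; have /andP[_ v2] := Hr v Ev.
  have [Iu _] := Eu; have [Iv _] := Ev.
  have : q u (v - u) <= sup (right u).
    apply: ub_le_sup; first by case: (right_sup Iu).
    by exists (v - u) => //; split; [lra|rewrite subrKC].
  have : inf (left v) <= q v (u - v).
    apply: ge_inf; first by case: (left_inf Iv).
    by exists (u - v) => //; split; [lra|rewrite subrKC].
  (* The chord from [u] to [v], read from either end. *)
  have -> : q v (u - v) = q u (v - u) + 2 * K * (v - u).
    rewrite /q /quotient !subrKC; field; rewrite !subr_eq0.
    by rewrite (lt_eqF uv) (gt_eqF uv).
  rewrite ruv in u1; lra.
have [xy|yx|//] := ltgtP x y; first by have := key _ _ Ex Ey xy rxy.
by have := key _ _ Ey Ex yx (esym rxy).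
Qed.

(** By monotonicity a quotient of positive step bounds the derivative up to [K * h]. Such a bound
    involves only values of [f], so pointwise convergence of functions will suffice to control their
    derivatives. *)
Lemma semiconcave_derive_ge x h : I x -> derivable f x 1 -> 0 < h -> I (x + h) ->
  quotient f x h - K * h <= derive1 f x.
Proof.
move=> Ix df h0 Ih; apply/ler_addgt0Pr => e e0.
have e2 : 0 < e / 2 by rewrite divr_gt0.
have [d d0 Hd] := derivable_quotient df e2.
have [d' d'0 Hd'] := step Ix.
have Kp : 0 < `|K| + 1 by rewrite ltr_wpDl.
pose k := Num.min (d / 2) (Num.min d' (Num.min h (e / 2 / (`|K| + 1)))).
have k0 : 0 < k by rewrite !lt_min !divr_gt0// d'0 h0.
have : `|k| <= k by rewrite gtr0_norm.
rewrite {2}/k !le_min => /and4P[kd kd' kh ke].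
have Ik : I (x + k) by exact: Hd'.
have kn0 : k != 0 by rewrite gt_eqF.
have /Hd-/(_ kn0) : `|k| < d by apply: (le_lt_trans kd); lra.
have : q x h <= q x k.
  by apply: q_mono => //; [rewrite gt_eqF|rewrite -(gtr0_norm k0)].
move: ke; rewrite ler_pdivlMr// => ke.
have Kk : `|K * k| <= e / 2 by rewrite normrM; have := normr_ge0 k; lra.
by move: Kk; rewrite /q ler_norml ltr_norml; lra.
Qed.

Lemma semiconcave_derive_le x h : I x -> derivable f x 1 -> 0 < h -> I (x - h) ->
  derive1 f x <= quotient f x (- h) + K * h.
Proof.
move=> Ix df h0 Ih; apply/ler_addgt0Pr => e e0.
have e2 : 0 < e / 2 by rewrite divr_gt0.
have [d d0 Hd] := derivable_quotient df e2.
have [d' d'0 Hd'] := step Ix.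
have Kp : 0 < `|K| + 1 by rewrite ltr_wpDl.
pose k := Num.min (d / 2) (Num.min d' (Num.min h (e / 2 / (`|K| + 1)))).
have k0 : 0 < k by rewrite !lt_min !divr_gt0// d'0 h0.
have : `|k| <= k by rewrite gtr0_norm.
rewrite {2}/k !le_min => /and4P[kd kd' kh ke].
have Ik : I (x + - k) by apply: Hd'; rewrite normrN.
have kn0 : - k != 0 by rewrite oppr_eq0 gt_eqF.
have /Hd-/(_ kn0) : `|- k| < d by rewrite normrN; apply: (le_lt_trans kd); lra.
have : q x (- k) <= q x (- h).
  by apply: q_mono => //; [rewrite oppr_eq0 gt_eqF|rewrite lerN2 -(gtr0_norm k0)].
move: ke; rewrite ler_pdivlMr// => ke.
have Kk : `|K * k| <= e / 2 by rewrite normrM; have := normr_ge0 k; lra.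
by move: Kk; rewrite /q ler_norml ltr_norml; lra.
Qed.

End one.

(** A fixed small step [k] squeezes each derivative between a left and a right quotient. The error
    [K * k] does not depend on [n] because [K] does not, so [k] is chosen first and [n]
    afterwards. *)
Lemma semiconcave_cvg_derive K (f_ : nat -> R -> R) f x :
  (forall n, semiconcave I K (f_ n)) -> semiconcave I K f ->
  (forall y, I y -> f_ ^~ y @ \oo --> f y) -> I x ->
  (forall n, derivable (f_ n) x 1) -> derivable f x 1 ->
  (fun n => derive1 (f_ n) x) @ \oo --> derive1 f x.
Proof.
move=> fnK fK cf Ix dfn df; apply/cvgrPdist_le => e e0.
have e2 : 0 < e / 3 by rewrite divr_gt0.
have [d d0 Hd] := derivable_quotient df e2.
have [d' d'0 Hd'] := Iint Ix.
have Kp : 0 < `|K| + 1 by rewrite ltr_wpDl.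
pose k := Num.min (d / 2) (Num.min (d' / 2) (e / 3 / (`|K| + 1))).
have k0 : 0 < k by rewrite !lt_min !divr_gt0.
have : `|k| <= k by rewrite gtr0_norm.
rewrite {2}/k !le_min => /and3P[kd kd' ke].
have kd0 : `|k| < d by apply: (le_lt_trans kd); lra.
have kd'0 : `|k| < d' by apply: (le_lt_trans kd'); lra.
have Ik : I (x + k) by apply: Hd'; rewrite addrAC subrr add0r.
have Ink : I (x + - k) by apply: Hd'; rewrite addrAC subrr add0r normrN.
have kn0 : k != 0 by rewrite gt_eqF.
have nkn0 : - k != 0 by rewrite oppr_eq0 gt_eqF.
have := Hd _ kn0 kd0; have := Hd _ nkn0; rewrite normrN => /(_ kd0) q1 q2.
move: ke; rewrite ler_pdivlMr// => ke.
have Kk : `|K * k| <= e / 3 by rewrite normrM; have := normr_ge0 k; lra.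
have cq h : I (x + h) -> h != 0 -> (fun n => quotient (f_ n) x h) @ \oo --> quotient f x h.
  by move=> Ih h0; apply: cvgMl; apply: cvgB; exact: cf.
have := cq _ Ik kn0; have := cq _ Ink nkn0.
move=> /cvgrPdist_le/(_ _ e2) c1 /cvgrPdist_le/(_ _ e2) c2.
near=> n.
have n1 : `|quotient f x (- k) - quotient (f_ n) x (- k)| <= e / 3 by near: n.
have n2 : `|quotient f x k - quotient (f_ n) x k| <= e / 3 by near: n.
have := semiconcave_derive_ge (fnK n) Ix (dfn n) k0 Ik.
have := semiconcave_derive_le (fnK n) Ix (dfn n) k0 Ink.
move: n1 n2 Kk (ltW q1) (ltW q2); rewrite !ler_norml; lra.
Unshelve. all: by end_near. Qed.

End semiconcave_theory.

(** * Measurability *)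

(** Such a set is a union of rational boxes, of which there are countably many, and a box belongs to
    the product sigma-algebra. *)
Lemma boxopen_measurable {R : realType} (A : set (measurableTypeR R * measurableTypeR R)) :
  (forall z, A z -> exists2 e : R, 0 < e &
     forall x t, `|x - z.1| < e -> `|t - z.2| < e -> A (x, t)) ->
  measurable A.
Proof.
move=> Ao.
pose box (k : rat * rat * nat) : set (measurableTypeR R * measurableTypeR R) :=
  ball (ratr k.1.1 : R) k.2.+1%:R^-1 `*` ball (ratr k.1.2 : R) k.2.+1%:R^-1.
pose B k := if `[< box k `<=` A >] then box k else set0.
have -> : A = \bigcup_k B k.
  apply/seteqP; split=> [z Az|z [n _]]; last first.
    by rewrite /B; case: ifPn => // /asboolP; apply.
  have [e e0 He] := Ao z Az.
  have [m me] : exists m : nat, m.+1%:R^-1 < e / 2.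
    have /ltr_add_invr[k ke] : 0 < e / 2 by rewrite divr_gt0.
    by exists k; rewrite -[ltLHS]add0r.
  have m0 : 0 < (m.+1%:R^-1 : R) by rewrite invr_gt0.
  have rat_near (x : R) : exists q : rat, ball (ratr q : R) m.+1%:R^-1 x.
    have [q] : exists q : rat, (ratr q : R) \in `]x - m.+1%:R^-1, x[.
      by apply: rat_in_itvoo; rewrite ltrBlDr ltrDl.
    rewrite in_itv/= => /andP[q1 q2]; exists q; rewrite /ball/= ler0_norm; last lra.
    by rewrite opprB ltrBlDl -ltrBlDr.
  have [q1 Hq1] := rat_near z.1; have [q2 Hq2] := rat_near z.2.
  exists (q1, q2, m) => //; rewrite /B.
  suff H : box (q1, q2, m) `<=` A by rewrite (asboolT H).
  move=> [x t] [/= x1 t1]; move: Hq1 Hq2 x1 t1; rewrite /ball/= => Hq1 Hq2 x1 t1.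
  have tri (a b c : R) : `|c - a| < m.+1%:R^-1 -> `|c - b| < m.+1%:R^-1 -> `|b - a| < e.
    move=> ca cb; rewrite -(subrKA c) (le_lt_trans (ler_normD _ _))//.
    by rewrite (splitr e) distrC ltrD// (lt_trans _ me).
  by apply: He; [apply: tri Hq1 x1|apply: tri Hq2 t1].
apply: countable_bigcupT_measurable => [|k]; first exact: countableP.
rewrite /B; by case: ifP => // _; apply: measurableX; exact: measurable_ball.
Qed.

Section value_measurable.
Context {R : realType} (HL HR : R -> R) (RL RR mL mR cL cR a0 : R) (u0 : R -> R).
Context (hL : hamiltonian HL RL mL cL a0) (hR : hamiltonian HR RR mR cR a0).
Context (u0l : forall y, y <= 0 -> u0 0 <= u0 y)
        (u0r : forall y, 0 <= y -> u0 0 - RR * y <= u0 y).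
Notation V := (value_of HL HR RL RR u0).

Definition off_interface : set (plane R) := [set z | z.1 != 0 /\ 0 < z.2].

Lemma measurable_off_interface : measurable off_interface.
Proof.
apply: boxopen_measurable => -[x t] /= [x0 t0].
exists (Num.min `|x| t) => [|x' t']; first by rewrite lt_min normr_gt0 x0.
rewrite /off_interface/= !lt_min => /andP[xx _] /andP[_ tt]; split.
  by apply: contraTneq xx => ->; rewrite sub0r normrN ltxx.
by move: tt; rewrite ltr_norml; lra.
Qed.

(** The value 0 on the interface and for [t <= 0] makes this a total Borel function. *)
Definition value_fun (F : R -> R) : plane R -> R :=
  (fun z => V F z.1 z.2) \_ off_interface.

Lemma value_fun_measurable F CF : (forall s, `|F s| <= CF) ->
  borel2 (value_fun F).
Proof.
move=> FC; apply/(measurable_restrictT _ measurable_off_interface).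
apply: (measurability _ (RGenInftyO.measurableE R)) => //.
move=> _ [_ [C ->] <-]; apply: boxopen_measurable => -[x t] /= [[x0 t0]].
rewrite in_itv/= => VC.
have [e e0 He] := value_of_usc hL hR u0l u0r x0 t0 FC VC.
by exists e => // x' t' xx tt; have [? ? ?] := He _ _ xx tt; split => //=; rewrite in_itv.
Qed.

(* A Borel function which coincides with the derivative in [x] wherever the latter exists. *)
Definition value_grad (F : R -> R) (z : plane R) : R :=
  fine (limn_esup (fun n => ((value_fun F (z.1 + n.+1%:R^-1, z.2) - value_fun F z) /
    n.+1%:R^-1)%:E)).

Lemma value_grad_measurable F CF : (forall s, `|F s| <= CF) ->
  borel2 (value_grad F).
Proof.
move=> FC; apply: (measurableT_comp (fine_measurable measurableT)).
apply: measurable_fun_limn_esup => n; apply/measurable_EFinP.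
apply: measurable_funM => //; apply: measurable_funB; last exact: value_fun_measurable FC.
apply: (measurableT_comp (value_fun_measurable FC)).
apply: measurable_fun_pair => //.
exact: measurable_funD.
Qed.

Lemma value_gradE F x t : x != 0 -> 0 < t -> derivable (V F ^~ t) x 1 ->
  value_grad F (x, t) = derive1 (V F ^~ t) x.
Proof.
move=> x0 t0 dV; rewrite /value_grad.
set u := (X in limn_esup X).
suff ul : u @ \oo --> (derive1 (V F ^~ t) x)%:E by rewrite (cvg_limn_einf_sup ul).2.
apply/fine_cvgP; split; first by apply: nearW.
apply/cvgrPdist_lt => e e0; have [d d0 Hd] := derivable_quotient dV e0.
have x1 : 0 < `|x| by rewrite normr_gt0.
near=> n; rewrite distrC /=.
have n0 : n.+1%:R^-1 != 0 :> R by rewrite invr_eq0.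
have nd : n.+1%:R^-1 < d by near: n; exact: (near_infty_natSinv_lt (PosNum d0)).
have nx : n.+1%:R^-1 < `|x|.
  by near: n; exact: (near_infty_natSinv_lt (PosNum x1)).
have in1 : off_interface (x, t) by [].
have in2 : off_interface (x + n.+1%:R^-1, t).
  split => //=; apply: contraTneq nx => /eqP; rewrite addr_eq0 => /eqP ->.
  by rewrite normrN gtr0_norm ?invr_gt0// ltxx.
rewrite /value_fun !patchE (mem_set in1) (mem_set in2).
by apply: Hd => //; rewrite gtr0_norm// invr_gt0.
Unshelve. all: by end_near. Qed.

End value_measurable.

(** [P] and [A] are rounded down to a grid of mesh [1 / (n + 1)]. They then take countably many
    values, at each of which [f] is measurable in [z]; continuity of [f z] gives the limit. *)
Lemma caratheodory_measurable_comp d (T : measurableType d) (R : realType)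
    (f : T -> R -> R -> R) (P A : T -> measurableTypeR R) :
  (forall p a, measurable_fun setT (fun z => f z p a : measurableTypeR R)) ->
  (forall z, continuous (fun q : R * R => f z q.1 q.2)) ->
  measurable_fun setT P -> measurable_fun setT A ->
  measurable_fun setT (fun z => f z (P z) (A z) : measurableTypeR R).
Proof.
move=> mf cf mP mA.
pose r n (x : R) : R := (Num.floor (x * n.+1%:R))%:~R / n.+1%:R.
have rP n x : `|r n x - x| <= n.+1%:R^-1.
  have n0 : 0 < n.+1%:R :> R by rewrite ltr0n.
  have /andP[h1 h2] := floor_itv (x * n.+1%:R).
  have -> : r n x - x = ((Num.floor (x * n.+1%:R))%:~R - x * n.+1%:R) / n.+1%:R.
    by rewrite mulrBl mulfK ?gt_eqF.
  rewrite normrM [X in _ * X]gtr0_norm ?invr_gt0// -[leRHS]mul1r ler_wpM2r ?invr_ge0//.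
  by move: h2; rewrite intrD ler_norml => h2; lra.
apply: (@measurable_fun_cvg _ _ _ _ (fun n z => f z (r n (P z)) (r n (A z)))); last first.
  move=> z _; have := cf z (P z, A z) => /= c.
  have rx x : r n x @[n --> \oo] --> x.
    apply/cvgrPdist_le => e e0; near=> n; rewrite distrC (le_trans (rP n x))// ltW//.
    by near: n; exact: (near_infty_natSinv_lt (PosNum e0)).
  exact: (cvg_comp _ _ (cvg_pair (rx (P z)) (rx (A z))) c).
move=> n; have n0 : 0 < n.+1%:R :> R by rewrite ltr0n.
move=> _ Y mY; rewrite setTI.
pose I (i : int) : set (measurableTypeR R) := `[i%:~R / n.+1%:R, (i + 1)%:~R / n.+1%:R[%classic.
have II i x : I i x <-> Num.floor (x * n.+1%:R) = i.
  rewrite /I/= in_itv/= ler_pdivrMr// ltr_pdivlMr//; split.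
    by move=> h; exact: floor_def.
  by move=> <-; exact: floor_itv.
have -> : (fun z => f z (r n (P z)) (r n (A z))) @^-1` Y =
    \bigcup_(ij : int * int) ((P @^-1` I ij.1 `&` A @^-1` I ij.2) `&`
      (fun z => f z (ij.1%:~R / n.+1%:R) (ij.2%:~R / n.+1%:R)) @^-1` Y).
  apply/seteqP; split=> [z Yz|z [[i j] _ [[/= /II iP /II jA]]]]; last first.
    by rewrite /r iP jA.
  exists (Num.floor (P z * n.+1%:R), Num.floor (A z * n.+1%:R)) => //=.
  by split => //; split; exact/II.
apply: countable_bigcupT_measurable => [|[i j]]; first exact: countableP.
apply: measurableI; first apply: measurableI.
- by rewrite -[X in measurable X]setTI; apply: mP => //; exact: measurable_itv.
- by rewrite -[X in measurable X]setTI; apply: mA => //; exact: measurable_itv.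
- by rewrite -[X in measurable X]setTI; apply: mf.
Unshelve. all: by end_near. Qed.

Lemma countType_enum (I : countType) (i0 : I) :
  exists e : nat -> I, forall i, exists n, e n = i.
Proof.
exists (fun n => odflt i0 (unpickle n)) => i; exists (pickle i); by rewrite pickleK.
Qed.

(** * Products of sigma-finite measures and null sections *)

Section product_sigma_finite.
Local Open Scope ereal_scope.
Context d1 d2 (T1 : measurableType d1) (T2 : measurableType d2) (R : realType).
Context (m1 : {sigma_finite_measure set T1 -> \bar R})
        (m2 : {sigma_finite_measure set T2 -> \bar R}).

Lemma product_sigma_finite : sigma_finite setT (m1 \x m2).
Proof.
have [F TF mF] := sigma_finiteT m1; have [G TG mG] := sigma_finiteT m2.
have [e He] := countType_enum (0%N, 0%N).
exists (fun n => F (e n).1 `*` G (e n).2).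
  apply/esym; rewrite -subTset => -[x y] _.
  have [i _ Fx] : (\bigcup_i F i) x by rewrite -TF.
  have [j _ Gy] : (\bigcup_i G i) y by rewrite -TG.
  by have [n ne] := He (i, j); exists n => //; rewrite ne.
move=> n; have [mFn Fn] := mF (e n).1; have [mGn Gn] := mG (e n).2.
by split; [exact: measurableX|rewrite product_measure1E// lte_mul_pinfty// ge0_fin_numE].
Qed.

(* The library infers no sigma-finite structure for a product of sigma-finite measures. *)
Definition product_measure_sf : {sigma_finite_measure set (T1 * T2)%type -> \bar R} :=
  HB.pack_for {sigma_finite_measure set (T1 * T2)%type -> \bar R} (m1 \x m2)
    (Measure_isSigmaFinite.Build _ _ _ _ product_sigma_finite).

Lemma product_measure_sfE : product_measure_sf = m1 \x m2 :> (set (T1 * T2)%type -> \bar R).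
Proof. by []. Qed.

End product_sigma_finite.

Section null_sections.
Local Open Scope ereal_scope.
Context d1 d2 (T1 : measurableType d1) (T2 : measurableType d2) (R : realType).
Context (m1 : {sigma_finite_measure set T1 -> \bar R})
        (m2 : {sigma_finite_measure set T2 -> \bar R}).

(** Time is the second coordinate and the estimates hold for almost every time, so null sets are
    sliced at fixed second coordinate; Tonelli allows this order. *)
Lemma product_measure_ysection (N : set (T1 * T2)) : measurable N ->
  (m1 \x m2) N = \int[m2]_y m1 (ysection N y).
Proof.
move=> mN; transitivity (\int[m2]_y fubini_G m1 (EFin \o \1_N) y).
  by rewrite -indic_fubini_tonelli// indic_fubini_tonelli_FE.
by rewrite indic_fubini_tonelli_GE.
Qed.

Lemma null_ysection (N : set (T1 * T2)) : measurable N -> (m1 \x m2) N = 0 ->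
  {ae m2, forall y, m1 (ysection N y) = 0}.
Proof.
move=> mN N0; have mG := measurable_fun_ysection m1 mN.
have : ae_eq m2 setT (m1 \o ysection N) (cst 0).
  apply/ae_eq_integral_abs => //; rewrite -[RHS]N0 product_measure_ysection//.
  by apply: eq_integral => x _; rewrite /= gee0_abs.
by apply: filterS => x /(_ I).
Qed.

Lemma ae_null_ysection (N : set (T1 * T2)) : measurable N ->
  {ae m2, forall y, m1 (ysection N y) = 0} -> (m1 \x m2) N = 0.
Proof.
move=> mN N0; rewrite product_measure_ysection// -(integral0 m2 setT).
apply: ae_eq_integral => //; first exact: measurable_fun_ysection.
by apply: filterS N0 => y -> _.
Qed.

End null_sections.

Lemma ae_ex_itv {R : realType} (P : R -> Prop) (a b : R) : a < b ->
  {ae @lebesgue_measure R, forall x, P x} -> exists2 x, a < x < b & P x.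
Proof.
move=> ab [N [mN N0 PN]]; apply: contrapT => nP.
have : (lebesgue_measure `]a, b[%classic <= lebesgue_measure N)%E.
  apply: le_measure; rewrite ?inE//.
  move=> x /=; rewrite in_itv/= => xab; apply: PN => /= Px; apply: nP; by exists x.
rewrite N0 lebesgue_measure_itv/= lte_fin ab -EFinB lee_fin subr_le0.
by rewrite leNgt ab.
Qed.

(** * Borel replacement of the integrand *)

Section integrand.
Context {R : realType} (T A0 : R) (psi : R * R * R * R -> R).
Let D := [set z : R * R * R * R | z.1.1.2 \in `[0, T] /\ z.2 \in `[A0, 0]].
Context (A0_lt0 : A0 < 0).
Context (psi_measurable : lebesgue4_measurable_fun D psi)
    (psi_bounded : [bounded psi z | z in D])
    (psi_support : compact (closed_support D psi))
    (psi_continuous : forall x t : R, t \in `[0, T] ->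
       {within [set q : R * R | q.2 \in `[A0, 0]],
         continuous (fun q : R * R => psi (x, t, q.1, q.2))})
    (psi_convex : forall x t p : R, t \in `[0, T] ->
       convex_function (`[A0, 0]%classic : set R^o)
         (fun a : R => psi (x, t, p, a))).

Let cvg_psi (I : Type) (F : set_system I) (FF : Filter F) (u : I -> R * R) (x t p a : R) :
  0 <= t <= T -> A0 <= a <= 0 -> (forall i, A0 <= (u i).2 <= 0) ->
  u @ F --> (p, a) -> (fun i => psi (x, t, (u i).1, (u i).2)) @ F --> psi (x, t, p, a).
Proof.
move=> t0T aA uA cu.
have tin : t \in `[0, T] by rewrite in_itv.
have /subspace_continuousP/(_ (p, a)) := psi_continuous (x := x) tin.
rewrite /= in_itv/= => /(_ aA) c.
have cw : u @ F --> within [set q : R * R | q.2 \in `[A0, 0]] (nbhs (p, a)).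
  move=> B HB; apply: (@filterS _ F FF _ _ _ (cu _ HB)) => i /=.
  by move=> H; apply: H; rewrite in_itv/=; exact: uA.
exact: (cvg_comp u _ cw c).
Qed.

(* For almost every [(p, a)] the section of [psi] agrees with a Borel function off a null
   set; countably many such [(p, a)] are dense, and they determine [psi] by continuity. *)
Lemma integrand_reduction : exists (ph : R -> R -> R -> R -> R) (M K : R) (N : set (plane R)),
  [/\ [/\ measurable N, (lebesgue_measure \x lebesgue_measure)%E N = 0 & 0 < M],
    (forall p a, borel2 (fun z => ph z.1 z.2 p a)),
    (forall x t, continuous (fun q : R * R => ph x t q.1 q.2)),
    (forall x t p a, `|ph x t p a| <= M /\ (K < `|x| -> ph x t p a = 0)) &
    (forall x t p a, 0 <= t <= T -> A0 <= a <= 0 -> ~ N (x, t) ->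
       psi (x, t, p, a) = ph x t p a) /\
    (forall x t p a b, A0 <= a <= 0 -> A0 <= b <= 0 ->
       ph x t p ((a + b) / 2) <= (ph x t p a + ph x t p b) / 2)].
Proof.
have [M M0 HM] := pinfty_ex_gt0 psi_bounded.
(* The projection of the compact support to the space variable is bounded. *)
have [K K0 HK] : exists2 K, 0 < K & forall z, D z -> psi z != 0 -> `|z.1.1.1| <= K.
  pose pr (z : R * R * R * R) := z.1.1.1.
  have cpr : continuous pr.
    move=> [[[x t] p] a].
    exact: (cvg_comp _ _ (cvg_comp _ _ cvg_fst cvg_fst) cvg_fst).
  have := continuous_compact (continuous_subspaceT cpr) psi_support.
  move=> /compact_bounded/pinfty_ex_gt0[K K0 HK]; exists K => // z Dz pz.
  by apply: HK; exists z => //; apply: subset_closure.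
have mD : measurable (D : set (plane R * measurableTypeR R * measurableTypeR R)).
  apply: measurableI.
    rewrite -[X in measurable X]setTI.
    have m : measurable_fun setT (fun z : plane R * measurableTypeR R * measurableTypeR R => z.1.1.2).
      apply: (measurableT_comp measurable_snd); apply: (measurableT_comp measurable_fst).
      exact: measurable_fst.
    exact: (m measurableT `[0, T]%classic (measurable_itv _)).
  rewrite -[X in measurable X]setTI.
  exact: (measurable_snd measurableT `[A0, 0]%classic (measurable_itv _)).
have [N4 [mN4 N40 mf]] := completed_measurable_ae_eq mD psi_measurable.
set f := (psi \_ _) in mf.
pose m2 := product_measure_sf (@lebesgue_measure R) (@lebesgue_measure R).
pose m3 := product_measure_sf m2 (@lebesgue_measure R).
have {}N40 : (m3 \x lebesgue_measure)%E N4 = 0%E by exact: N40.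
(* Fubini twice: almost every [a], and then almost every [p], gives a null section, so such pairs
   exist in every small box. *)
have dense (p0 a0 e : R) : A0 <= a0 <= 0 -> 0 < e -> exists q : R * R,
    [/\ `|q.1 - p0| < e, `|q.2 - a0| < e, A0 <= q.2 <= 0 &
      (lebesgue_measure \x lebesgue_measure)%E (ysection (ysection N4 q.2) q.1) = 0].
  move=> /andP[a1 a2] e0.
  (* [a0] may be an end point of [[A0, 0]]; as [A0 < 0], the truncated interval still has positive
     length. *)
  have ab : Num.max A0 (a0 - e) < Num.min 0 (a0 + e).
    by rewrite gt_max !lt_min A0_lt0; apply/and3P; split; lra.
  have [a + a3] := ae_ex_itv ab (@null_ysection _ _ _ _ _ m3 lebesgue_measure _ mN4 N40).
  rewrite gt_max lt_min => /andP[/andP[a4 a5] /andP[a6 a7]].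
  have pp : p0 - e < p0 + e by lra.
  have mNa : measurable (ysection N4 a) by exact: measurable_ysection.
  have [p /andP[p1 p2] p3] := ae_ex_itv pp (@null_ysection _ _ _ _ _ m2 lebesgue_measure _ mNa a3).
  exists (p, a); split; last exact: p3; rewrite /= ?ltr_norml; apply/andP; split; lra.
have /choice[g Hg] : forall k : rat * rat * nat, exists q : R * R,
    [/\ `|q.1 - ratr k.1.1| < k.2.+1%:R^-1, `|q.2 - clamp A0 0 (ratr k.1.2)| < k.2.+1%:R^-1,
      A0 <= q.2 <= 0 &
      (lebesgue_measure \x lebesgue_measure)%E (ysection (ysection N4 q.2) q.1) = 0].
  by move=> k; apply: dense; [exact: clamp_in (ltW A0_lt0)|rewrite invr_gt0].
have [enum Henum] := countType_enum (0 : rat, 0 : rat, 0%N).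
pose Nk k : set (plane R) := ysection (ysection N4 (g k).2) (g k).1.
pose N : set (plane R) := \bigcup_n Nk (enum n).
have mNk k : measurable (Nk k).
  by apply: measurable_ysection; exact: measurable_ysection.
have mN : measurable N by exact: bigcupT_measurable.
have N0 : (lebesgue_measure \x lebesgue_measure)%E N = 0%E.
  apply/negligibleP => //; apply: negligible_bigcup => n; apply/negligibleP => //.
  by case: (Hg (enum n)).
have NkN k : Nk k `<=` N by have [n <-] := Henum k; move=> z; exists n.
pose G : set (plane R) := [set z | 0 <= z.2 <= T /\ `|z.1| <= K] `\` N.
have mG : measurable G.
  apply: measurableD => //.
  have -> : [set z : plane R | 0 <= z.2 <= T /\ `|z.1| <= K] =
      (`[- K, K]%classic : set (measurableTypeR R)) `*` (`[0, T]%classic : set (measurableTypeR R)).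
    by apply/seteqP; split => -[x t] /=; rewrite !in_itv/= ler_norml => -[].
  by apply: measurableX; exact: measurable_itv.
(* The value 0 off [G] removes the exceptional points and the large [x] at once; [clamp] extends the
   control variable to the line, so that continuity becomes global. *)
pose ph x t p a : R := if `[< G (x, t) >] then psi (x, t, p, clamp A0 0 a) else 0.
have phG x t p a : G (x, t) -> ph x t p a = psi (x, t, p, clamp A0 0 a).
  by move=> Gz; rewrite /ph asboolT.
have phnG x t p a : ~ G (x, t) -> ph x t p a = 0.
  by move=> Gz; rewrite /ph asboolF.
have inD x t p a : 0 <= t <= T -> A0 <= a <= 0 -> D (x, t, p, a).
  by move=> t0T aA; split; rewrite /= in_itv.
exists ph, M, K, N; split => //.
- move=> p a.
  have /choice[k Hk] : forall n, exists q : rat * rat * nat,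
      [/\ q.2 = n, `|ratr q.1.1 - p| < n.+1%:R^-1 & `|ratr q.1.2 - a| < n.+1%:R^-1].
    move=> n.
    have near (c : R) : exists q : rat, `|ratr q - c| < n.+1%:R^-1.
      have [q] : exists q : rat, (ratr q : R) \in `]c - n.+1%:R^-1, c[.
        by apply: rat_in_itvoo; rewrite ltrBlDr ltrDl invr_gt0.
      rewrite in_itv/= => /andP[q1 q2]; exists q; rewrite ler0_norm; last lra.
      by rewrite opprB ltrBlDl -ltrBlDr.
    by have [q1 ?] := near p; have [q2 ?] := near a; exists (q1, q2, n).
  (* The sections at the chosen pairs are Borel in [z]; the pairs [g (k n)] tend to
     [(p, clamp A0 0 a)], at distance below [2 / (n + 1)], and continuity of [psi] identifies the
     limit on [G]. *)
  apply: (@measurable_fun_cvg _ _ _ _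
      (fun n => (fun z => f (z, (g (k n)).1, (g (k n)).2)) \_ G)).
    move=> n; apply/(measurable_restrictT _ mG); apply: measurable_funTS.
    apply: (measurableT_comp mf).
    apply: measurable_fun_pair => //; apply: measurable_fun_pair => //.
  move=> [x t] _ /=.
  have [Gz|nGz] := pselect (G (x, t)); last first.
    rewrite phnG//; rewrite (_ : (fun n => _) = (fun=> 0)); first exact: cvg_cst.
    by apply/funext => n; rewrite patchE memNset.
  have [[t0T xK] nN] := Gz.
  rewrite (_ : (fun n => _) = (fun n => psi (x, t, (g (k n)).1, (g (k n)).2))); last first.
    apply/funext => n; rewrite patchE mem_set// /f patchE ifT//.
    have [_ _ gA _] := Hg (k n); apply/mem_set; split; first exact: inD.
    move=> N4z; apply: nN; apply: (NkN (k n)).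
    by rewrite /Nk /ysection /=; apply/mem_set; apply/mem_set.
  rewrite phG//; apply: cvg_psi => //; [exact: clamp_in (ltW A0_lt0)|by move=> n; case: (Hg (k n))|].
  have inv0 (e : R) : 0 < e -> \forall n \near \oo, n.+1%:R^-1 < e.
    by move=> e0; exact: (near_infty_natSinv_lt (PosNum e0)).
  have gk n : `|(g (k n)).1 - p| < 2 * n.+1%:R^-1 /\ `|(g (k n)).2 - clamp A0 0 a| < 2 * n.+1%:R^-1.
    have [kn h1 h2] := Hk n; have [g1 g2 _ _] := Hg (k n); rewrite kn in g1 g2.
    set r := n.+1%:R^-1 in g1 g2 h1 h2 *; clearbody r.
    split.
      by rewrite -(subrKA (ratr (k n).1.1)) (le_lt_trans (ler_normD _ _))//; lra.
    rewrite -(subrKA (clamp A0 0 (ratr (k n).1.2))) (le_lt_trans (ler_normD _ _))//.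
    by have := clamp_lip A0 0 (ratr (k n).1.2) a; lra.
  rewrite (_ : (fun n => g (k n)) = fun n => ((g (k n)).1, (g (k n)).2)); last first.
    by apply/funext => n; case: (g (k n)).
  have c1 : (g (k n)).1 @[n --> \oo] --> p.
    apply/cvgrPdist_lt => e e0; near=> n.
    rewrite distrC (lt_trans (gk n).1)// -ltr_pdivlMl//.
    by near: n; apply: inv0; rewrite mulr_gt0.
  have c2 : (g (k n)).2 @[n --> \oo] --> clamp A0 0 a.
    apply/cvgrPdist_lt => e e0; near=> n.
    rewrite distrC (lt_trans (gk n).2)// -ltr_pdivlMl//.
    by near: n; apply: inv0; rewrite mulr_gt0.
  exact: (cvg_pair c1 c2).
- move=> x t q.
  have [Gz|nGz] := pselect (G (x, t)); last first.
    rewrite /ph (asboolF nGz); exact: cst_continuous.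
  rewrite /ph (asboolT Gz); have [[t0T _] _] := Gz.
  apply: (@cvg_psi _ (nbhs q) _ (fun q => (q.1, clamp A0 0 q.2)) x t q.1 (clamp A0 0 q.2)) => //.
  - exact: clamp_in (ltW A0_lt0).
  - by move=> i; exact: clamp_in (ltW A0_lt0).
  have c1 : q'.1 @[q' --> q] --> q.1 by case: q => ? ?; exact: cvg_fst.
  have c2 : clamp A0 0 q'.2 @[q' --> q] --> clamp A0 0 q.2.
    by case: q {c1} => p a /=; apply: (@cvg_comp _ _ _ snd (clamp A0 0)); [exact: cvg_snd|exact: clamp_continuous].
  exact: (cvg_pair c1 c2).
- move=> x t p a; split.
    have [Gz|nGz] := pselect (G (x, t)); last by rewrite phnG// normr0 ltW.
    rewrite phG//; apply: HM; apply: inD; [by case: Gz => -[]|exact: clamp_in (ltW A0_lt0)].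
  move=> Kx; apply: phnG => -[[_ xK] _].
  by move: (lt_le_trans Kx xK); rewrite ltxx.
- split.
    move=> x t p a t0T aA nN.
    have [xK|xK] := leP `|x| K.
      by rewrite phG ?clamp_id.
    rewrite phnG; last by move=> [[_ xK'] _]; move: (lt_le_trans xK xK'); rewrite ltxx.
    apply/eqP; apply: contraTT xK => /HK-/(_ (inD _ _ _ _ t0T aA))/=.
    by rewrite -leNgt.
  move=> x t p a b aA bA.
  have [Gz|nGz] := pselect (G (x, t)); last by rewrite !phnG// addr0 mul0r.
  have abA : A0 <= (a + b) / 2 <= 0 by lra.
  rewrite !phG// !clamp_id//; have [[t0T _] _] := Gz.
  have tin : t \in `[0, T] by rewrite in_itv.
  have i1 : 0 <= (2^-1 : R) by rewrite invr_ge0.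
  have i2 : (2^-1 : R) <= 1 by rewrite invf_le1// ler1n.
  have := @psi_convex x t p tin (Itv01 i1 i2) a b.
  rewrite !inE/= !in_itv/= => /(_ aA bA).
  have E : conv (Itv01 i1 i2) (a : convex_lmodType R^o) b = (a + b) / 2.
    by rewrite [LHS](_ : _ = 2^-1 * a + (1 - 2^-1) * b)//; field.
  rewrite E => /le_trans; apply; rewrite [leLHS](_ : _ = (psi (x, t, p, a) + psi (x, t, p, b)) / 2)//.
  by rewrite [LHS](_ : _ = 2^-1 * psi (x, t, p, a) + (1 - 2^-1) * psi (x, t, p, b))//; field.
Unshelve. all: by end_near. Qed.

End integrand.

(** * Integrals over intervals *)

Section dominated_convergence_real.
Context d (T : measurableType d) (R : realType) (mu : {measure set T -> \bar R}).
Context (D : set T) (mD : measurable D).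

Lemma Rintegral_dominated_cvg (f_ : nat -> T -> R) (f g : T -> R) :
  (forall n, measurable_fun D (f_ n)) -> measurable_fun D f ->
  {ae mu, forall x, D x -> f_ ^~ x @ \oo --> f x} ->
  mu.-integrable D (EFin \o g) -> (forall x n, D x -> `|f_ n x| <= g x) ->
  mu.-integrable D (EFin \o f) /\
  (fun n => \int[mu]_(x in D) f_ n x) @ \oo --> \int[mu]_(x in D) f x.
Proof.
move=> mf_ mf cf ig fg.
have [||||if_ _ c] := @dominated_convergence _ T R mu D mD (fun n => EFin \o f_ n)
    (EFin \o f) (EFin \o g) _ _ _ ig.
- by move=> n; exact/measurable_EFinP.
- exact/measurable_EFinP.
- by apply: filterS cf => x H Dx; apply: cvg_EFin; [exact: nearW|exact: H].
- by apply: aeW => x n Dx /=; rewrite lee_fin fg.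
split => //; apply: fine_cvg; rewrite fineK//; exact: integrable_fin_num.
Qed.

End dominated_convergence_real.

Section interval_integrals.
Context {R : realType}.
Notation mu := (@lebesgue_measure R).
Implicit Types (h : R -> R) (a b c : R).

(** Not oriented: it is 0 when [b <= a]. The open domain is that of [action]. *)
Definition int h a b := \int[mu]_(s in `]a, b[) h s.

Lemma integrable_sub_itv h a b a' b' : integrable_itv a b h ->
  a <= a' -> b' <= b -> integrable_itv a' b' h.
Proof.
move=> ih aa bb; apply: integrableS ih => //.
by apply: subset_itv; rewrite bnd_simp.
Qed.

Lemma int_split h a b c : integrable_itv a c h -> a <= b <= c ->
  int h a c = int h a b + int h b c.
Proof.
move=> ih /andP[ab bc].
have ib : integrable_itv a b h by exact: integrable_sub_itv ih _ bc.
move: ab; rewrite le_eqVlt => /predU1P[<-|ab].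
  by rewrite [X in X + _](_ : _ = 0) ?add0r// /int set_itvoo0// Rintegral_set0.
move: bc; rewrite le_eqVlt => /predU1P[->|bc].
  by rewrite [X in _ + X](_ : _ = 0) ?addr0// /int set_itvoo0// Rintegral_set0.
have := @Rintegral_itvB R h (BRight a) (BLeft c) b ih.
rewrite !bnd_simp => /(_ (ltW ab) bc); rewrite -Rintegral_itv_bndo_bndc// /int => <-.
by rewrite addrC subrK.
Qed.

Lemma int_cst (k : R) a b : a <= b -> int (fun=> k) a b = k * (b - a).
Proof.
move=> ab; rewrite /int Rintegral_cst//; congr (_ * _).
rewrite [X in fine X](_ : _ = (b - a)%:E)// [LHS]lebesgue_measure_itv/= lte_fin EFinB.
by move: ab; rewrite le_eqVlt => /predU1P[->|->//]; rewrite ltxx subee.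
Qed.

Lemma bounded_integrable h a b (M : R) :
  borel h ->
  (forall s, a < s < b -> `|h s| <= M) -> integrable_itv a b h.
Proof.
move=> mh hM; apply: measurable_bounded_integrable => //.
- by rewrite /= lebesgue_measure_itv/=; case: ifP => _; rewrite ltry.
- exact: measurable_funTS.
- exists M; split; first exact: num_real.
  by move=> x Mx s /=; rewrite in_itv/= => /hM /le_trans; apply; exact: ltW.
Qed.

Lemma cst_integrable_itv (k : R) a b : integrable_itv a b (fun s : R => k).
Proof. by apply: (@bounded_integrable _ _ _ `|k|) => //; exact: measurable_cst. Qed.

Lemma control_integrable (A : R -> R) (a0 a b : R) : borel A -> (forall s, a0 <= A s <= 0) ->
  integrable_itv a b A.
Proof.
move=> mA A01; apply: (@bounded_integrable _ _ _ (- a0)) => // s _.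
by have := A01 s; rewrite ler_norml; lra.
Qed.

Lemma continuous_integrable (f : R -> R) a b : continuous f -> integrable_itv a b f.
Proof.
move=> cf; have [ab|ab] := leP a b.
  have ct : {within `[a, b], continuous (fun s => `|f s|)}.
    apply: continuous_subspaceT => s; apply: cvg_norm; exact: cf.
  have [c _ Hc] := EVT_max ab ct.
  apply: (@bounded_integrable _ _ _ `|f c|); first exact: continuous_measurable_fun.
  by move=> s /andP[s0 st]; apply: Hc; rewrite in_itv/= !ltW.
rewrite set_itv_ge; first exact: integrable_set0.
by rewrite bnd_simp -leNgt ltW.
Qed.

Lemma integrableD_itv h k a b : integrable_itv a b h ->
  integrable_itv a b k ->
  integrable_itv a b (fun s => h s + k s).
Proof.
have mI : measurable (`]a, b[%classic : set (measurableTypeR R)) by [].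
by move=> ih ik; have := integrableD mI ih ik.
Qed.

Lemma integrableZ_itv (l : R) h a b : integrable_itv a b h ->
  integrable_itv a b (fun s => l * h s).
Proof.
have mI : measurable (`]a, b[%classic : set (measurableTypeR R)) by [].
by move=> ih; have := integrableZl mI l ih.
Qed.

Lemma intD h k a b : integrable_itv a b h -> integrable_itv a b k ->
  int (fun s => h s + k s) a b = int h a b + int k a b.
Proof. by move=> ih ik; rewrite /int RintegralD. Qed.

Lemma intZ (l : R) h a b : integrable_itv a b h ->
  int (fun s => l * h s) a b = l * int h a b.
Proof. by move=> ih; rewrite /int RintegralZl. Qed.

Lemma int_le h k a b : integrable_itv a b h -> integrable_itv a b k ->
  (forall s, a < s < b -> h s <= k s) -> int h a b <= int k a b.
Proof.
by move=> ih ik hk; apply: le_Rintegral.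
Qed.

Lemma int_normr h a b : integrable_itv a b h ->
  `|int h a b| <= int (fun s => `|h s|) a b.
Proof. by move=> ih; exact: le_normr_Rintegral. Qed.

Lemma integrable_norm_itv h a b : integrable_itv a b h ->
  integrable_itv a b (fun s => `|h s|).
Proof. by move=> ih; exact: integrable_norm. Qed.

Lemma int_continuous h a b : a <= b -> integrable_itv a b h ->
  {within `[a, b], continuous (fun s => int h a s)}.
Proof.
rewrite le_eqVlt => /predU1P[<- _|ab ih].
  by rewrite set_itv1; exact: continuous_subspace1.
have mh : measurable_fun `]a, b[ (h : measurableTypeR R -> measurableTypeR R).
  by apply/measurable_EFinP; exact: (measurable_int mu).
have ih' : mu.-integrable `[a, b] (EFin \o h).
  apply/integrableP; split.
    apply/measurable_EFinP.
    apply: (measurable_fun_itv_cc (b0 := false) (b1 := true)); exact: mh.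
  have /integrableP[_] := ih; apply: le_lt_trans; rewrite le_eqVlt; apply/orP; left.
  apply/eqP; apply: integral_itv_bndoo; apply: measurableT_comp => //.
  exact/measurable_EFinP.
apply: (@subspace_eq_continuous _ _ _ (fun s => \int[mu]_(x in `[a, s]) h x)); last first.
  exact: parameterized_integral_continuous (ltW ab) ih'.
move=> s; rewrite inE/= in_itv/= => /andP[as_ sb]; rewrite /int /from_subspace; apply/esym.
move: as_; rewrite le_eqVlt => /predU1P[<-|as_].
  by rewrite set_itv1 Rintegral_set1 set_itvoo0// Rintegral_set0.
have is_ : integrable_itv a s h by exact: integrable_sub_itv ih _ sb.
rewrite Rintegral_itv_bndo_bndc// Rintegral_itv_obnd_cbnd//.
apply: integrableS ih' => //.
by apply: subset_itv; rewrite bnd_simp// ltW.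
Qed.

Lemma int_eq h k a b : (forall s, a < s < b -> h s = k s) -> int h a b = int k a b.
Proof.
by move=> hk; apply: eq_Rintegral => s; rewrite inE/= in_itv/=; exact: hk.
Qed.

Lemma int_FTC (F f : R -> R) a b : a <= b -> (forall s : R, a <= s <= b -> is_derive s 1 F (f s)) ->
  continuous f -> int f a b = F b - F a.
Proof.
rewrite le_eqVlt => /predU1P[<- _ _|ab dF cf].
  by rewrite /int set_itvoo0// Rintegral_set0 subrr.
have cF s : a <= s <= b -> {for s, continuous F}.
  by move=> /dF ?; exact/differentiable_continuous/derivable1_diffP.
have := @continuous_FTC2 R f F a b ab (continuous_subspaceT cf).
rewrite /int /Rintegral => H.
have mf : measurable_fun `]a, b[ (fun s => (f s)%:E : \bar R).
  by apply/measurable_EFinP; apply: measurable_funTS; exact: continuous_measurable_fun.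
rewrite -(integral_itv_bndoo true false mf) H//.
- split => [s||].
  + by rewrite in_itv/= => /andP[/ltW as_ /ltW sb]; have /dF ? : a <= s <= b by rewrite as_.
  + by apply/cvg_at_right_filter/cF; rewrite lexx ltW.
  + by apply/cvg_at_left_filter/cF; rewrite lexx ltW.
- move=> s; rewrite in_itv/= => /andP[/ltW as_ /ltW sb].
  by have /dF ? : a <= s <= b; [rewrite as_|rewrite derive1E; exact: derive_val].
Qed.

End interval_integrals.

(** * Ramps and splines *)

Section ramp.
Context {R : realType}.
Implicit Types (x s c e k : R).

Definition ramp x : R := Num.max x 0.

Lemma ramp_id x : 0 <= x -> ramp x = x.
Proof. by move=> x0; rewrite /ramp (max_idPl x0). Qed.

Lemma ramp_0 x : x <= 0 -> ramp x = 0.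
Proof. by move=> x0; rewrite /ramp (max_idPr x0). Qed.

Lemma ramp_cases x : x <= 0 /\ ramp x = 0 \/ 0 <= x /\ ramp x = x.
Proof.
by have [x0|x0] := leP x 0; [left; rewrite ramp_0|right; rewrite ramp_id ltW].
Qed.

Lemma ramp_lip x y : `|ramp x - ramp y| <= `|x - y|.
Proof.
have h1 := ler_norm (x - y); have h2 := ler_norm (y - x); rewrite distrC in h2.
by rewrite ler_norml; have [[? ->]|[? ->]] := ramp_cases x;
  have [[? ->]|[? ->]] := ramp_cases y; apply/andP; split; lra.
Qed.

(** A second-order Taylor estimate: the square of [ramp] has the Lipschitz derivative [2 * ramp],
    although it has no second derivative at 0. *)
Lemma ramp_sqr x k : `|ramp (x + k) ^+ 2 - ramp x ^+ 2 - 2 * ramp x * k| <= k ^+ 2.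
Proof.
rewrite ler_norml; have [[? ->]|[? ->]] := ramp_cases x;
  have [[? ->]|[? ->]] := ramp_cases (x + k); apply/andP; split; nra.
Qed.

Lemma ramp_continuous : continuous ramp.
Proof.
move=> s; apply/cvgrPdist_lt => e e0; near=> y.
by rewrite (le_lt_trans (ramp_lip _ _))//; near: y; exact: cvgr_dist_lt.
Unshelve. all: by end_near. Qed.

Lemma continuous_ramp c : continuous (fun s => ramp (s - c)).
Proof.
move=> s; apply/cvgrPdist_lt => e e0; near=> y.
rewrite (le_lt_trans (ramp_lip _ _))// (_ : s - c - (y - c) = s - y); last by ring.
by near: y; exact: cvgr_dist_lt.
Unshelve. all: by end_near. Qed.

Lemma is_derive_ramp_sqr c s :
  is_derive s 1 (fun s => ramp (s - c) ^+ 2) (2 * ramp (s - c)).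
Proof.
have [d dE] : derivable (fun s => ramp (s - c) ^+ 2) s 1 /\
    derive1 (fun s => ramp (s - c) ^+ 2) s = 2 * ramp (s - c).
  apply: quotient_derivable => e e0; exists e => // h h0 he.
  rewrite /quotient (_ : s + h - c = s - c + h); last by ring.
  rewrite (_ : _ - _ = (ramp (s - c + h) ^+ 2 - ramp (s - c) ^+ 2 - 2 * ramp (s - c) * h) / h);
    last by field.
  apply: le_lt_trans he; rewrite normrM normfV ler_pdivrMr ?normr_gt0//.
  by rewrite (le_trans (ramp_sqr _ _))// -expr2 real_normK ?num_real.
by apply: DeriveDef => //; rewrite -derive1E.
Qed.

(* A quadratic spline rising from 0 to 1 on [[c, c + 2 e]]. *)
Definition spline e c s : R := (2 * e ^+ 2)^-1 *
  (ramp (s - c) ^+ 2 - 2 * ramp (s - (c + e)) ^+ 2 + ramp (s - (c + 2 * e)) ^+ 2).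

(** The derivative of [spline e c]: the triangular kernel of mass one on [[c, c + 2 * e]]. *)
Definition hat e c s : R := (e ^+ 2)^-1 *
  (ramp (s - c) - 2 * ramp (s - (c + e)) + ramp (s - (c + 2 * e))).

Lemma is_derive_spline e c s : e != 0 -> is_derive s 1 (spline e c) (hat e c s).
Proof.
move=> e0; have := is_derive_ramp_sqr c s; have := is_derive_ramp_sqr (c + e) s.
have := is_derive_ramp_sqr (c + 2 * e) s => h1 h2 h3.
rewrite /spline /hat; apply: is_derive_eq.
by rewrite /GRing.scale/=; field.
Qed.

Lemma continuous_spline e c : e != 0 -> continuous (spline e c).
Proof.
move=> e0 s; have d := is_derive_spline c s e0.
exact/differentiable_continuous/derivable1_diffP.
Qed.

Lemma continuous_hat e c : continuous (hat e c).
Proof.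
move=> s; rewrite /hat; apply: cvgM; first exact: cvg_cst.
apply: cvgD; last exact: continuous_ramp.
apply: cvgB; first exact: continuous_ramp.
by apply: cvgM; [exact: cvg_cst|exact: continuous_ramp].
Qed.

Lemma spline0 e c s : 0 < e -> s <= c -> spline e c s = 0.
Proof. by move=> e0 sc; rewrite /spline !ramp_0; [ring|lra..]. Qed.

Lemma spline1 e c s : 0 < e -> c + 2 * e <= s -> spline e c s = 1.
Proof.
move=> e0 sc; rewrite /spline !ramp_id; [|lra..].
by field; rewrite gt_eqF.
Qed.

Lemma spline_bounds e c s : 0 < e -> 0 <= spline e c s <= 1.
Proof.
move=> e0; have e2 : 0 < 2 * e ^+ 2 by rewrite mulr_gt0// exprn_gt0.
have [sc|sc] := leP s c; first by rewrite spline0// lexx ler01.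
have [se|se] := leP (c + 2 * e) s; first by rewrite spline1// lexx ler01.
rewrite /spline mulrC divr_ge0 ?ler_pdivrMr// ?mul1r; last exact: ltW.
  rewrite (@ramp_id (s - c)) ?(@ramp_0 (s - (c + 2 * e))); [|lra..].
  have [[? ->]|[? ->]] := ramp_cases (s - (c + e)); nra.
rewrite (@ramp_id (s - c)) ?(@ramp_0 (s - (c + 2 * e))); [|lra..].
have [[? ->]|[? ->]] := ramp_cases (s - (c + e)); nra.
Qed.

Lemma hat_ge0 e c s : 0 < e -> 0 <= hat e c s.
Proof.
move=> e0; rewrite /hat mulr_ge0 ?invr_ge0 ?sqr_ge0//.
have [[? ->]|[? ->]] := ramp_cases (s - c);
have [[? ->]|[? ->]] := ramp_cases (s - (c + e));
have [[? ->]|[? ->]] := ramp_cases (s - (c + 2 * e)); lra.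
Qed.

Lemma hat_eq0 e c s : 0 < e -> s <= c \/ c + 2 * e <= s -> hat e c s = 0.
Proof.
move=> e0 [sc|sc]; rewrite /hat; [rewrite !ramp_0|rewrite !ramp_id]; try lra; ring.
Qed.

End ramp.

Lemma measurable_gt0 (R : realType) (g : R -> R) :
  borel g ->
  borel (fun s => (0 < g s)%R%:R : R).
Proof.
move=> mg; rewrite (_ : (fun s => _) = \1_[set s | 0 < g s]); last first.
  by apply/funext => s; rewrite indicE; have [gs|gs] := boolP (0 < g s);
    [rewrite mem_set|rewrite memNset//=; exact/negP].
apply: measurable_indic.
rewrite (_ : [set s | 0 < g s] = g @^-1` `]0, +oo[); last first.
  by apply/seteqP; split => s /=; rewrite in_itv/= andbT.
by rewrite -[X in measurable X]setTI; apply: mg => //; exact: measurable_itv.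
Qed.

(** * From weak derivatives to increments *)

Section du_bois_reymond.
Context {R : realType} (t : R) (gamma h : R -> R).
Notation mu := (@lebesgue_measure R).
Context (t0 : 0 < t) (cg : continuous gamma).
Context (mh : borel h)
  (ih : integrable_itv 0 t h)
  (weak : forall phi, C1_compact_support 0 t phi ->
    int (fun s => gamma s * derive1 phi s) 0 t = - int (fun s => h s * phi s) 0 t).

Let int_hat e c : 0 < e -> 0 <= c -> c + 2 * e <= t -> int (hat e c) 0 t = 1.
Proof.
move=> e0 c0 ct; have eN0 : e != 0 by rewrite gt_eqF.
rewrite (int_FTC (ltW t0) (fun s _ => is_derive_spline c s eN0) (@continuous_hat R e c)).
by rewrite (spline0 e0 c0) (spline1 e0 ct) subr0.
Qed.

(** The kernel has mass one and lives on [[c, c + 2 * e]], so the integral is an average of [gamma]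
    just to the right of [c]. *)
Let hat_average e c d : 0 < e -> 0 <= c -> c + 2 * e <= t ->
  (forall s, c <= s <= c + 2 * e -> `|gamma s - gamma c| <= d) ->
  `|int (fun s => gamma s * hat e c s) 0 t - gamma c| <= d.
Proof.
move=> e0 c0 ct gd.
have chat := @continuous_hat R e c.
have i1 : integrable_itv 0 t (fun s => gamma s * hat e c s).
  by apply: continuous_integrable => s; apply: cvgM; [exact: cg|exact: chat].
have i2 : integrable_itv 0 t (hat e c) by exact: continuous_integrable.
have E : int (fun s => gamma s * hat e c s) 0 t - gamma c =
    int (fun s => gamma s * hat e c s + - gamma c * hat e c s) 0 t.
  by rewrite (intD i1 (integrableZ_itv (- gamma c) i2)) (intZ _ i2) int_hat// mulr1.
have i3 : integrable_itv 0 t (fun s => gamma s * hat e c s + - gamma c * hat e c s).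
  exact: (integrableD_itv i1 (integrableZ_itv (- gamma c) i2)).
rewrite E (le_trans (int_normr i3))//.
have -> : d = int (fun s => d * hat e c s) 0 t by rewrite (intZ _ i2) int_hat// mulr1.
apply: int_le; [exact: integrable_norm_itv i3|exact: integrableZ_itv i2|] => s _.
rewrite -mulrDl normrM (ger0_norm (hat_ge0 c s e0)).
have [sc|sc] := leP s c; first by rewrite hat_eq0 ?mulr0//; left.
have [se|se] := leP (c + 2 * e) s; first by rewrite hat_eq0 ?mulr0//; right.
by rewrite ler_wpM2r ?hat_ge0// gd// !ltW.
Qed.

(** A plateau that rises just after [a] and falls just after [b]; its derivative is a difference of
    two kernels. *)
Let test_function e a b : 0 < e -> 0 < a -> a < b -> b + 2 * e < t ->
  C1_compact_support 0 t (fun s => spline e a s - spline e b s) /\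
  derive1 (fun s => spline e a s - spline e b s) = (fun s => hat e a s - hat e b s).
Proof.
move=> e0 a0 ab bt; have eN0 : e != 0 by rewrite gt_eqF.
have d (s : R) : is_derive s 1 (fun s => spline e a s - spline e b s) (hat e a s - hat e b s).
  have h1 := @is_derive_spline R e a s eN0; have h2 := @is_derive_spline R e b s eN0.
  exact: is_deriveB.
have dE : derive1 (fun s => spline e a s - spline e b s) = (fun s => hat e a s - hat e b s).
  by apply/funext => s; rewrite derive1E; exact: derive_val.
split => //.
have sub : closed_support setT (fun s => spline e a s - spline e b s) `<=` `[a, b + 2 * e].
  rewrite [X in _ `<=` X](closure_id _).1; last exact: itv_closed.
  apply: closure_subset => s [_]; rewrite /= in_itv/=.
  have [sa|sa] := leP a s; last by rewrite !spline0 ?subrr ?eqxx//; lra.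
  have [sb|sb] := leP s (b + 2 * e); first by [].
  by rewrite !spline1 ?subrr ?eqxx//; lra.
split.
- split; first by move=> s; exact: ex_derive.
  by rewrite dE => s; apply: cvgB; exact: continuous_hat.
- apply: subclosed_compact sub; [exact: closed_closure|exact: segment_compact].
- by apply: (subset_trans sub); apply: subset_itv; rewrite bnd_simp.
Qed.

(** As [e n] tends to 0 the plateaus tend to the indicator of []a, b]] and the kernels concentrate
    at [a] and [b]; the weak formulation becomes the increment formula. *)
Let increment_interior a b : 0 < a -> a < b -> b < t -> gamma b - gamma a = int h a b.
Proof.
move=> a0 ab bt.
(* A third of the room to the right of [b], so that a falling edge of length [2 * e n] stays inside
   []0, t[]. *)
pose d := (t - b) / 3; have d0 : 0 < d by rewrite divr_gt0// subr_gt0.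
pose e n : R := d / n.+1%:R.
have e0 n : 0 < e n by rewrite divr_gt0.
have ed n : e n <= d by rewrite /e ler_pdivrMr// -[leLHS]mulr1 ler_pM2l// ler1n.
have bet n : b + 2 * e n < t by have := ed n; rewrite /d; lra.
have aet n : a + 2 * e n < t by have := bet n; lra.
have ecvg : e @ \oo --> (0 : R).
  by rewrite -(mulr0 d); apply: cvgM; [exact: cvg_cst|exact: cvg_harmonic].
pose phi n s := spline (e n) a s - spline (e n) b s.
have avg c : 0 < c -> (forall n, c + 2 * e n < t) ->
    (fun n => int (fun s => gamma s * hat (e n) c s) 0 t) @ \oo --> gamma c.
  move=> c0 ct; apply/cvgrPdist_le => r r0.
  have /cvgrPdist_le/(_ r r0) := cg (x := c).
  rewrite -nbhs_nearE => /nbhs_ballP[dl /= dl0 Hdl].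
  have dl2 : 0 < dl / 2 by rewrite divr_gt0.
  move/cvgrPdist_lt : ecvg => /(_ _ dl2) cve; near=> n; rewrite distrC.
  have en : e n < dl / 2.
    have : `|0 - e n| < dl / 2 by near: n.
    by rewrite sub0r normrN gtr0_norm.
  apply: hat_average => //; [exact: ltW|exact: ltW|] => s /andP[cs sc].
  rewrite distrC; apply: Hdl; rewrite /ball/= distrC ger0_norm; lra.
have L1 : (fun n => int (fun s => gamma s * derive1 (phi n) s) 0 t) @ \oo --> gamma a - gamma b.
  rewrite (_ : (fun n => _) = (fun n => int (fun s => gamma s * hat (e n) a s) 0 t -
      int (fun s => gamma s * hat (e n) b s) 0 t)).
    by apply: cvgB; apply: avg => //; exact: lt_trans ab.
  apply/funext => n; rewrite (test_function (e0 n) a0 ab (bet n)).2.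
  have ig c : integrable_itv 0 t (fun s => gamma s * hat (e n) c s).
    by apply: continuous_integrable => s; apply: cvgM; [exact: cg|exact: continuous_hat].
  rewrite (_ : (fun s => _) = (fun s => gamma s * hat (e n) a s + -1 * (gamma s * hat (e n) b s))).
    by rewrite (intD (ig a) (integrableZ_itv (-1) (ig b))) (intZ _ (ig b)) mulN1r.
  by apply/funext => s; ring.
pose ind : R -> R := \1_(`]a, b]).
have mind : borel ind.
  exact: measurable_indic.
have L2 : (fun n => int (fun s => h s * phi n s) 0 t) @ \oo --> int (fun s => h s * ind s) 0 t.
  apply: (Rintegral_dominated_cvg _ _ _ _ (integrable_norm_itv ih) _).2.
  - by [].
  - move=> n; apply: measurable_funTS; apply: measurable_funM => //.
    apply: continuous_measurable_fun => s.
    by apply: cvgB; apply: continuous_spline; rewrite gt_eqF.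
  - by apply: measurable_funTS; exact: measurable_funM.
  - apply: aeW => s _; apply: cvgM; first exact: cvg_cst.
    rewrite /ind indicE; have [sa|sa] := leP s a.
      rewrite memNset ?in_itv/= ?(le_gtF sa)//; last first.
        by rewrite in_itv/= => /andP[]; rewrite ltNge sa.
      rewrite (_ : (fun n => _) = (fun=> 0)); first exact: cvg_cst.
      by apply/funext => n; rewrite /phi !spline0// ?subrr//; lra.
    have late c : c < s -> (fun n => spline (e n) c s) @ \oo --> (1 : R).
      move=> cs; have cs2 : 0 < (s - c) / 2 by rewrite divr_gt0// subr_gt0.
      apply: cvg_near_cst; near=> n; apply: spline1 => //.
      have : `|0 - e n| < (s - c) / 2.
        by near: n; move/cvgrPdist_lt : ecvg; apply.
      by rewrite sub0r normrN gtr0_norm//; lra.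
    have [sb|sb] := leP s b.
      have c0 : (fun n => spline (e n) b s) @ \oo --> (0 : R).
        rewrite (_ : (fun n => _) = (fun=> 0)); first exact: cvg_cst.
        by apply/funext => n; rewrite spline0.
      have ms : s \in `]a, b]%classic by rewrite inE/= in_itv/= sa sb.
      rewrite ms.
      have H : phi ^~ s @ \oo --> (1 - 0 : R) by exact: cvgB (late _ sa) c0.
      by rewrite subr0 in H.
    rewrite memNset; last by rewrite /= in_itv/= => /andP[_]; rewrite leNgt sb.
    have H : phi ^~ s @ \oo --> (1 - 1 : R) by exact: cvgB (late _ sa) (late _ sb).
    by rewrite subrr in H.
  - move=> s n _; rewrite normrM ler_piMr//.
    have := spline_bounds a s (e0 n); have := spline_bounds b s (e0 n).
    by rewrite ler_norml /phi; lra.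
have E : int (fun s => h s * ind s) 0 t = int h a b.
  have sub : `]a, b]%classic `<=` (`]0, t[%classic : set R).
    by apply: subset_itv; rewrite bnd_simp// ltW.
  rewrite /int [RHS]Rintegral_itv_bndo_bndc; last exact: integrable_sub_itv ih (ltW a0) (ltW bt).
  rewrite -[in RHS](setIidr sub) Rintegral_mkcondr; apply: eq_Rintegral => s _.
  by rewrite /ind indicE patchE; case: (s \in _); rewrite ?mulr1 ?mulr0.
have : gamma a - gamma b = - int h a b.
  rewrite -E; apply: (cvg_unique _ L1) => //.
  rewrite (_ : (fun n => _) = (fun n => - int (fun s => h s * phi n s) 0 t)).
    exact: cvgN.
  by apply/funext => n; apply: weak; exact: (test_function _ _ _ _).1.
by move=> E'; rewrite -[RHS]opprK -E' opprB.
Unshelve. all: by end_near. Qed.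

(** [D] is constant in the interior; continuity up to the boundary carries the constant to 0 and
    [t], which test functions do not reach. *)
Lemma du_bois_reymond a b : 0 <= a -> a <= b -> b <= t -> gamma b - gamma a = int h a b.
Proof.
pose D s := gamma s - int h 0 s.
have cD : {within `[0, t], continuous D}.
  move=> s; apply: cvgB; first by have := @continuous_subspaceT _ _ `[0, t] _ cg s.
  exact: (int_continuous (ltW t0) ih).
have sub s : s <= t -> integrable_itv 0 s h.
  by move=> st; exact: integrable_sub_itv ih _ st.
have Dmid r s : 0 < r -> r < s -> s < t -> D r = D s.
  move=> r0 rs st; have := increment_interior r0 rs st.
  by rewrite /D (int_split (sub s (ltW st)) (b := r)) ?(ltW r0) ?(ltW rs)//; lra.
have Dconst s : 0 < s < t -> D s = D (t / 2).
  have t2 : 0 < t / 2 by rewrite divr_gt0.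
  have t3 : t / 2 < t by lra.
  move=> /andP[s0 st]; have [st2|ts|->//] := ltgtP s (t / 2); first exact: Dmid.
  by apply/esym; exact: Dmid.
have /(continuous_within_itvP _ t0)[_ D0 Dt] := cD.
have {}D0 : D 0 = D (t / 2).
  apply: (cvg_unique _ D0) => //; apply: cvg_near_cst; near=> s; apply: Dconst.
  by apply/andP; split; near: s; [exact: nbhs_right_gt|exact: nbhs_right_lt].
have {}Dt : D t = D (t / 2).
  apply: (cvg_unique _ Dt) => //; apply: cvg_near_cst; near=> s; apply: Dconst.
  by apply/andP; split; near: s; [exact: nbhs_left_gt|exact: nbhs_left_lt].
have Dall s : 0 <= s -> s <= t -> D s = D (t / 2).
  rewrite !le_eqVlt => /predU1P[<-//|s0] /predU1P[->//|st].
  by apply: Dconst; rewrite s0.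
move=> a0 ab bt; have := Dall a a0 (le_trans ab bt); have := Dall b (le_trans a0 ab) bt.
by rewrite /D (int_split (sub b bt) (b := a)) ?a0//; lra.
Unshelve. all: by end_near. Qed.

End du_bois_reymond.

(** * From paths to configurations and back *)

Section excursion.
Context {R : realType} (t : R) (gamma h : R -> R).
Notation mu := (@lebesgue_measure R).
Context (cg : continuous gamma)
  (mh : borel h)
  (ih : integrable_itv 0 t h)
  (gh : forall a b, 0 <= a -> a <= b -> b <= t -> gamma b - gamma a = int h a b).

Let sub a b : 0 <= a -> b <= t -> integrable_itv a b h.
Proof. by move=> a0 bt; exact: integrable_sub_itv ih _ _. Qed.

(** A continuous nondecreasing clock whose increments dominate those of [gamma]. *)
Let N s := int (fun r => `|h r|) 0 s.

Let N_split r s : 0 <= r -> r <= s -> s <= t -> N s - N r = int (fun r => `|h r|) r s.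
Proof.
move=> r0 rs st; have r0s : 0 <= r <= s by rewrite r0.
have := int_split (integrable_norm_itv (sub (lexx 0) st)) r0s.
by rewrite /N => ->; ring.
Qed.

Let N_incr r s : 0 <= r -> r <= s -> s <= t -> `|gamma s - gamma r| <= N s - N r.
Proof.
move=> r0 rs st; rewrite (gh r0 rs st) (N_split r0 rs st).
exact: int_normr (sub r0 st).
Qed.

Let N_mono r s : 0 <= r -> r <= s -> s <= t -> N r <= N s.
Proof.
move=> r0 rs st; rewrite -subr_ge0; exact: le_trans (N_incr r0 rs st).
Qed.

(* Halving [N s - N r] repeatedly shows that a function with increments bounded by
   [C * (N s - N r) ^+ 2] is constant. *)
Let bisection (Q : R -> R) (C a b : R) : 0 <= a -> a <= b -> b <= t ->
  (forall r s, a <= r -> r <= s -> s <= b -> `|Q s - Q r| <= C * (N s - N r) ^+ 2) ->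
  Q a = Q b.
Proof.
move=> a0 ab bt QN.
have halves n : forall r s, a <= r -> r <= s -> s <= b ->
    `|Q s - Q r| <= C * (N s - N r) ^+ 2 / 2 ^+ n.
  elim: n => [|n IHn] r s ar rs sb; first by rewrite expr0 divr1 QN.
  have r0 : 0 <= r by exact: (le_trans a0 ar).
  have st : s <= t by exact: (le_trans sb bt).
  have cN : {within `[r, s], continuous N}.
    apply: (@continuous_subspaceW _ _ _ `[0, t]).
      by apply: subset_itv; rewrite bnd_simp.
    by apply: int_continuous; [exact: le_trans r0 (le_trans rs st)|exact: integrable_norm_itv].
  have Nrs := N_mono r0 rs st.
  have [|m] := IVT (v := (N r + N s) / 2) rs cN.
    by rewrite (min_idPl Nrs) (max_idPr Nrs); apply/andP; split; lra.
  rewrite in_itv/= => /andP[rm ms] Nm.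
  have := IHn r m ar rm (le_trans ms sb); have := IHn m s (le_trans ar rm) ms sb.
  rewrite Nm; have -> : N s - (N r + N s) / 2 = (N s - N r) / 2 by field.
  have -> : (N r + N s) / 2 - N r = (N s - N r) / 2 by field.
  have -> : C * ((N s - N r) / 2) ^+ 2 / 2 ^+ n = C * (N s - N r) ^+ 2 / 2 ^+ n.+1 / 2.
    by rewrite (exprS _ n); field; rewrite expf_neq0.
  move=> h1 h2; rewrite -(subrKA (Q m)) (le_trans (ler_normD _ _))//; lra.
apply/eqP; rewrite -subr_eq0 -normr_eq0 distrC -[_ == _]negbK; apply/negP.
rewrite neq_lt ltNge normr_ge0/= => Q0.
set q := `|_| in Q0; set M := C * (N b - N a) ^+ 2.
have H n : q <= M / 2 ^+ n by exact: halves.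
have M0 : 0 < M by have := H 0%N; rewrite expr0 divr1; exact: lt_le_trans.
have : (fun n => M / 2 ^+ n) @ \oo --> (0 : R).
  rewrite (_ : (fun n => _) = geometric M 2^-1); last first.
    by apply/funext => n; rewrite /geometric/= exprVn.
  by apply: cvg_geometric; rewrite ger0_norm ?invf_lt1 ?ltr1n// invr_ge0.
move=> /cvgrPdist_lt/(_ _ Q0)[n _ /(_ n (leqnn n))].
by rewrite /= sub0r normrN ger0_norm ?ltNge ?H// divr_ge0// ?exprn_ge0// ltW.
Qed.

Let mul_integrable (k : R -> R) a b : 0 <= a -> b <= t ->
  borel k ->
  (forall s, `|k s| <= 1) -> integrable_itv a b (fun s => k s * h s).
Proof.
move=> a0 bt mk k1; apply: le_integrable (sub a0 bt) => //.
  by apply/measurable_EFinP; apply: measurable_funTS; exact: measurable_funM.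
by move=> s _ /=; rewrite lee_fin normrM ler_piMl.
Qed.

(** A Lipschitz approximation of the indicator of [y > 0]: it rises linearly from 0 to 1 on
    [[0, e]]. *)
Let cut e y : R := (ramp y - ramp (y - e)) / e.

Let cut_bounds e y : 0 < e -> `|cut e y| <= 1.
Proof.
move=> e0; rewrite /cut normrM normfV (gtr0_norm e0) ler_pdivrMr// mul1r.
by apply: (le_trans (ramp_lip _ _)); rewrite opprB addrCA subrr addr0 gtr0_norm.
Qed.

(** The chain rule for [Phi], a primitive of [cut e], along [gamma]. Instead of differentiating
    [gamma] almost everywhere, the defect [Q] is shown to have increments quadratic in those of [N],
    hence to be constant. *)
Let excursion_cut e a b : 0 < e -> 0 <= a -> a <= b -> b <= t -> gamma a = 0 -> gamma b = 0 ->
  int (fun s => cut e (gamma s) * h s) a b = 0.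
Proof.
move=> e0 a0 ab bt ga gb; have en0 : e != 0 by rewrite gt_eqF.
have mcut : borel (fun s => cut e (gamma s)).
  apply: continuous_measurable_fun => s; apply: cvgM; last exact: cvg_cst.
  apply: cvgB; last first.
    by apply: (@cvg_comp _ _ _ gamma (fun y => ramp (y - e))); [exact: cg|exact: continuous_ramp].
  by apply: (@cvg_comp _ _ _ gamma ramp); [exact: cg|exact: ramp_continuous].
have ik r s : 0 <= r -> s <= t -> integrable_itv r s (fun s => cut e (gamma s) * h s).
  by move=> r0 st; apply: mul_integrable => // x; exact: cut_bounds.
pose Phi y := (ramp y ^+ 2 - ramp (y - e) ^+ 2) / (2 * e).
pose Q s := Phi (gamma s) - int (fun s => cut e (gamma s) * h s) a s.
have : Q a = Q b; last first.
  rewrite /Q ga gb {1}/int set_itvoo0// Rintegral_set0; lra.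
apply: (@bisection Q (3 / e) a b a0 ab bt) => r s ar rs sb.
have r0 : 0 <= r by exact: (le_trans a0 ar).
have st : s <= t by exact: (le_trans sb bt).
have Nrs : 0 <= N s - N r by rewrite subr_ge0 N_mono.
(* The remainders of the two squared ramps, each at most [(N s - N r) ^+ 2], are divided by
   [2 * e]. *)
have Taylor : `|Phi (gamma s) - Phi (gamma r) - cut e (gamma r) * (gamma s - gamma r)| <=
    e^-1 * (N s - N r) ^+ 2.
  have k2 : (gamma s - gamma r) ^+ 2 <= (N s - N r) ^+ 2.
    rewrite -(@real_normK _ (gamma s - gamma r)) ?num_real// lerXn2r ?nnegrE//.
    exact: N_incr.
  have := ramp_sqr (gamma r) (gamma s - gamma r).
  have := ramp_sqr (gamma r - e) (gamma s - gamma r).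
  rewrite subrKC (_ : gamma r - e + (gamma s - gamma r) = gamma s - e); last by ring.
  rewrite /Phi /cut; set X := ramp _ ^+ 2 - _ - _; set Y := ramp _ ^+ 2 - _ - _ => hX hY.
  rewrite [X in `|X|](_ : _ = (Y - X) / (2 * e)); last by rewrite /X /Y; field.
  rewrite normrM normfV (@gtr0_norm _ (2 * e)) ?mulr_gt0//.
  rewrite ler_pdivrMr ?mulr_gt0// (le_trans (ler_normB _ _))//.
  rewrite (_ : _ * (2 * e) = 2 * (N s - N r) ^+ 2); last by field.
  lra.
(* [cut e] is Lipschitz with constant [2 / e], as a difference of two ramps; together with [Taylor]
   this makes up the [3 / e] above. *)
have drift : `|cut e (gamma r) * (gamma s - gamma r) - int (fun s => cut e (gamma s) * h s) r s| <=
    2 / e * (N s - N r) ^+ 2.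
  rewrite (gh r0 rs st) -(intZ _ (sub r0 st)).
  have i1 := integrableZ_itv (cut e (gamma r)) (sub r0 st).
  have i2 := integrableZ_itv (-1) (ik r s r0 st).
  rewrite [X in `|X|](_ : _ = int (fun u => cut e (gamma r) * h u + -1 * (cut e (gamma u) * h u)) r s);
    last by rewrite (intD i1 i2) (intZ _ (ik r s r0 st)) mulN1r.
  have i3 := integrableD_itv i1 i2.
  apply: (le_trans (int_normr i3)); have i4 := integrable_norm_itv (sub r0 st).
  rewrite (_ : 2 / e * (N s - N r) ^+ 2 = int (fun u => 2 / e * (N s - N r) * `|h u|) r s); last first.
    by rewrite (intZ _ i4) -N_split//; ring.
  apply: int_le; [exact: integrable_norm_itv|exact: integrableZ_itv|] => u /andP[ru us].
  rewrite mulN1r -mulrBl normrM ler_wpM2r//.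
  have h3 : `|gamma r - gamma u| <= N s - N r.
    rewrite distrC (le_trans (N_incr r0 (ltW ru) (le_trans (ltW us) st)))//.
    by rewrite lerD2r N_mono// ?(ltW us)// (le_trans r0)// ltW.
  have h1 := ramp_lip (gamma r) (gamma u); have h2 := ramp_lip (gamma r - e) (gamma u - e).
  rewrite opprB addrA subrK in h2.
  rewrite [X in `|X|](_ : _ = ((ramp (gamma r) - ramp (gamma u)) -
    (ramp (gamma r - e) - ramp (gamma u - e))) / e); last by rewrite /cut; field.
  rewrite normrM normfV (gtr0_norm e0) ler_pdivrMr// (_ : _ * e = 2 * (N s - N r)); last by field.
  by rewrite (le_trans (ler_normB _ _))//; lra.
have ars : a <= r <= s by rewrite ar.
rewrite /Q (int_split (ik a s a0 st) ars).
rewrite [X in `|X|](_ : _ = (Phi (gamma s) - Phi (gamma r) - cut e (gamma r) * (gamma s - gamma r)) +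
  (cut e (gamma r) * (gamma s - gamma r) - int (fun s => cut e (gamma s) * h s) r s)); last by ring.
rewrite (le_trans (ler_normD _ _))//.
rewrite (_ : 3 / e * (N s - N r) ^+ 2 = e^-1 * (N s - N r) ^+ 2 + 2 / e * (N s - N r) ^+ 2); last by ring.
exact: lerD.
Qed.

(** Letting [e] tend to 0 replaces [cut e] by the indicator: between two visits to 0, the velocity
    has mean zero on the positive side. *)
Lemma excursion a b : 0 <= a -> a <= b -> b <= t -> gamma a = 0 -> gamma b = 0 ->
  integrable_itv a b (fun s => (0 < gamma s)%R%:R * h s) /\
  int (fun s => (0 < gamma s)%R%:R * h s) a b = 0.
Proof.
move=> a0 ab bt ga gb.
have mpos : borel (fun s => (0 < gamma s)%R%:R : R).
  by apply: measurable_gt0; exact: continuous_measurable_fun.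
pose f n s := cut n.+1%:R^-1 (gamma s) * h s.
have e0 n : 0 < n.+1%:R^-1 :> R by rewrite invr_gt0.
have mcut n : borel (fun s => cut n.+1%:R^-1 (gamma s)).
  apply: continuous_measurable_fun => s; apply: cvgM; last exact: cvg_cst.
  apply: cvgB; last first.
    by apply: (@cvg_comp _ _ _ gamma (fun y => ramp (y - n.+1%:R^-1))); [exact: cg|exact: continuous_ramp].
  by apply: (@cvg_comp _ _ _ gamma ramp); [exact: cg|exact: ramp_continuous].
have [|||||ig c] := @Rintegral_dominated_cvg _ _ _ mu `]a, b[ _ f
  (fun s => (0 < gamma s)%R%:R * h s) (fun s => `|h s|) _ _ _ (integrable_norm_itv (sub a0 bt)).
- exact: measurable_itv.
- by move=> n; apply: measurable_funTS; exact: (measurable_funM (mcut n) mh).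
- by apply: measurable_funTS; exact: (measurable_funM mpos mh).
- apply: aeW => s _; apply: cvgM; last exact: cvg_cst.
  have [gs|gs] := ltP 0 (gamma s); last first.
    rewrite (_ : (fun n => _) = (fun=> 0)); first exact: cvg_cst.
    by apply/funext => n; rewrite /cut !ramp_0 ?subrr ?mul0r// subr_le0 (le_trans gs)// ltW.
  apply: cvg_near_cst; near=> n.
  have ng : n.+1%:R^-1 < gamma s by near: n; exact: (near_infty_natSinv_lt (PosNum gs)).
  rewrite /cut !ramp_id ?subr_ge0 ?ltW//.
  by rewrite opprB addrCA subrr addr0 divff// gt_eqF.
- by move=> s n _; rewrite normrM ler_piMl// cut_bounds.
split => //; apply: (cvg_unique _ c) => //.
rewrite (_ : (fun n => _) = (fun=> 0)); first exact: cvg_cst.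
by apply/funext => n; exact: excursion_cut.
Unshelve. all: by end_near. Qed.

End excursion.

(** * The cost of a path from below *)

Section running_cost.
Context {R : realType} (HL HR : R -> R) (RL RR mL mR cL cR a0 : R) (u0 : R -> R).
Context (hL : hamiltonian HL RL mL cL a0) (hR : hamiltonian HR RR mR cR a0).
Notation mu := (@lebesgue_measure R).

Definition running_cost (A gamma g : R -> R) s : R :=
  lagrangian HR RR (g s) * (0 < gamma s)%R%:R
  + lagrangian HL RL (g s) * (gamma s < 0)%R%:R
  - A s * (gamma s == 0)%:R.

Variant running_cost_spec (A gamma g : R -> R) (s : R) : R -> Prop :=
| RunRight of 0 < gamma s : running_cost_spec A gamma g s (lagrangian HR RR (g s))
| RunLeft of gamma s < 0 : running_cost_spec A gamma g s (lagrangian HL RL (g s))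
| RunWait of gamma s = 0 : running_cost_spec A gamma g s (- A s).

Lemma running_costP A gamma g s : running_cost_spec A gamma g s (running_cost A gamma g s).
Proof.
rewrite /running_cost; case: (ltgtP (gamma s) 0) => gs.
- by rewrite !mulr0 mulr1 add0r subr0; apply: RunLeft.
- by rewrite !mulr0 mulr1 addr0 subr0; apply: RunRight.
- by rewrite !mulr0 add0r mulr1 add0r; apply: RunWait.
Qed.

Lemma lagrangian_lip H r m c : hamiltonian H r m c a0 -> forall x y,
  `|lagrangian H r x - lagrangian H r y| <= r * `|x - y|.
Proof.
move=> hH x y; rewrite !lagrangianE.
have := ell_lip hH 1 x 1 y; have := ell_lip hH 1 y 1 x.
rewrite subrr normr0 mulr0 !addr0 (distrC y) ler_norml; lra.
Qed.

Lemma lagrangian_continuous H r m c : hamiltonian H r m c a0 -> continuous (lagrangian H r).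
Proof.
move=> hH x; apply/cvgrPdist_lt => e e0; have r0 := ham_r hH.
have d0 : 0 < r^-1 * e by rewrite mulr_gt0// invr_gt0.
near=> y; apply: (le_lt_trans (lagrangian_lip hH x y)); rewrite -ltr_pdivlMl//.
Unshelve. all: by end_near. Qed.

Lemma lagrangian_ge0 H r m c : hamiltonian H r m c a0 -> forall x, 0 <= lagrangian H r x.
Proof. by move=> hH x; rewrite lagrangianE; exact: ell_ge0 hH _ _. Qed.

Section path.
Context (t : R) (A gamma h : R -> R).
Context (cg : continuous gamma)
  (mA : borel A)
  (A01 : forall s, a0 <= A s <= 0)
  (mh : borel h)
  (ih : integrable_itv 0 t h).

Lemma measurable_running_cost :
  borel (running_cost A gamma h).
Proof.
have mg : borel gamma.
  exact: continuous_measurable_fun.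
have mng : borel (fun s => - gamma s).
  exact: measurable_funN.
have mlag H r m c : hamiltonian H r m c a0 ->
    borel (fun s => lagrangian H r (h s)).
  move=> hH; have ml := continuous_measurable_fun (lagrangian_continuous hH).
  exact: (measurableT_comp ml mh).
have p1 := measurable_gt0 mg; have p2 := measurable_gt0 mng.
rewrite (_ : running_cost A gamma h = (fun s =>
   lagrangian HR RR (h s) * (0 < gamma s)%R%:R + lagrangian HL RL (h s) * (0 < - gamma s)%R%:R
   - A s * (1 - (0 < gamma s)%R%:R - (0 < - gamma s)%R%:R))); last first.
  apply/funext => s; rewrite /running_cost oppr_gt0.
  by case: (ltgtP (gamma s) 0) => _ /=; congr (_ + _ - _ * _); rewrite ?mulr0n ?mulr1n; ring.
apply: measurable_funB; first apply: measurable_funD.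
- exact: (measurable_funM (mlag _ _ _ _ hR) p1).
- exact: (measurable_funM (mlag _ _ _ _ hL) p2).
- apply: (measurable_funM mA); apply: (measurable_funB _ p2).
  by apply: (measurable_funB _ p1); exact: measurable_cst.
Qed.

Lemma running_cost_ge0 s : 0 <= running_cost A gamma h s.
Proof.
by case: running_costP => _; [exact: lagrangian_ge0 hR _|exact: lagrangian_ge0 hL _|
  rewrite oppr_ge0; case/andP: (A01 s)].
Qed.

Lemma integrable_running_cost : integrable_itv 0 t (running_cost A gamma h).
Proof.
pose C := lagrangian HR RR 0 + lagrangian HL RL 0 - a0.
have i1 : integrable_itv 0 t (fun s : R => C).
  by apply: (@bounded_integrable _ _ _ _ `|C|) => //; exact: measurable_cst.
have i2 := integrableD_itv i1 (integrableZ_itv (RR + RL) (integrable_norm_itv ih)).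
apply: le_integrable i2 => //.
  by apply/measurable_EFinP; apply: measurable_funTS; exact: measurable_running_cost.
have RR0 := ham_r hR; have RL0 := ham_r hL.
have l1 := lagrangian_ge0 hR 0; have l2 := lagrangian_ge0 hL 0.
have a00 : a0 <= 0 by case/andP: (A01 0) => h1 h2; exact: le_trans h2.
move=> s _ /=; rewrite lee_fin ger0_norm ?running_cost_ge0// ler_normr; apply/orP; left.
have hs := normr_ge0 (h s).
have := lagrangian_lip hR (h s) 0; have := lagrangian_lip hL (h s) 0; rewrite subr0 !ler_norml.
have := mulr_ge0 (ltW RR0) hs; have := mulr_ge0 (ltW RL0) hs.
have := A01 s; rewrite /C.
by case: running_costP => _; lra.
Qed.

Context (gh : forall a b, 0 <= a -> a <= b -> b <= t -> gamma b - gamma a = int h a b).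
Notation rc := (running_cost A gamma h).
Notation F := (fun s => int A 0 s).

Let sub (k : R -> R) a b : integrable_itv 0 t k -> 0 <= a -> b <= t ->
  integrable_itv a b k.
Proof. by move=> ik a0' bt; exact: integrable_sub_itv ik _ _. Qed.

(** Jensen's inequality: each momentum [p] gives an affine minorant of the Lagrangian whose integral
    sees only the displacement; the supremum over [p] is taken afterwards. *)
Let one_side H r m c a b : hamiltonian H r m c a0 -> 0 <= a -> a <= b -> b <= t ->
  (forall s, a < s < b -> rc s = lagrangian H r (h s)) ->
  ell H r (b - a) (gamma b - gamma a) <= int rc a b.
Proof.
move=> hH a0' ab bt rcE; apply: (ell_le hH) => p pr.
have iab := sub ih a0' bt.
rewrite (gh a0' ab bt) [leLHS](_ : _ = int (fun s => p * h s + - H p) a b); last first.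
  rewrite (intD (integrableZ_itv p iab) (cst_integrable_itv _ _ _)) (intZ _ iab) int_cst//; ring.
apply: int_le.
- exact: (integrableD_itv (integrableZ_itv p iab) (cst_integrable_itv _ _ _)).
- exact: sub integrable_running_cost a0' bt.
- move=> s sab; rewrite rcE// lagrangianE.
  by have := ell_ge hH 1 (h s) pr; lra.
Qed.

Let one_side_at x a b : 0 <= a -> a <= b -> b <= t ->
  (forall s, a < s < b -> 0 < gamma s * x) ->
  ell_at HL HR RL RR x (b - a) (gamma b - gamma a) <= int rc a b.
Proof.
move=> a0' ab bt gx; rewrite /ell_at; case: ifPn => x0.
  apply: (one_side hR) => // s sab; have := gx s sab; rewrite pmulr_lgt0// => gs.
  by case: running_costP => //; lra.
apply: (one_side hL) => // s sab; have := gx s sab => gs.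
have {}x0 : x < 0.
  by rewrite lt_neqAle leNgt x0 andbT; apply: contraTneq gs => ->; rewrite mulr0 ltxx.
by move: gs; rewrite nmulr_lgt0// => gs; case: running_costP => //; lra.
Qed.

(** At momenta [p] where the Hamiltonians are at most [a0], the Lagrangians are at least
    [p * h s - A s]. The terms [p * h s] integrate to 0 on each side by [excursion]. *)
Let waiting a b : 0 <= a -> a <= b -> b <= t -> gamma a = 0 -> gamma b = 0 ->
  F a - F b <= int rc a b.
Proof.
move=> a0' ab bt ga gb.
have [pR pRr HpR] := ham_min hR; have [pL pLr HpL] := ham_min hL.
have [ipos pos0] := excursion cg mh ih gh a0' ab bt ga gb.
have cNg : continuous (fun s => - gamma s) by move=> s; apply: cvgN; exact: cg.
have mNh : borel (fun s => -1 * h s).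
  by apply: measurable_funM => //; exact: measurable_cst.
(* The left side is the right side of the reflected path. *)
have [ineg neg0] : integrable_itv a b (fun s => (0 < - gamma s)%R%:R * (-1 * h s)) /\
    int (fun s => (0 < - gamma s)%R%:R * (-1 * h s)) a b = 0.
  apply: (excursion cNg mNh (integrableZ_itv (-1) ih)) => //; rewrite ?ga ?gb ?oppr0//.
  move=> r s r0 rs st; rewrite (intZ _ (sub ih r0 st)) -gh//; lra.
have iA := integrableZ_itv (-1) (control_integrable a b mA A01).
have i1 := integrableZ_itv pR ipos; have i2 := integrableZ_itv (- pL) ineg.
have i3 := integrableD_itv (integrableD_itv i1 i2) iA.
have FE : F a - F b = int (fun s => pR * ((0 < gamma s)%R%:R * h s) +
    - pL * ((0 < - gamma s)%R%:R * (-1 * h s)) + -1 * A s) a b.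
  rewrite (intD (integrableD_itv i1 i2) iA) (intD i1 i2) (intZ _ ipos) (intZ _ ineg) pos0 neg0.
  rewrite (intZ _ (control_integrable a b mA A01)).
  have a0b : 0 <= a <= b by rewrite a0'.
  by rewrite (int_split (control_integrable 0 b mA A01) a0b); ring.
rewrite FE; apply: int_le => //.
  exact: sub integrable_running_cost a0' bt.
move=> s _; rewrite oppr_gt0; have := A01 s.
case: running_costP => gs.
- rewrite gs (lt_gtF gs) /= lagrangianE; have := ell_ge hR 1 (h s) pRr; lra.
- rewrite gs (lt_gtF gs) /= lagrangianE; have := ell_ge hL 1 (h s) pLr; lra.
- rewrite gs ltxx /=; lra.
Qed.

Let same_sign r s : r <= s -> (forall u, r <= u <= s -> gamma u != 0) -> 0 < gamma r * gamma s.
Proof.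
move=> rs nz; rewrite ltNge; apply/negP => neg.
have [|u] := @IVT _ gamma r s 0 rs (continuous_subspaceT cg).
  by rewrite ge_min le_max; have [h1|h1] := leP (gamma r) 0; have [h2|h2] := leP (gamma s) 0 => //=;
    nra.
by rewrite in_itv/= => /nz /eqP.
Qed.

(** The path is cut at its first and last visits [a] and [b] to the interface: it is one-sided
    before and after, and is compared with waiting in between. A path without zeros is compared with
    the straight line. *)
Lemma running_cost_lower : 0 < t -> gamma t != 0 ->
  exists2 v, configs HL HR RL RR u0 F (gamma t) t v & v <= int rc 0 t + u0 (gamma 0).
Proof.
move=> t0 gt0; have tt : t <= t by [].
pose Z := [set s | 0 <= s <= t /\ gamma s = 0].
have [Z0|nZ] := pselect (Z !=set0); last first.
  have nz u : 0 <= u <= t -> gamma u != 0.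
    by move=> ut; apply/eqP => gu; apply: nZ; exists u.
  exists (ell_at HL HR RL RR (gamma t) t (gamma t - gamma 0) + u0 (gamma 0)).
    left; exists (gamma 0); split => //; apply: same_sign; first exact: ltW.
    by move=> u ut; exact: nz.
  rewrite lerD2r -[X in ell_at _ _ _ _ _ X]subr0; apply: one_side_at => //; first exact: ltW.
  move=> s /andP[s0 st]; apply: same_sign; first exact: ltW.
  by move=> u /andP[su ut]; apply: nz; rewrite ut (le_trans (ltW s0)).
have cZ : compact Z.
  apply: (subclosed_compact _ (@segment_compact _ 0 t)) => [|s [] //].
  rewrite (_ : Z = `[0, t]%classic `&` gamma @^-1` [set 0]).
    apply: closedI; first exact: itv_closed.
    apply: closed_comp; first by move=> s _; exact: cg.
    by apply: accessible_closed_set1; exact: hausdorff_accessible.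
  by apply/seteqP; split => s /=; rewrite in_itv.
have cid : {within Z, continuous (fun s : R => s)} by apply: continuous_subspaceT => s; exact: cvg_id.
have [b /set_mem[/andP[b0 bt] gb] bmax] := compact_EVT_max Z0 cZ cid.
have [a /set_mem[/andP[a0' at_] ga] amin] := compact_EVT_min Z0 cZ cid.
have ab : a <= b by apply: amin; rewrite inE; split => //; rewrite b0.
have bt' : b < t by rewrite lt_neqAle bt andbT; apply: contraTneq gt0 => <-; rewrite gb eqxx.
have irc := integrable_running_cost.
have s1 : 0 <= a <= t by rewrite a0'.
have s2 : a <= b <= t by rewrite ab.
rewrite (int_split irc s1) (int_split (sub irc a0' tt) s2).
exists (ell_at HL HR RL RR (gamma 0) a (- gamma 0) + u0 (gamma 0) + (F a - F b) +
  ell_at HL HR RL RR (gamma t) (t - b) (gamma t)).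
  (* If [a = 0] then the path starts at 0, as [configs] demands. *)
  right; exists a, b, (gamma 0); split => //.
  by move: a0'; rewrite le_eqVlt => /predU1P[E|]; [right; rewrite [in LHS]E|left].
have h1 : ell_at HL HR RL RR (gamma 0) a (- gamma 0) <= int rc 0 a.
  have -> : - gamma 0 = gamma a - gamma 0 by rewrite ga sub0r.
  rewrite -[X in ell_at _ _ _ _ _ X]subr0; apply: one_side_at => // s /andP[s0 sa].
  rewrite mulrC; apply: same_sign; first exact: ltW.
  move=> u /andP[u0' us]; apply/eqP => gu.
  have : a <= u by apply: amin; rewrite inE; split => //; rewrite u0' (le_trans us)// (le_trans (ltW sa)).
  by rewrite leNgt (le_lt_trans us sa).
have h2 : ell_at HL HR RL RR (gamma t) (t - b) (gamma t) <= int rc b t.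
  have E : gamma t = gamma t - gamma b by rewrite gb subr0.
  rewrite {2}E; apply: one_side_at => // s /andP[bs st].
  apply: same_sign; first exact: ltW.
  move=> u /andP[su ut]; apply/eqP => gu.
  have : u <= b by apply: bmax; rewrite inE; split => //; rewrite ut (le_trans b0)// (le_trans (ltW bs)).
  by rewrite leNgt (lt_le_trans bs su).
have := waiting a0' ab bt ga gb; lra.
Qed.

End path.
End running_cost.

(** * Polygonal paths and the cost from above *)

Section polygonal_paths.
Context {R : realType}.
Notation mu := (@lebesgue_measure R).

Lemma C1_compact_support_ends (a b : R) phi : C1_compact_support a b phi -> phi a = 0 /\ phi b = 0.
Proof.
move=> [_ _ sub].
have supp s : phi s != 0 -> `]a, b[%classic s.
  by move=> ps; apply: sub; apply: subset_closure.
split; apply/eqP; rewrite -[_ == _]negbK; apply/negP => /supp; rewrite /= in_itv/= ltxx//.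
by rewrite andbF.
Qed.

Lemma measurable_gtr (c : R) :
  borel (fun s : R => (c < s)%R%:R : R).
Proof.
rewrite (_ : (fun s => _) = (fun s => (0 < s - c)%R%:R)).
  by apply: measurable_gt0; exact: measurable_funB.
by apply/funext => s; rewrite -(subr_gt0 c s).
Qed.

Section weak.
Context (t : R) (t0 : 0 < t) (phi : R -> R) (sphi : C1_compact_support 0 t phi).

Let dphi (s : R) : is_derive s 1 phi (derive1 phi s).
Proof. by case: sphi => -[d _] _ _; rewrite derive1E; exact/derivableP/d. Qed.

Let cphi : continuous phi.
Proof. by move=> s; have d := dphi s; exact/differentiable_continuous/derivable1_diffP. Qed.

Let cdphi : continuous (derive1 phi).
Proof. by case: sphi => -[]. Qed.

Let mpos c : borel (fun s : R => (c < s)%R%:R : R).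
Proof. exact: measurable_gtr. Qed.

Let ramp_integrable c : integrable_itv 0 t (fun s => ramp (s - c) * derive1 phi s).
Proof.
by apply: continuous_integrable => s; apply: cvgM; [exact: continuous_ramp|exact: cdphi].
Qed.

Let step_integrable c : integrable_itv 0 t (fun s : R => (c < s)%R%:R * phi s).
Proof.
apply: (le_integrable _ _ _ (continuous_integrable 0 t cphi)) => //.
  apply/measurable_EFinP; apply: measurable_funTS; apply: (measurable_funM (mpos c)).
  exact: continuous_measurable_fun.
move=> s _ /=; rewrite lee_fin normrM; case: (c < s)%R => /=.
  by rewrite normr1 mul1r.
by rewrite normr0 mul0r normr_ge0.
Qed.

(** Integration by parts on [[c, t]]: the boundary terms vanish with the ramp at [c] and with [phi]
    at [t]. *)
Lemma weak_ramp c : 0 <= c -> c <= t ->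
  int (fun s => ramp (s - c) * derive1 phi s) 0 t = - int (fun s : R => (c < s)%R%:R * phi s) 0 t.
Proof.
move=> c0 ct; have [phi0 phit] := C1_compact_support_ends sphi.
have s0 : 0 <= c <= t by rewrite c0.
rewrite (int_split (ramp_integrable c) s0) (int_split (step_integrable c) s0).
rewrite (@int_eq _ _ (fun=> 0) 0 c); last first.
  by move=> s /andP[_ sc]; rewrite ramp_0 ?mul0r// subr_le0 ltW.
rewrite [X in _ = - (X + _)](@int_eq _ _ (fun=> 0) 0 c); last first.
  by move=> s /andP[_ sc]; rewrite (lt_gtF sc) mul0r.
rewrite int_cst// !mul0r !add0r.
rewrite (@int_eq _ _ (fun s => (s - c) * derive1 phi s) c t); last first.
  by move=> s /andP[cs _]; rewrite ramp_id// subr_ge0 ltW.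
rewrite [X in _ = - X](@int_eq _ _ phi c t); last first.
  by move=> s /andP[cs _]; rewrite cs mul1r.
have cl : continuous (fun s => (s - c) * derive1 phi s).
  by move=> s; apply: cvgM; [apply: cvgB; [exact: cvg_id|exact: cvg_cst]|exact: cdphi].
apply/eqP; rewrite -subr_eq0 opprK.
rewrite -(intD (continuous_integrable _ _ cl) (continuous_integrable _ _ cphi)).
have dF (s : R) : is_derive s 1 (fun s => (s - c) * phi s) ((s - c) * derive1 phi s + phi s).
  have d := dphi s; apply: is_derive_eq.
  by rewrite /GRing.scale/=; ring.
rewrite (int_FTC ct (fun s _ => dF s)); first by rewrite phit mulr0 subrr mul0r subrr.
by move=> s; apply: cvgD; [exact: cl|exact: cphi].
Qed.

Lemma weak_cst : int (derive1 phi) 0 t = 0.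
Proof.
have [phi0 phit] := C1_compact_support_ends sphi.
by rewrite (int_FTC (ltW t0) (fun s _ => dphi s) cdphi) phi0 phit subrr.
Qed.

(** For [a <= b]: slope [c1] from [y], rest between [a] and [b], then slope [c2]. As a combination
    of ramps it gets its weak derivative from [weak_ramp]; [s - 0] gives the first ramp the common
    form. *)
Definition polygon y c1 a c2 b (s : R) : R := y + c1 * ramp (s - 0) - c1 * ramp (s - a) + c2 * ramp (s - b).
Definition polygon_slope c1 a c2 b (s : R) : R :=
  c1 * (0 < s)%R%:R - c1 * (a < s)%R%:R + c2 * (b < s)%R%:R.

Lemma polygon_continuous y c1 a c2 b : continuous (polygon y c1 a c2 b).
Proof.
move=> s; rewrite /polygon; apply: cvgD; last first.
  by apply: cvgM; [exact: cvg_cst|exact: continuous_ramp].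
apply: cvgB; last by apply: cvgM; [exact: cvg_cst|exact: continuous_ramp].
by apply: cvgD; [exact: cvg_cst|apply: cvgM; [exact: cvg_cst|exact: continuous_ramp]].
Qed.

Lemma polygon_slope_measurable c1 a c2 b :
  borel (polygon_slope c1 a c2 b).
Proof.
have m k c : borel (fun s : R => k * (c < s)%R%:R : R).
  exact: (measurable_funM (measurable_cst k) (mpos c)).
apply: (measurable_funD _ (m _ _)); exact: (measurable_funB (m _ _) (m _ _)).
Qed.

Lemma polygon_slope_bounded c1 a c2 b s :
  `|polygon_slope c1 a c2 b s| <= `|c1| + `|c1| + `|c2|.
Proof.
have m (k : R) c : `|k * (c < s)%R%:R| <= `|k|.
  by case: (c < s)%R; rewrite /= ?mulr1// mulr0 normr0 normr_ge0.
rewrite /polygon_slope (le_trans (ler_normD _ _))// lerD//.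
by rewrite (le_trans (ler_normB _ _))// lerD.
Qed.

Lemma weak_polygon y c1 a c2 b : 0 <= a -> a <= t -> 0 <= b -> b <= t ->
  int (fun s => polygon y c1 a c2 b s * derive1 phi s) 0 t =
  - int (fun s => polygon_slope c1 a c2 b s * phi s) 0 t.
Proof.
move=> a0 at_ b0 bt.
have id := continuous_integrable 0 t cdphi.
rewrite (@int_eq _ _ (fun s => y * derive1 phi s + c1 * (ramp (s - 0) * derive1 phi s) +
  (- c1) * (ramp (s - a) * derive1 phi s) + c2 * (ramp (s - b) * derive1 phi s))); last first.
  by move=> s _; rewrite /polygon; ring.
have j1 := integrableZ_itv y id; have j2 := integrableZ_itv c1 (ramp_integrable 0).
have j3 := integrableZ_itv (- c1) (ramp_integrable a); have j4 := integrableZ_itv c2 (ramp_integrable b).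
have j12 := integrableD_itv j1 j2; have j123 := integrableD_itv j12 j3.
rewrite (intD j123 j4) (intD j12 j3) (intD j1 j2) !intZ//.
rewrite weak_cst !weak_ramp ?lexx ?(ltW t0)//.
rewrite (@int_eq _ (fun s => polygon_slope _ _ _ _ s * _)
  (fun s : R => c1 * ((0 < s)%R%:R * phi s) + (- c1) * ((a < s)%R%:R * phi s) +
    c2 * ((b < s)%R%:R * phi s))); last first.
  by move=> s _; rewrite /polygon_slope; ring.
have k1 := integrableZ_itv c1 (step_integrable 0); have k2 := integrableZ_itv (- c1) (step_integrable a).
have k3 := integrableZ_itv c2 (step_integrable b).
rewrite (intD (integrableD_itv k1 k2) k3) (intD k1 k2) !intZ//; ring.
Qed.

End weak.
End polygonal_paths.

Section polygon_cost.
Context {R : realType} (HL HR : R -> R) (RL RR mL mR cL cR a0 : R) (u0 : R -> R).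
Context (hL : hamiltonian HL RL mL cL a0) (hR : hamiltonian HR RR mR cR a0).
Notation mu := (@lebesgue_measure R).
Context (A : R -> R) (mA : borel A)
  (A01 : forall s, a0 <= A s <= 0).
Notation F := (fun s => int A 0 s).
Notation rc := (running_cost HL HR RL RR A).

Let slope_at (x : R) := if 0 < x then lagrangian HR RR else lagrangian HL RL.

Let slope_atE (x tau d : R) : 0 < tau -> tau * slope_at x (d / tau) = ell_at HL HR RL RR x tau d.
Proof.
by move=> tau0; rewrite /slope_at /ell_at; case: ifPn => _;
  [exact: ell_lagrangian hR tau d tau0|exact: ell_lagrangian hL tau d tau0].
Qed.

(** The second alternative is a first leg spent at rest at 0: there the cost [- A s] is at most
    [- a0], hence at most either Lagrangian at 0. *)
Let rc_le (y : R) (gamma h : R -> R) (s : R) : 0 < gamma s * y \/ gamma s = 0 /\ h s = 0 ->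
  rc gamma h s <= slope_at y (h s).
Proof.
case=> [gy|[gs hs]].
  rewrite /slope_at; case: ltP => y0.
    by move: gy; rewrite pmulr_lgt0// => gs; case: running_costP => // ?; lra.
  have {}y0 : y < 0 by rewrite lt_neqAle y0 andbT; apply: contraTneq gy => ->; rewrite mulr0 ltxx.
  by move: gy; rewrite nmulr_lgt0// => gs; case: running_costP => // ?; lra.
have := A01 s; rewrite hs; have := ell_wait hL ler01; have := ell_wait hR ler01.
by case: running_costP => [||_]; [lra|lra|]; rewrite /slope_at; case: ifPn => _; rewrite lagrangianE; lra.
Qed.

Let cst_integrable (k : R) a b : integrable_itv a b (fun s : R => k) := cst_integrable_itv k a b.

Lemma running_cost_upper x t v : 0 < t -> x != 0 -> configs HL HR RL RR u0 F x t v ->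
  exists y c1 a c2 b, [/\ [/\ 0 <= a, a <= t, 0 <= b & b <= t],
    polygon y c1 a c2 b t = x &
    int (rc (polygon y c1 a c2 b) (polygon_slope c1 a c2 b)) 0 t + u0 (polygon y c1 a c2 b 0) <= v].
Proof.
move=> t0 x0.
have irc y c1 a c2 b r s : 0 <= r -> s <= t ->
    integrable_itv r s (rc (polygon y c1 a c2 b) (polygon_slope c1 a c2 b)).
  move=> r0 st; apply: (integrable_sub_itv _ r0 st).
  have mh := polygon_slope_measurable c1 a c2 b.
  have ih : integrable_itv 0 t (polygon_slope c1 a c2 b).
    by apply: (@bounded_integrable _ _ _ _ _ mh) => s' _; exact: polygon_slope_bounded.
  exact: (integrable_running_cost hL hR (@polygon_continuous _ y c1 a c2 b) mA A01 mh ih).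
case=> [[y [yx ->]]|[a [b [y [a0' ab bt ay ->]]]]].
  (* A single slope: with [a = b = t] the other two ramps vanish on [[0, t]]. *)
  exists y, ((x - y) / t), t, 0, t; split; first by rewrite !(ltW t0) lexx.
    by rewrite /polygon subrr (ramp_0 (lexx 0)) subr0 (ramp_id (ltW t0)); field; rewrite gt_eqF.
  set p := polygon _ _ _ _ _; set h := polygon_slope _ _ _ _.
  have p0 : p 0 = y.
    have t0' : 0 - t <= 0 by rewrite sub0r oppr_le0 ltW.
    by rewrite /p /polygon (ramp_0 t0') subrr (ramp_0 (lexx 0)); ring.
  rewrite p0 lerD2r -slope_atE// mulrC.
  rewrite -[X in _ * X]subr0 -(int_cst _ (ltW t0)); apply: int_le => //; first exact: irc.
  move=> s /andP[s0 st].
  have ps : p s = y + (x - y) / t * s.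
    have st' : s - t <= 0 by rewrite subr_le0 ltW.
    by rewrite /p /polygon subr0 (ramp_id (ltW s0)) (ramp_0 st'); ring.
  have hs : h s = (x - y) / t.
    by rewrite /h /polygon_slope s0 (lt_gtF st) /=; ring.
  rewrite -hs; apply: rc_le; left.
  have -> : p s = ((t - s) * y + s * x) / t by rewrite ps; field; rewrite gt_eqF.
  rewrite mulrAC divr_gt0// mulrDl addr_gt0//.
    by rewrite -mulrA mulr_gt0// subr_gt0.
  by rewrite -mulrA mulr_gt0// -expr2 exprn_even_gt0.
(* If [a = 0] then [y = 0] and division by 0 gives [c1 = 0], so [c1 * a = - y] in all cases. *)
pose c1 := - y / a; pose c2 := x / (t - b).
have tb : 0 < t - b by rewrite subr_gt0.
have b0 : 0 <= b by exact: le_trans ab.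
have c1a : c1 * a = - y.
  case: ay => [a1|y0]; first by rewrite /c1 divfK// gt_eqF.
  by rewrite /c1 y0 oppr0 !mul0r.
exists y, c1, a, c2, b.
have a_t : a <= t by rewrite (le_trans ab)// ltW.
split; first by rewrite a0' b0 (ltW bt).
  rewrite /polygon subr0 !ramp_id ?(ltW t0) ?(ltW tb) ?subr_ge0//.
  have : c2 * (t - b) = x by rewrite /c2 divfK// gt_eqF.
  by move: c1a; lra.
set p := polygon _ _ _ _ _; set h := polygon_slope _ _ _ _.
have p0 : p 0 = y.
  have a1 : 0 - a <= 0 by rewrite sub0r oppr_le0.
  have b1 : 0 - b <= 0 by rewrite sub0r oppr_le0.
  by rewrite /p /polygon subrr (ramp_0 a1) (ramp_0 b1) (ramp_0 (lexx 0)); ring.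
have s1 : 0 <= a <= t by rewrite a0'.
have s2 : a <= b <= t by rewrite ab ltW.
rewrite p0 (int_split (irc _ _ _ _ _ 0 t (lexx _) (lexx _)) s1).
rewrite (int_split (irc _ _ _ _ _ a t a0' (lexx _)) s2) -/p -/h.
have i1 : int (rc p h) 0 a <= ell_at HL HR RL RR y a (- y).
  move: a0'; rewrite le_eqVlt => /predU1P[<-|a1].
    by rewrite /int set_itvoo0// Rintegral_set0; exact: ell_at_ge0 hL hR _ _ _.
  rewrite -slope_atE// mulrC -[X in _ * X]subr0 -(int_cst _ (ltW a1)).
  apply: int_le => //; first exact: irc.
  move=> s /andP[s0 sa].
  have sb : s <= b by rewrite (le_trans (ltW sa)).
  have ps : p s = y + c1 * s.
    by rewrite /p /polygon subr0 ramp_id ?(ltW s0)// !ramp_0 ?subr_le0 ?(ltW sa)//; ring.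
  have hs : h s = c1.
    by rewrite /h /polygon_slope s0 (lt_gtF sa) (le_gtF sb) /=; ring.
  rewrite -/c1 -hs; apply: rc_le; rewrite ps hs.
  have -> : y + c1 * s = (a - s) / a * y by rewrite /c1; field; rewrite gt_eqF.
  have [y0|y0] := eqVneq y 0; first by right; rewrite /c1 y0 oppr0 mul0r !mulr0.
  by left; rewrite -mulrA mulr_gt0 ?divr_gt0 ?subr_gt0// -expr2 exprn_even_gt0.
have i2 : int (rc p h) a b <= F a - F b.
  have iA := control_integrable a b mA A01.
  have a0b : 0 <= a <= b by rewrite a0'.
  rewrite (int_split (control_integrable 0 b mA A01) a0b) opprD addNKr -mulN1r -(intZ _ iA).
  apply: int_le; [exact: irc (ltW bt)|exact: integrableZ_itv|] => s /andP[as_ sb].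
  have ps : p s = 0.
    rewrite /p /polygon subr0 ramp_id ?(le_trans a0' (ltW as_))// ramp_id ?subr_ge0 ?(ltW as_)//.
    by rewrite ramp_0 ?subr_le0 ?(ltW sb)//; move: c1a; lra.
  by case: running_costP => //; rewrite ?ps ?ltxx// mulN1r.
have i3 : int (rc p h) b t <= ell_at HL HR RL RR x (t - b) x.
  rewrite -slope_atE// mulrC -(int_cst _ (ltW bt)).
  apply: int_le => //; first exact: irc.
  move=> s /andP[bs st].
  have as_ : a < s by exact: le_lt_trans bs.
  have s0 : 0 < s by exact: le_lt_trans as_.
  have ps : p s = c2 * (s - b).
    rewrite /p /polygon subr0 !ramp_id ?subr_ge0 ?(ltW bs) ?(ltW as_) ?(ltW s0)//.
    by move: c1a; lra.
  have hs : h s = c2.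
    by rewrite /h /polygon_slope s0 as_ bs /=; ring.
  rewrite -/c2 -hs; apply: rc_le; left; rewrite ps /c2.
  rewrite -!mulrA mulrC -!mulrA mulr_gt0 ?invr_gt0// mulr_gt0 ?subr_gt0//.
  by rewrite -expr2 exprn_even_gt0.
lra.
Qed.

End polygon_cost.

(** * Borel representatives of paths and controls *)

Section borel_paths.
Context {R : realType}.
Notation mu := (@lebesgue_measure R).
Notation cmu := (@completed_lebesgue_measure R).

Lemma continuous_extension (t : R) (gamma : R -> R) : 0 <= t ->
  {within `[0, t], continuous gamma} ->
  exists2 g, continuous g & forall s, 0 <= s <= t -> g s = gamma s.
Proof.
move=> t0 cg; exists (gamma \o clamp 0 t); last by move=> s st; rewrite /= clamp_id.
move=> s; have inI : `[0, t]%classic (clamp 0 t s) by rewrite /= in_itv/=; exact: clamp_in.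
move/subspace_continuousP : cg => /(_ _ inI) c.
have cw : clamp 0 t @ s --> within `[0, t] (nbhs (clamp 0 t s)).
  move=> B HB; apply: (@filterS _ (nbhs s) _ _ _ _ (@clamp_continuous R 0 t s _ HB)) => i /=.
  by move=> H; apply: H; rewrite in_itv/=; exact: clamp_in.
exact: (cvg_comp (clamp 0 t) _ cw c).
Qed.

Lemma Rintegral_completed (f g : R -> R) a b :
  borel g ->
  {ae mu, forall s, a < s < b -> f s = g s} ->
  \int[cmu]_(s in `]a, b[) f s = int g a b.
Proof.
move=> mg fg; rewrite /int /Rintegral (@ae_eq_integral_completed _ _ _ (EFin \o g))//.
  by apply/measurable_EFinP; exact: measurable_funTS.
by apply: (aeS _ fg) => s H /=; rewrite in_itv/= => /H ->.
Qed.

(** A square integrable velocity is integrable on a bounded interval because [|h| <= 1 + h ^+ 2];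
    [du_bois_reymond] then applies to the continuous extension of the path. *)
Lemma H1_borel (t : R) (gamma g : R -> R) : 0 < t -> H1_with_derivative 0 t gamma g ->
  exists gamma' h : R -> R,
  [/\ continuous gamma', forall s, 0 <= s <= t -> gamma' s = gamma s,
      borel h,
      integrable_itv 0 t h &
      {ae mu, forall s, 0 < s < t -> g s = h s} /\
      forall a b, 0 <= a -> a <= b -> b <= t -> gamma' b - gamma' a = int h a b].
Proof.
move=> t0 [cg _ [mg g2] wd].
have [g' cg' g'E] := continuous_extension (ltW t0) cg.
have mI : measurable (`]0, t[%classic : set (measurableTypeR R)) by [].
have [N [mN N0 mh]] := lebesgue_measurable_ae_borel mI mg.
set h := g \_ _ in mh.
have gh : {ae mu, forall s, 0 < s < t -> g s = h s}.
  exists N; split => // s /= H; apply: contrapT => nN; apply: H => st.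
  rewrite /h patchE mem_set//; split => //=; by rewrite in_itv.
have mh2 : borel (fun s => h s ^+ 2).
  exact: measurable_funX.
have ih2 : integrable_itv 0 t (fun s => h s ^+ 2).
  apply/integrableP; split; first by apply/measurable_EFinP; exact: measurable_funTS.
  apply: le_lt_trans g2; rewrite le_eqVlt; apply/orP; left; apply/eqP.
  rewrite (@ae_eq_integral_completed _ _ _ (EFin \o (fun s => h s ^+ 2)))//.
  - by apply: eq_integral => s _; rewrite /= ger0_norm// sqr_ge0.
  - by apply/measurable_EFinP; exact: measurable_funTS.
  - by apply: (aeS _ gh) => s H /=; rewrite in_itv/= => /H ->.
have ih : integrable_itv 0 t h.
  have i1 : integrable_itv 0 t (fun s : R => 1 : R).
    by apply: (@bounded_integrable _ _ _ _ 1) => // s _; rewrite normr1.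
  apply: le_integrable (integrableD_itv i1 ih2) => //.
    by apply/measurable_EFinP; exact: measurable_funTS.
  move=> s _ /=; rewrite lee_fin (@ger0_norm _ (1 + h s ^+ 2)); last by rewrite addr_ge0// sqr_ge0.
  by rewrite -(@real_normK _ (h s)) ?num_real//; have := normr_ge0 (h s); nra.
exists g', h; split => //; split => //.
move=> a b a0 ab bt; apply: (du_bois_reymond t0 cg' mh ih) => // phi sphi.
have [[dphi cdphi] _ _] := sphi.
have cphi : continuous phi by move=> s; exact/differentiable_continuous/derivable1_diffP/dphi.
have := wd _ sphi.
rewrite (@Rintegral_completed _ (fun s => g' s * derive1 phi s)); last first.
- by apply: aeW => s /andP[s0 st]; rewrite g'E// !ltW.
- by apply: measurable_funM; exact: continuous_measurable_fun.
rewrite (@Rintegral_completed _ (fun s => h s * phi s))//; last first.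
  by apply: (aeS _ gh) => s H st; rewrite H.
by apply: measurable_funM => //; exact: continuous_measurable_fun.
Qed.

Lemma L2_bounded (f : R -> R) a b (M : R) :
  borel f ->
  (forall s, a < s < b -> `|f s| <= M) -> L2 a b f.
Proof.
move=> mf fM; split.
  by apply: borel_lebesgue_measurable_fun => //; exact: measurable_funTS.
have mf2 : borel (fun s => f s ^+ 2).
  exact: measurable_funX.
rewrite integral_completed_lebesgue//; last by apply/measurable_EFinP; exact: measurable_funTS.
apply: integrable_lty => //; apply: (@bounded_integrable _ _ _ _ (M ^+ 2)) => // s sab.
by rewrite normrX; have := fM s sab; have := normr_ge0 (f s); nra.
Qed.

(** The value 0 outside []0, T[] and on the exceptional set is admissible since [a0 <= 0], and it
    keeps the primitive bounded on the whole line. *)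
Lemma control_borel (T a0 : R) (A : R -> R) : a0 <= 0 -> control T a0 A ->
  exists A' : R -> R,
  [/\ borel A',
      forall s, a0 <= A' s <= 0, forall s, ~~ (0 < s < T) -> A' s = 0 &
      {ae mu, forall s, 0 < s < T -> A s = A' s}].
Proof.
move=> a00 [mA A01].
have mI : measurable (`]0, T[%classic : set (measurableTypeR R)) by [].
have [N [mN N0 mA']] := lebesgue_measurable_ae_borel mI mA.
exists (A \_ (`]0, T[%classic `\` N)); split => //.
- move=> s; rewrite patchE; case: ifPn => [/set_mem[sT _]|_]; last by rewrite a00 lexx.
  by have := A01 s sT; rewrite in_itv.
- move=> s sT; rewrite patchE memNset// => -[]; rewrite /= in_itv/= => sT'.
  by rewrite sT' in sT.
- exists N; split => // s /= H; apply: contrapT => nN; apply: H => sT.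
  by rewrite patchE mem_set//; split => //=; rewrite in_itv.
Qed.

End borel_paths.

(** * The value function through the primitive of the control *)

Section value_formula.
Context {R : realType} (HL HR : R -> R) (RL RR mL mR cL cR a0 : R) (u0 : R -> R).
Context (hL : hamiltonian HL RL mL cL a0) (hR : hamiltonian HR RR mR cR a0).
Context (u0l : forall y, y <= 0 -> u0 0 <= u0 y)
        (u0r : forall y, 0 <= y -> u0 0 - RR * y <= u0 y).
Notation mu := (@lebesgue_measure R).
Context (T : R) (T0 : 0 < T) (A : R -> R)
  (mA : borel A)
  (A01 : forall s, a0 <= A s <= 0).

Lemma control_primitive_incr a b : a <= b -> a0 * (b - a) <= int A a b <= 0.
Proof.
move=> ab; have iA := control_integrable a b mA A01.
have h1 : int (fun=> a0) a b <= int A a b.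
  by apply: int_le => [||s _]; [exact: cst_integrable_itv|exact: iA|case/andP: (A01 s)].
have h2 : int A a b <= int (fun=> 0) a b.
  by apply: int_le => [||s _]; [exact: iA|exact: cst_integrable_itv|case/andP: (A01 s)].
by move: h1 h2; rewrite !int_cst// mul0r => -> ->.
Qed.

Context (Aout : forall s, ~~ (0 < s < T) -> A s = 0).

Lemma control_primitive_bounded s : `|int A 0 s| <= - a0 * T.
Proof.
have a00 : a0 <= 0 by case/andP: (A01 0) => h1 h2; exact: le_trans h2.
have key r : 0 <= r -> r <= T -> `|int A 0 r| <= - a0 * T.
  move=> r0 rT; have /andP[h1 h2] := control_primitive_incr r0.
  by rewrite ler0_norm//; nra.
have [s0|s0] := leP s 0.
  rewrite /int set_itv_ge ?Rintegral_set0 ?normr0; last by rewrite bnd_simp -leNgt.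
  by apply: mulr_ge0; [rewrite oppr_ge0|exact: ltW].
have [sT|sT] := leP s T; first by apply: key => //; exact: ltW.
have T01 : 0 <= T <= s by rewrite !ltW.
rewrite (int_split (control_integrable 0 s mA A01) T01) (@int_eq _ A (fun=> 0) T s).
  by rewrite int_cst ?(ltW sT)// mul0r addr0 key// ltW.
by move=> r /andP[Tr _]; apply: Aout; rewrite (lt_gtF Tr) andbF.
Qed.

Lemma action_borel (B gamma g gamma' h : R -> R) t : 0 < t -> t <= T ->
  {ae mu, forall s, 0 < s < T -> B s = A s} ->
  continuous gamma' -> (forall s, 0 <= s <= t -> gamma' s = gamma s) ->
  borel h ->
  integrable_itv 0 t h ->
  {ae mu, forall s, 0 < s < t -> g s = h s} ->
  action HL HR RL RR u0 B t gamma g =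
  (int (running_cost HL HR RL RR A gamma' h) 0 t + u0 (gamma 0))%:E.
Proof.
move=> t0 tT BA cg gE mh ih gh.
have irc := integrable_running_cost hL hR cg mA A01 mh ih.
rewrite /action (@ae_eq_integral_completed _ _ _ (EFin \o running_cost HL HR RL RR A gamma' h))//.
- by rewrite EFinD /int /Rintegral fineK//; exact: integrable_fin_num.
- by apply/measurable_EFinP; apply: measurable_funTS; exact: (measurable_running_cost hL hR cg mA mh).
- apply: (aeS2 _ BA gh) => s BAs ghs; rewrite /= in_itv/= => st.
  have sT : 0 < s < T by case/andP: st => -> st /=; exact: lt_le_trans tT.
  have st' : 0 <= s <= t by case/andP: st => ? ?; rewrite !ltW.
  by rewrite /running_cost (gE s st') (BAs sT) (ghs st).
Qed.

(** Every path costs at least as much as some configuration, by [running_cost_lower], and every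
    configuration is matched by an admissible polygon of no greater cost. *)
Lemma valueE (B : R -> R) x t : 0 < t -> t <= T -> x != 0 ->
  {ae mu, forall s, 0 < s < T -> B s = A s} ->
  value HL HR RL RR u0 B x t = value_of HL HR RL RR u0 (fun s => int A 0 s) x t.
Proof.
move=> t0 tT x0 BA; rewrite /value gt_eqF//; set E := [set y | _].
have FC := control_primitive_bounded.
suff -> : ereal_inf E = (value_of HL HR RL RR u0 (fun s => int A 0 s) x t)%:E by [].
apply/eqP; rewrite eq_le; apply/andP; split; last first.
  apply/ereal_infP => _ [gamma [g [H1g gx ->]]].
  have [gamma' [h [cg gE mh ih [gh incr]]]] := H1_borel t0 H1g.
  rewrite (action_borel t0 tT BA cg gE mh ih gh) lee_fin.
  have g't : gamma' t = x by rewrite gE ?gx// lexx ltW.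
  have g't0 : gamma' t != 0 by rewrite g't.
  have [v Fv vle] := running_cost_lower u0 hL hR cg mA A01 mh ih incr t0 g't0.
  rewrite -(gE 0) ?lexx ?(ltW t0)//.
  apply: le_trans vle; apply: (value_of_le hL hR u0l u0r FC).
  by rewrite -g't.
apply/lee_addgt0Pr => e e0.
have [v Fv ve] := value_of_adherent hL hR u0l u0r x t0 FC e0.
have [y [c1 [a [c2 [b [[aa at_ bb bt] px ple]]]]]] := running_cost_upper hL hR mA A01 t0 x0 Fv.
set p := polygon _ _ _ _ _ in px ple; set h := polygon_slope _ _ _ _ in ple.
have cp : continuous p by exact: polygon_continuous.
have mh : borel h.
  exact: polygon_slope_measurable.
have hb s : 0 < s < t -> `|h s| <= `|c1| + `|c1| + `|c2| by move=> _; exact: polygon_slope_bounded.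
have ih : integrable_itv 0 t h by exact: bounded_integrable mh hb.
apply: (@le_trans _ _ (action HL HR RL RR u0 B t p h)).
  apply: ereal_inf_lbound; exists p, h; split => //; split.
  - exact: continuous_subspaceT.
  - have ct : {within `[0, t], continuous (fun s => `|p s|)}.
      by apply: continuous_subspaceT => s; apply: cvg_norm; exact: cp.
    have [c _ Hc] := EVT_max (ltW t0) ct.
    apply: (@L2_bounded _ _ _ _ `|p c|); first exact: continuous_measurable_fun.
    by move=> s /andP[s0 st]; apply: Hc; rewrite in_itv/= !ltW.
  - exact: L2_bounded mh hb.
  - move=> phi sphi; have [[dphi cdphi] _ _] := sphi.
    have cphi : continuous phi by move=> s; exact/differentiable_continuous/derivable1_diffP/dphi.
    rewrite (@Rintegral_completed _ _ (fun s => p s * derive1 phi s)); [|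
      by apply: measurable_funM; exact: continuous_measurable_fun|exact: aeW].
    rewrite (@Rintegral_completed _ _ (fun s => h s * phi s)); [|
      by apply: measurable_funM => //; exact: continuous_measurable_fun|exact: aeW].
    exact: weak_polygon.
rewrite (action_borel t0 tT BA cp (fun s _ => erefl) mh ih (aeW _ (fun s _ => erefl))).
by rewrite -EFinD lee_fin (le_trans ple)// ltW.
Qed.

End value_formula.

(** * Compactness *)

Section equilipschitz_cluster.
Context {R : realType}.

(* Pointwise cluster points exist by Tychonoff's theorem, and for equi-Lipschitz functions
   pointwise closeness on a finite grid is uniform closeness. *)
Lemma equilipschitz_cluster (T L C : R) (f_ : nat -> R -> R) : 0 < T -> 0 <= L ->
  (forall n s, `|f_ n s| <= C) ->
  (forall n (r s : R), 0 <= r <= T -> 0 <= s <= T -> `|f_ n s - f_ n r| <= L * `|s - r|) ->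
  exists2 f : R -> R, (forall s, `|f s| <= C) &
    forall e : R, 0 < e -> forall m, exists2 n, (m <= n)%N &
      forall s : R, 0 <= s <= T -> `|f_ n s - f s| <= e.
Proof.
move=> T0 L0 fC fL.
have cK : compact [set g : prod_topology (fun _ : R => R) | forall s, `[- C, C]%classic (g s)].
  by apply: (@tychonoff R (fun=> R) (fun=> `[- C, C]%classic)) => _; exact: segment_compact.
pose fp n : prod_topology (fun _ : R => R) := f_ n.
have [|f [fK fcl]] := cK (fp @ \oo) _.
  by exists 0%N => // n _ s; rewrite /= in_itv/= -ler_norml; exact: fC.
have {}fK s : `|f s| <= C by have := fK s; rewrite /= in_itv/= -ler_norml.
have ev s : (fun g : prod_topology (fun _ : R => R) => g s) @ f --> f s.
  exact: (@proj_continuous R (fun=> R) s f).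
have pick m (I : finType) (s : I -> R) (e : R) : 0 < e -> exists2 n, (m <= n)%N & forall i, `|f_ n (s i) - f (s i)| < e.
  move=> e0.
  have nf : nbhs f [set g : prod_topology (fun _ : R => R) | forall i, `|g (s i) - f (s i)| < e].
    apply: (@filter_forall _ I _ (nbhs f)) => i.
    have /cvgrPdist_lt/(_ e e0) := ev (s i).
    by apply: filterS => g; rewrite distrC.
  have fm : (fp @ \oo) [set g | exists2 n, (m <= n)%N & g = fp n].
    by exists m => // n /= mn; exists n.
  by have [g [[n mn ->] H]] := fcl _ _ fm nf; exists n.
exists f => // e e0 m.
(* Closeness at two points suffices, hence the index type [bool]. *)
have fLip (r s : R) : 0 <= r <= T -> 0 <= s <= T -> `|f s - f r| <= L * `|s - r|.
  move=> rT sT; apply/ler_addgt0Pr => d d0.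
  have d2 : 0 < d / 2 by rewrite divr_gt0.
  have [n _ Hn] := pick 0%N bool (fun b => if b then r else s) _ d2.
  have := Hn true; have := Hn false => /=.
  have := fL n r s rT sT; rewrite !ler_norml !ltr_norml; lra.
(* A mesh on which the Lipschitz bound is at most [e / 3]; adding 1 to [L] covers [L = 0]. *)
pose d := e / (3 * (L + 1)).
have d0 : 0 < d by rewrite divr_gt0// mulr_gt0// ltr_wpDl.
have Ld : L * d <= e / 3.
  by rewrite /d mulrA ler_pdivrMr ?mulr_gt0 ?ltr_wpDl//; nra.
have [k Tk] : exists k : nat, T / d < k%:R.
  by exists (Num.trunc (T / d)).+1; exact: truncnS_gt.
have kd : T < k%:R * d by rewrite -ltr_pdivrMr.
have e3 : 0 < e / 3 by rewrite divr_gt0.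
(* Grid points [i * d], cut off at [T] to stay in [[0, T]]. *)
have [n mn Hn] := pick m 'I_k.+1 (fun i => Num.min T (i%:R * d)) _ e3.
exists n => // s /andP[s0 sT].
have [i [iT si]] : exists i : 'I_k.+1, 0 <= Num.min T (i%:R * d) <= T /\ `|s - Num.min T (i%:R * d)| <= d.
  have tk : (Num.trunc (s / d) < k.+1)%N.
    rewrite ltnS -(ler_nat R) (le_trans _ (ltW Tk))// (@le_trans _ _ (s / d))//.
      by rewrite truncn_le divr_ge0// ltW.
    by rewrite ler_pM2r ?invr_gt0.
  exists (Ordinal tk) => /=; set j := Num.trunc (s / d).
  have sd : 0 <= s / d by rewrite divr_ge0// ltW.
  have j1 : j%:R * d <= s by rewrite -ler_pdivlMr// truncn_le.
  have j2 : s < (j%:R + 1) * d by rewrite -ltr_pdivrMr// natr1 truncnS_gt.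
  have jT : j%:R * d <= T by exact: le_trans sT.
  rewrite (min_idPr jT) jT mulr_ge0 ?ler0n ?(ltW d0)//; split => //.
  by rewrite ger0_norm; lra.
set r := Num.min T _ in iT si.
have sT' : 0 <= s <= T by rewrite s0.
have := Hn i; rewrite -/r; have := fL n r s iT sT'; have := fLip r s iT sT'.
have : L * `|s - r| <= e / 3 by rewrite (le_trans _ Ld)// ler_wpM2l.
rewrite !ler_norml !ltr_norml; lra.
Unshelve. all: by end_near. Qed.

End equilipschitz_cluster.

(** * Almost everywhere convergent selection from nested convex sets *)

Section convex_selection.
Context {R : realType} (T a0 : R) (T0 : 0 < T) (a00 : a0 <= 0).
Notation mu := (@lebesgue_measure R).

Definition borel_control : set (R -> R) := [set B |
  [/\ borel B,
      forall s, a0 <= B s <= 0 & forall s : R, ~~ (0 < s < T) -> B s = 0]].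

Context (C : nat -> set (R -> R)) (CB : forall k, C k `<=` borel_control)
  (C0 : forall k, C k !=set0) (Cnest : forall k l, (k <= l)%N -> C l `<=` C k)
  (Cmid : forall k A B, C k A -> C k B -> C k (fun s => (A s + B s) / 2)).

Let q (B : R -> R) := int (fun s => B s ^+ 2) 0 T.

Let sq_integrable (f : R -> R) M : borel f ->
  (forall s, `|f s| <= M) -> integrable_itv 0 T (fun s => f s ^+ 2).
Proof.
move=> mf fM; apply: (@bounded_integrable _ _ _ _ (M ^+ 2)); first exact: measurable_funX.
by move=> s _; rewrite normrX; have := fM s; have := normr_ge0 (f s); nra.
Qed.

Let cst_integrable (k : R) : integrable_itv 0 T (fun s : R => k).
Proof. exact: cst_integrable_itv. Qed.

Let bc_norm B s : borel_control B -> `|B s| <= - a0.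
Proof. by move=> [_ B01 _]; have := B01 s; rewrite ler_norml; lra. Qed.

Let q_bounds B : borel_control B -> 0 <= q B <= a0 ^+ 2 * T.
Proof.
move=> bB; have iB : integrable_itv 0 T (fun s => B s ^+ 2).
  by case: (bB) => mB _ _; apply: sq_integrable mB (fun s => bc_norm s bB).
have h1 : int (fun=> 0) 0 T <= q B.
  by apply: int_le => // s _; exact: sqr_ge0.
have h2 : q B <= int (fun=> a0 ^+ 2) 0 T.
  apply: int_le => // s _; have := bc_norm s bB; have := normr_ge0 (B s).
  by rewrite -(@real_normK _ (B s)) ?num_real//; nra.
by move: h1 h2; rewrite !int_cst ?(ltW T0)// mul0r subr0 => -> ->.
Qed.

Let dist A B := int (fun s => (A s - B s) ^+ 2) 0 T.

Let parallelogram A B : borel_control A -> borel_control B ->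
  dist A B = 2 * q A + 2 * q B - 4 * q (fun s => (A s + B s) / 2).
Proof.
move=> bA bB; have [mA _ _] := bA; have [mB _ _] := bB.
have iA := sq_integrable mA (fun s => bc_norm s bA).
have iB := sq_integrable mB (fun s => bc_norm s bB).
have mAB : borel (fun s => (A s + B s) / 2).
  by apply: measurable_funM; [exact: measurable_funD|exact: measurable_cst].
have iAB : integrable_itv 0 T (fun s => ((A s + B s) / 2) ^+ 2).
  apply: (sq_integrable (M := - a0) mAB) => s.
  have := bc_norm s bA; have := bc_norm s bB; rewrite !ler_norml; lra.
rewrite /dist (@int_eq _ _ (fun s => 2 * A s ^+ 2 + 2 * B s ^+ 2 + (-4) * ((A s + B s) / 2) ^+ 2)); last first.
  by move=> s _; field.
have j1 := integrableZ_itv 2 iA; have j2 := integrableZ_itv 2 iB.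
rewrite (intD (integrableD_itv j1 j2) (integrableZ_itv (-4) iAB)) (intD j1 j2).
by rewrite !intZ// /q; ring.
Qed.

Let d k := inf [set q B | B in C k].

Let d_has_inf k : has_inf [set q B | B in C k].
Proof.
split; first by have [B CkB] := C0 k; exists (q B), B.
by exists 0 => _ [B /CB /q_bounds /andP[? _] <-].
Qed.

Let d_le k B : C k B -> d k <= q B.
Proof. by move=> kB; apply: ge_inf; [case: (d_has_inf k)|exists B]. Qed.

Let d_mono k l : (k <= l)%N -> d k <= d l.
Proof.
move=> kl; apply: lb_le_inf; first by case: (d_has_inf l).
by move=> _ [B /(Cnest kl) kB <-]; exact: d_le.
Qed.

Let d_has_sup : has_sup (range d).
Proof.
split; first by exists (d 0%N), 0%N.
exists (a0 ^+ 2 * T) => _ [k _ <-]; have [B kB] := C0 k.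
by apply: (le_trans (d_le kB)); case/andP: (q_bounds (CB kB)).
Qed.

(** The infima [d k] increase and are bounded. Where [d] is within [4^-j] of its supremum, the
    midpoint of two almost minimal elements still has squared norm at least [d], and the
    parallelogram identity makes these elements close. *)
Lemma minimal_norm_selection : exists B : nat -> R -> R, (forall k, C k (B k)) /\
  forall k, dist (B k.+1) (B k) <= 8 / 4 ^+ k.
Proof.
have p0 (j : nat) : 0 < (4 ^+ j)^-1 :> R by rewrite invr_gt0 exprn_gt0.
have /choice[K HK] : forall j : nat, exists k, sup (range d) - (4 ^+ j)^-1 < d k.
  move=> j; have [_ [k _ <-] Hk] := sup_adherent (p0 j) d_has_sup; by exists k.
(* These partial sums are nondecreasing, at least [K j] and at least [j]; the last property puts
   [B j] into [C j] by nesting. *)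
pose kk j := (\sum_(i < j.+1) (K i).+1)%N.
have kkS j : kk j.+1 = (kk j + (K j.+1).+1)%N by rewrite /kk big_ord_recr.
have kkK j : (K j <= kk j)%N.
  by rewrite /kk big_ord_recr/= (leq_trans _ (leq_addl _ _)).
have kkj j : (j <= kk j)%N.
  by elim: j => // j IH; rewrite kkS addnS ltnS (leq_trans IH)// leq_addr.
have kkm j : (kk j <= kk j.+1)%N by rewrite kkS leq_addr.
have dk j : sup (range d) - (4 ^+ j)^-1 < d (kk j).
  exact: lt_le_trans (HK j) (d_mono (kkK j)).
have dsup k : d k <= sup (range d).
  by apply: ub_le_sup; [case: d_has_sup|exists k].
have /choice[B HB] : forall j, exists B, C (kk j) B /\ q B < d (kk j) + (4 ^+ j)^-1.
  move=> j; have [_ [B CB' <-] qB] := inf_adherent (p0 j) (d_has_inf (kk j)); by exists B.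
exists B; split => [k|k]; first by have [CkB _] := HB k; exact: Cnest (kkj k) _ CkB.
have [C1 q1] := HB k.+1; have [C2 q2] := HB k.
have C1' := Cnest (kkm k) C1.
rewrite (parallelogram (CB C1) (CB C2)).
have := d_le (Cmid C1' C2); have := dk k; have := dsup (kk k); have := dsup (kk k.+1).
have : (4 ^+ k.+1)^-1 <= (4 ^+ k)^-1 :> R.
  by rewrite lef_pV2 ?posrE ?exprn_gt0// exprS ler_peMl ?exprn_ge0// ler1n.
set x := (4 ^+ k)^-1; set y := (4 ^+ k.+1)^-1.
move: q1 q2; rewrite -/x -/y; lra.
Qed.

(** The geometric decay of the squared distances makes the successive differences summable in L^1,
    so their series converges almost everywhere and no subsequence has to be extracted. *)
Lemma convex_selection : exists A (B : nat -> R -> R), [/\ borel_control A, forall k, C k (B k) &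
  {ae mu, forall s : R, 0 < s < T -> B ^~ s @ \oo --> A s}].
Proof.
have [B [CkB dB]] := minimal_norm_selection.
have bB k := CB (CkB k).
have mB k : borel (B k) by case: (bB k).
pose g k s := `|B k.+1 s - B k s|.
have mg k : borel (g k).
  by apply: (measurableT_comp (@normr_measurable R setT)); apply: measurable_funB; exact: mB.
have gM k s : `|g k s| <= - a0 - a0.
  rewrite /g normr_id (le_trans (ler_normB _ _))// lerD//; exact: bc_norm.
have ig k : integrable_itv 0 T (g k) by exact: bounded_integrable (mg k) (fun s _ => gM k s).
(* Weighted Young inequality [z <= 2^-k + 2^k * z ^+ 2]: the first term integrates to [T / 2^k], the
   second to at most [2^k * 8 / 4^k]. *)
have gint k : int (g k) 0 T <= (T + 8) / 2 ^+ k.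
  have w0 : 0 < (2 ^+ k)^-1 :> R by rewrite invr_gt0 exprn_gt0.
  have isq : integrable_itv 0 T (fun s => (B k.+1 s - B k s) ^+ 2).
    apply: (sq_integrable (M := - a0 - a0)); first by apply: measurable_funB; exact: mB.
    by move=> s; have := gM k s; rewrite /g normr_id.
  have i2 := integrableZ_itv (2 ^+ k) isq.
  apply: (@le_trans _ _ (int (fun s => (2 ^+ k)^-1 + 2 ^+ k * (B k.+1 s - B k s) ^+ 2) 0 T)).
    apply: int_le => //; first exact: integrableD_itv.
    move=> s _; rewrite /g -(@real_normK _ (B k.+1 s - B k s)) ?num_real//.
    set z := `|_|; set w := (2 ^+ k)^-1 in w0 *.
    have ww : 2 ^+ k * w = 1 by rewrite mulfV// expf_neq0.
    have z0 : 0 <= z by exact: normr_ge0.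
    have P0 : 0 < 2 ^+ k :> R by rewrite exprn_gt0.
    have -> : z = w * (2 ^+ k * z) by rewrite mulrA (mulrC w) ww mul1r.
    have -> : 2 ^+ k * (w * (2 ^+ k * z)) ^+ 2 = w * (2 ^+ k * w) * (2 ^+ k * z) ^+ 2 by ring.
    rewrite ww mulr1 -{2}[w]mulr1 -mulrDr ler_pM2l//; nra.
  rewrite (intD (cst_integrable _) i2) (intZ _ isq) int_cst ?(ltW T0)// subr0.
  have -> : (T + 8) / 2 ^+ k = (2 ^+ k)^-1 * T + 2 ^+ k * (8 / 4 ^+ k).
    have -> : (4 : R) ^+ k = 2 ^+ k * 2 ^+ k.
      by rewrite -exprMn; congr (_ ^+ _); ring.
    by field; rewrite expf_neq0.
  by rewrite lerD2l ler_pM2l ?exprn_gt0//; exact: dB.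
have mI : measurable (`]0, T[%classic : set (measurableTypeR R)) by [].
have fin : {ae mu, forall s, `]0, T[%classic s ->
    (\sum_(0 <= k <oo) (g k s)%:E)%E \is a fin_num}.
  apply: integrable_ae => //; apply/integrableP; split.
    apply: ge0_emeasurable_sum => k => [x _ _|_]; first by rewrite lee_fin normr_ge0.
    by apply/measurable_EFinP; apply: measurable_funTS; exact: mg.
  rewrite (_ : (fun x => `|_|)%E = (fun s => (\sum_(0 <= k <oo) (g k s)%:E)%E)); last first.
    apply/funext => s; rewrite gee0_abs//; apply: nneseries_ge0 => k _ _.
    by rewrite lee_fin normr_ge0.
  rewrite integral_nneseries//; last 2 first.
  - by move=> k; apply/measurable_EFinP; apply: measurable_funTS; exact: mg.
  - by move=> k s _; rewrite lee_fin normr_ge0.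
  apply: (@le_lt_trans _ _ (\sum_(0 <= k <oo) ((T + 8) / 2 ^+ k)%:E)%E).
    apply: lee_nneseries => [k _ _|k _]; first by apply: integral_ge0 => s _; rewrite lee_fin normr_ge0.
    rewrite -[leLHS]fineK; last exact: (integrable_fin_num mI (ig k)).
    by rewrite lee_fin; exact: gint.
  apply: (@le_lt_trans _ _ (2 * (T + 8))%:E); last exact: ltry.
  apply: lime_le.
    by apply: is_cvg_nneseries => k _ _; rewrite lee_fin divr_ge0 ?exprn_ge0// addr_ge0// ltW.
  apply: nearW => n; rewrite sumEFin lee_fin.
  suff -> : \sum_(0 <= k < n) (T + 8) / 2 ^+ k = 2 * (T + 8) - 2 * (T + 8) / 2 ^+ n.
    by rewrite gerBl divr_ge0 ?exprn_ge0// mulr_ge0// addr_ge0// ltW.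
  elim: n => [|n IH]; first by rewrite big_geq// expr0 divr1 subrr.
  by rewrite big_nat_recr//= IH exprS; field; rewrite expf_neq0.
(* The upper limit is Borel also where the sequence diverges; [clamp] enforces the bounds of a
   control there. *)
pose A s := clamp a0 0 (fine (limn_esup (fun k => (B k s)%:E))).
pose A' := A \_ `]0, T[.
have mA : borel A.
  apply: (measurableT_comp (continuous_measurable_fun (@clamp_continuous R a0 0))).
  apply: measurableT_comp; first exact: fine_measurable.
  by apply: measurable_fun_limn_esup => k; apply/measurable_EFinP; exact: mB.
exists A', B; split => //.
  split.
  - apply/(measurable_restrictT _ mI); exact: measurable_funTS.
  - move=> s; rewrite /A' /patch; case: ifP => _; last by rewrite a00 lexx.
    exact: clamp_in.
  - move=> s; rewrite /A' /patch; case: ifPn => //.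
    by rewrite inE/= in_itv/= => ->.
apply: (aeS _ fin) => s fs sT.
have {}fs := fs sT.
have Bc : cvgn (B ^~ s).
  have gc : cvgn (series (g ^~ s)).
    apply: nondecreasing_is_cvgn.
      apply/nondecreasing_seqP => n.
      by rewrite seriesSr lerDl normr_ge0.
    exists (fine (\sum_(0 <= k <oo) (g k s)%:E)) => _ [n _ <-].
    rewrite -lee_fin fineK// seriesEnat/= -sumEFin.
    by apply: nneseries_lim_ge => k _ _; rewrite lee_fin normr_ge0.
  have := @normed_cvg _ R^o (telescope (B ^~ s)) gc; rewrite telescopeK => Bc.
  have : cvgn ([sequence B n s - B 0%N s]_n \+ cst (B 0%N s)).
    by apply: is_cvgD => //; exact: is_cvg_cst.
  by congr (cvg (_ @ \oo)); apply/funext => n /=; rewrite subrK.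
have -> : A' s = limn (B ^~ s); last by [].
have lA : a0 <= limn (B ^~ s) <= 0.
  apply/andP; split.
    by apply: limr_ge => //; apply: nearW => n; case: (bB n) => _ /(_ s)/andP[].
  by apply: limr_le => //; apply: nearW => n; case: (bB n) => _ /(_ s)/andP[].
rewrite /A' /patch ifT; last by rewrite inE.
rewrite /A is_cvg_limn_esupE; last first.
  by apply: cvgP; apply: cvg_EFin; [exact: nearW|exact: Bc].
by rewrite EFin_lim//= clamp_id.
Qed.

End convex_selection.

(** * The initial datum *)

Section monotone.
Context {R : realType}.
Notation mu := (@lebesgue_measure R).

Lemma cvg_quotient_harmonic (f : R -> R) x : derivable f x 1 ->
  (fun n => quotient f x n.+1%:R^-1) @ \oo --> derive1 f x.
Proof.
move=> df; apply/cvgrPdist_lt => e e0; have [d d0 Hd] := derivable_quotient df e0.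
near=> n; rewrite distrC; apply: Hd; first by rewrite invr_neq0.
by rewrite gtr0_norm//; near: n; exact: (near_infty_natSinv_lt (PosNum d0)).
Unshelve. all: by end_near. Qed.

(** Integrated over [[a, b]], the difference quotient of [f] is a difference of quotients of its
    primitive [Phi], and so tends to [f b - f a]. Its negative part, bounded by the Lipschitz
    constant, tends to 0 almost everywhere and hence in the integral. *)
Lemma nondecreasing_ae_derive1_ge0 (f : R -> R) (L a b : R) : a <= b ->
  (forall x y, `|f x - f y| <= L * `|x - y|) ->
  {ae mu, forall x : R, a < x < b -> derivable f x 1 /\ 0 <= derive1 f x} -> f a <= f b.
Proof.
move=> ab fL df.
have cf : continuous f.
  move=> x; apply/cvgrPdist_lt => e e0.
  have L1 : 0 < `|L| + 1 by rewrite ltr_wpDl.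
  near=> y; rewrite (le_lt_trans (fL x y))// (@le_lt_trans _ _ ((`|L| + 1) * `|x - y|))//.
    by rewrite ler_wpM2r// (le_trans (ler_norm _))// lerDl.
  by rewrite -ltr_pdivlMl//; near: y; apply: cvgr_dist_lt => //; rewrite mulr_gt0// invr_gt0.
(* The base point [a - 1] makes [a] an interior point, where the primitive has a two-sided
   derivative. *)
pose Phi y := \int[mu]_(x in `[a - 1, y]) f x.
have dPhi y : a <= y <= b + 1 -> is_derive y 1 Phi (f y).
  move=> /andP[ay yb].
  have fi : mu.-integrable `[a - 1, b + 2] (EFin \o f).
    by apply: continuous_compact_integrable; [exact: segment_compact|exact: continuous_subspaceT].
  have [|||d1 d2] := @continuous_FTC1_closed R f (a - 1) y (b + 2) _ fi.
  - lra.
  - lra.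
  - exact: cf.
  - have E : 'D_1 Phi y = f y by rewrite -derive1E.
    exact: (DeriveDef d1 E).
pose h n : R := n.+1%:R^-1.
have h0 n : 0 < h n by rewrite invr_gt0.
have h1 n : h n <= 1 by rewrite invf_le1// ler1n.
have cs n : continuous (fun x => f (x + h n)).
  move=> x; apply: (@cvg_comp _ _ _ (fun x => x + h n) f _ _ _ _ (cf _)).
  by apply: cvgD; [exact: cvg_id|exact: cvg_cst].
have cqn n : continuous (fun x => quotient f x (h n)).
  by move=> x; apply: cvgM; [apply: cvgB; [exact: cs|exact: cf]|exact: cvg_cst].
have mq n : measurable_fun setT (fun x => quotient f x (h n) : R).
  exact: continuous_measurable_fun.
have qL n x : `|quotient f x (h n)| <= L.
  rewrite /quotient normrM (gtr0_norm (_ : 0 < (h n)^-1)) ?invr_gt0// ler_pdivrMr//.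
  by rewrite (le_trans (fL _ _))// addrAC subrr add0r gtr0_norm.
have iq n : integrable_itv a b (fun x => quotient f x (h n)).
  exact: bounded_integrable (mq n) (fun x _ => qL n x).
have Eq n : int (fun x => quotient f x (h n)) a b = quotient Phi b (h n) - quotient Phi a (h n).
  have dq (s : R) : a <= s <= b -> is_derive s 1 (fun x => quotient Phi x (h n)) (quotient f s (h n)).
    move=> /andP[as_ sb]; have := h1 n; have := h0 n; set r := h n => r0 r1.
    have d1 : is_derive s 1 Phi (f s) by apply: dPhi; lra.
    have d2 : is_derive (s + r) 1 Phi (f (s + r)) by apply: dPhi; lra.
    have d3 : is_derive s 1 (fun x : R => Phi (x + r)) (f (s + r)).
      rewrite -[f _]mulr1; apply: (@is_derive1_comp _ Phi (fun x => x + r)) => //.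
      exact: is_derive_shift.
    have d4 := is_deriveB d3 d1.
    have -> : quotient f s r = r^-1 *: (f (s + r) - f s) by rewrite /quotient mulrC.
    rewrite (_ : (fun x => _) = r^-1 *: ((fun x => Phi (x + r)) - Phi)); first exact: is_deriveZ.
    by apply/funext => x /=; rewrite /quotient mulrC.
  by rewrite (int_FTC ab dq (cqn n)) /quotient; ring.
have cq : (fun n => int (fun x => quotient f x (h n)) a b) @ \oo --> (f b - f a : R).
  under eq_fun do rewrite Eq.
  have da : is_derive a 1 Phi (f a) by apply: dPhi; lra.
  have db : is_derive b 1 Phi (f b) by apply: dPhi; lra.
  apply: cvgB.
    by rewrite -(@derive_val _ _ _ _ _ _ _ db) -derive1E; exact: cvg_quotient_harmonic.
  by rewrite -(@derive_val _ _ _ _ _ _ _ da) -derive1E; exact: cvg_quotient_harmonic.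
pose q0 n x := Num.min (quotient f x (h n)) 0.
have mq0 n : measurable_fun setT (q0 n) 
  by apply: measurable_minr; [exact: mq|exact: measurable_cst].
have q0L x n : `|q0 n x| <= L.
  rewrite (le_trans _ (qL n x))// /q0 minEle; case: ifP => // _.
  by rewrite normr0 normr_ge0.
have mI : measurable (`]a, b[%classic : set (measurableTypeR R)) by [].
have [|||||_] := @Rintegral_dominated_cvg _ _ R mu _ mI q0 (cst 0) (cst L).
- by move=> n; apply: measurable_funTS; exact: mq0.
- exact: measurable_cst.
- apply: (aeS _ df) => x H; rewrite /= in_itv/= => /H[dx dx0].
  have /cvgrPdist_lt cd := cvg_quotient_harmonic dx.
  apply/cvgrPdist_lt => e e0; have := cd e e0; apply: filterS => n.
  rewrite /q0 sub0r normrN -/(h n) ltr_norml => /andP[_ He].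
  rewrite minEle; case: ifP => H0; last by rewrite normr0.
  by rewrite ler0_norm//; lra.
- exact: bounded_integrable (measurable_cst _) (fun _ _ => lexx `|L|).
- by move=> x n _; exact: q0L.
rewrite [X in _ --> X](_ : _ = 0) => [c0|]; last by rewrite Rintegral_cst ?mul0r.
rewrite -subr_ge0; apply: (ler_cvg_to c0 cq).
apply: nearW => n; apply: int_le => //.
  exact: bounded_integrable (mq0 n) (fun x _ => q0L x n).
by move=> s _; rewrite /q0 ge_min lexx.
Unshelve. all: by end_near. Qed.

Lemma lipschitz_bound (f : R -> R) : lipschitz f ->
  exists L, forall x y, `|f x - f y| <= L * `|x - y|.
Proof.
move=> /pinfty_ex_gt0[L _ Lf]; exists L => x y.
by have := Lf (x, y); apply.
Qed.

Context (u0 : R -> R) (r : R) (u0lip : lipschitz u0).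

Lemma nonincreasing_left (y : R) : {ae completed_lebesgue_measure, forall x : R, x < 0 ->
    derivable u0 x 1 /\ - r < derive1 u0 x < 0} -> y <= 0 -> u0 0 <= u0 y.
Proof.
have [L u0L] := lipschitz_bound u0lip; move=> /completed_lebesgue_ae du y0.
rewrite -lerN2; apply: (nondecreasing_ae_derive1_ge0 (f := fun x => - u0 x) (L := L)) => //.
  by move=> x z; rewrite -opprD normrN; exact: u0L.
apply: (aeS _ du) => x H /andP[_ /H[dx /andP[_ dx0]]].
split; first exact: derivableN.
by rewrite derive1E deriveN// -derive1E oppr_ge0 ltW.
Qed.

(** The monotonicity criterion is applied to [u0 x + r * x], whose slope is positive. *)
Lemma slope_lower_bound_right (y : R) : {ae completed_lebesgue_measure, forall x : R, 0 < x ->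
    derivable u0 x 1 /\ - r < derive1 u0 x < 0} -> 0 <= y -> u0 0 - r * y <= u0 y.
Proof.
have [L u0L] := lipschitz_bound u0lip; move=> /completed_lebesgue_ae du y0.
rewrite lerBlDr -[leLHS]addr0 -[X in _ + X](mulr0 r).
apply: (nondecreasing_ae_derive1_ge0 (f := fun x => u0 x + r * x) (L := L + `|r|)) => //.
  move=> x z; have := u0L x z; rewrite mulrDl -normrM => h.
  rewrite (_ : _ - _ = (u0 x - u0 z) + r * (x - z)); last by ring.
  by rewrite (le_trans (ler_normD _ _))// lerD2r.
apply: (aeS _ du) => x H /andP[/H[dx /andP[dx0 _]] _].
have dr : is_derive x 1 (fun x : R => r * x) r.
  rewrite -[X in is_derive _ _ _ X]mulr1; exact: is_deriveZ.
have du1 : is_derive x 1 u0 (derive1 u0 x).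
  by apply: (DeriveDef dx); rewrite derive1E.
have ds := is_deriveD du1 dr; split; first by case: ds.
rewrite derive1E (@derive_val _ _ _ _ _ _ _ ds); lra.
Qed.

End monotone.

(** * Convergence of gradients *)

Section almost_everywhere_facts.
Context {R : realType}.
Notation mu := (@lebesgue_measure R).

Lemma ae_countable (P : R -> Prop) : countable [set x | ~ P x] -> {ae mu, forall x, P x}.
Proof.
move=> cP; exists [set x | ~ P x]; split => //; last exact: countable_lebesgue_measure0.
exact: countable_measurable.
Qed.

Lemma eq_near_derive1 (f g : R -> R) x e : 0 < e ->
  (forall y, `|y - x| < e -> f y = g y) -> derive1 f x = derive1 g x.
Proof.
move=> e0 fg; rewrite !derive1E; apply: near_eq_derive.
by near=> y; apply: fg; rewrite distrC; near: y; exact: cvgr_dist_lt.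
Unshelve. all: by end_near. Qed.

(** Convergence becomes an equation for an upper limit, so that sets of divergence of Borel
    functions are measurable. *)
Lemma cvg_limn_esup_norm (u : nat -> R) (l : R) :
  u @ \oo --> l <-> limn_esup (fun n => `|u n - l|%:E) = 0%E.
Proof.
split => [ul|u0].
  suff H : (fun n => `|u n - l|%:E) @ \oo --> 0%E by rewrite (cvg_limn_einf_sup H).2.
  apply: cvg_EFin; first exact: nearW.
  by rewrite -(normr0 R) -(subrr l); apply: cvg_norm; apply: cvgB => //; exact: cvg_cst.
have : (fun n => `|u n - l|%:E) @ \oo --> 0%E.
  by apply: limn_esup_le_cvg => [|n]; rewrite ?u0// lee_fin.
move=> /fine_cvg /= H; apply/subr_cvg0; exact/norm_cvg0P.
Qed.

(** Fubini for null sets; it applies because the bad set [E], described through [q], is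
    measurable. *)
Lemma ae_cvg_product (D : set R) (p_ : nat -> plane R -> measurableTypeR R) (p : plane R -> measurableTypeR R) :
  measurable (D : set (measurableTypeR R)) ->
  (forall n, measurable_fun setT (p_ n)) -> measurable_fun setT p ->
  {ae mu, forall t : measurableTypeR R, D t ->
    {ae mu, forall x : measurableTypeR R, p_ ^~ (x, t) @ \oo --> (p (x, t) : R)}} ->
  {ae product_measure_sf mu mu, forall z, D z.2 -> p_ ^~ z @ \oo --> (p z : R)}.
Proof.
move=> mD mp_ mp cp.
pose q z := limn_esup (fun n => `|p_ n z - p z|%:E).
have mq : measurable_fun setT q.
  apply: measurable_fun_limn_esup => n; apply/measurable_EFinP.
  apply: (measurableT_comp (@normr_measurable R setT)).
  by apply: measurable_funB; [exact: mp_|exact: mp].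
pose E := (snd @^-1` D) `&` (q @^-1` (~` [set 0%E])).
have mE : measurable E.
  apply: measurableI.
    by rewrite -[X in measurable X]setTI; exact: measurable_snd.
  by rewrite -[X in measurable X]setTI; apply: mq => //; exact: measurableC.
exists E; split => //; last first.
  move=> z /= /not_implyP[Dz nc]; split => // q0; apply: nc; exact/cvg_limn_esup_norm.
apply: ae_null_ysection => //; apply: filterS cp => t H.
have [Dt|nDt] := pselect (D t); last first.
  rewrite (_ : ysection E t = set0) ?measure0//.
  by apply/seteqP; split => // x; rewrite /ysection/= inE => -[].
have /negligibleP : mu.-negligible (ysection E t).
  apply: negligibleS (H Dt) => x; rewrite /ysection/= inE => -[_ /= nq] c; apply: nq.
  exact/cvg_limn_esup_norm.
by apply; exact: measurable_ysection.
Qed.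

Lemma ae_snd (P : R -> Prop) : {ae mu, forall t : measurableTypeR R, P t} ->
  {ae product_measure_sf mu mu, forall z : plane R, P z.2}.
Proof.
move=> [N [mN N0 PN]]; exists (snd @^-1` N); split.
- by rewrite -[X in measurable X]setTI; exact: measurable_snd.
- apply: ae_null_ysection; first by rewrite -[X in measurable X]setTI; exact: measurable_snd.
  exists N; split => // t /= nt; apply: contrapT => Nt; apply: nt.
  rewrite (_ : ysection _ _ = set0) ?measure0//.
  by apply/seteqP; split => // x; rewrite /ysection/= inE.
- by move=> z; exact: PN.
Qed.

End almost_everywhere_facts.

(** The points [a_ n] need not converge: compactness makes the continuity of [g] at [(p, x)] uniform
    in [x]. This allows the gradient to be replaced by its limit along controls of which only the
    primitives converge. *)
Lemma cvg_continuous_compact {R : realType} (g : R * R -> R) (a b p : R) (u a_ : nat -> R) :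
  continuous g -> u @ \oo --> p -> (forall n, a <= a_ n <= b) ->
  (fun n => g (u n, a_ n) - g (p, a_ n)) @ \oo --> (0 : R).
Proof.
move=> cg up ab; apply/cvgrPdist_lt => e e0.
pose P (n : nat) (x : R) := `|g (u n, x) - g (p, x)| < e.
have : \forall n \near \oo, `[a, b]%classic `<=` P n.
  apply: ((compact_near_coveringP _).1 (@segment_compact R a b) nat \oo P) => x _ /=.
  have e2 : 0 < e / 2 by rewrite divr_gt0.
  have c1 : (fun q : R * nat => g (u q.2, q.1)) @ (nbhs x, \oo) --> g (p, x).
    apply: (@cvg_comp _ _ _ (fun q : R * nat => (u q.2, q.1)) g _ _ _ _ (cg _)).
    exact: cvg_pair (cvg_comp (@snd R nat) u cvg_snd up) cvg_fst.
  have c2 : (fun q : R * nat => g (p, q.1)) @ (nbhs x, \oo) --> g (p, x).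
    apply: (@cvg_comp _ _ _ (fun q : R * nat => (p, q.1)) g _ _ _ _ (cg _)).
    exact: cvg_pair (cvg_cst p) cvg_fst.
  move/cvgrPdist_lt : c1 => /(_ _ e2) c1; move/cvgrPdist_lt : c2 => /(_ _ e2) c2.
  apply: filterS2 c1 c2 => q /=; rewrite /P !ltr_norml; lra.
apply: filterS => n /(_ (a_ n)); rewrite /P sub0r normrN; apply.
by rewrite /= in_itv/=; exact: ab.
Qed.

(** * The cost with gradient and control decoupled *)

Section functional.
Context {R : realType} (T a0 K M : R) (ph : R -> R -> R -> R -> R).
Notation mu := (@lebesgue_measure R).
Context (phm : forall p a, borel2 (fun z => ph z.1 z.2 p a))
  (phc : forall x t, continuous (fun q : R * R => ph x t q.1 q.2))
  (phM : forall x t p a, `|ph x t p a| <= M)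
  (phmid : forall x t p a b, a0 <= a <= 0 -> a0 <= b <= 0 ->
     ph x t p ((a + b) / 2) <= (ph x t p a + ph x t p b) / 2).
Let mu2 := product_measure_sf mu mu.

Definition slab : set (plane R) := `[- K, K] `*` `]0, T[.

Lemma measurable_slab : measurable slab.
Proof. exact: measurableX. Qed.
Hint Resolve measurable_slab : core.

Lemma slab_lty : (mu2 slab < +oo)%E.
Proof.
have fin (i : interval R) a b : i = Interval (BSide a (- K)) (BSide b K) \/ i = `]0, T[ ->
    (mu [set` i] < +oo)%E.
  by move=> [|] ->; rewrite lebesgue_measure_itv/=; case: ifP => _; rewrite ltry.
rewrite /mu2 product_measure_sfE product_measure1E//.
apply: lte_mul_pinfty => //; last by apply: (fin _ true true); right.
by rewrite ge0_fin_numE//; apply: (fin _ true false); left.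
Qed.

Lemma slab_integrable (f : plane R -> R) C : borel2 f ->
  (forall z, `|f z| <= C) -> mu2.-integrable slab (EFin \o f).
Proof.
move=> mf fC; apply: measurable_bounded_integrable => //; first exact: slab_lty.
  exact: measurable_funTS.
exists C; split; first exact: num_real.
by move=> x Cx z _ /=; rewrite (le_trans (fC z))// ltW.
Qed.

(** The gradient is an argument of its own: with [p] frozen, midpoint convexity in the control
    holds. *)
Definition functional (p : plane R -> R) (a : R -> R) : R :=
  \int[mu2]_(z in slab) ph z.1 z.2 (p z) (a z.2).

Lemma eq_functional (p q : plane R -> R) (a : R -> R) :
  (forall z, slab z -> p z = q z) -> functional p a = functional q a.
Proof. by move=> pq; apply: eq_Rintegral => z; rewrite inE => /pq ->. Qed.

Lemma measurable_integrand (p : plane R -> R) (a : R -> R) :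
  borel2 p ->
  borel a ->
  borel2 (fun z => ph z.1 z.2 (p z) (a z.2)).
Proof.
move=> mp ma.
apply: (@caratheodory_measurable_comp _ (plane R) R (fun z => ph z.1 z.2) p (fun z => a z.2)) => //.
by apply: measurableT_comp ma _; exact: measurable_snd.
Qed.

Lemma integrable_integrand (p : plane R -> R) (a : R -> R) :
  borel2 p ->
  borel a ->
  mu2.-integrable slab (EFin \o (fun z => ph z.1 z.2 (p z) (a z.2))).
Proof. by move=> mp ma; apply: (slab_integrable (C := M)) => //; exact: measurable_integrand. Qed.

Lemma functional_bounded (p : plane R -> R) (a : R -> R) :
  borel2 p ->
  borel a ->
  `|functional p a| <= M * fine (mu2 slab).
Proof.
move=> mp ma; have ip := integrable_integrand mp ma.
rewrite /functional (le_trans (le_normr_Rintegral _ ip))//.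
rewrite -Rintegral_cst//; apply: le_Rintegral => //.
- exact: integrable_norm.
- by apply: (slab_integrable (C := `|M|)) => //; exact: measurable_cst.
Qed.

Lemma functional_grad_cvg (p_ : nat -> plane R -> R) (p : plane R -> R) (a_ : nat -> R -> R) :
  (forall n, borel2 (p_ n)) ->
  borel2 p ->
  (forall n, borel (a_ n)) ->
  (forall n s, a0 <= a_ n s <= 0) ->
  {ae mu2, forall z, `]0, T[%classic z.2 -> p_ ^~ z @ \oo --> (p z : R)} ->
  (fun n => functional (p_ n) (a_ n) - functional p (a_ n)) @ \oo --> (0 : R).
Proof.
move=> mp_ mp ma a01 cp.
have i1 n := integrable_integrand (mp_ n) (ma n).
have i2 n := integrable_integrand mp (ma n).
rewrite (_ : (fun n => _) = (fun n => \int[mu2]_(z in slab)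
    (ph z.1 z.2 (p_ n z) (a_ n z.2) - ph z.1 z.2 (p z) (a_ n z.2)))); last first.
  by apply/funext => n; rewrite /functional RintegralB.
have [|||||_] := @Rintegral_dominated_cvg _ _ R mu2 slab measurable_slab
  (fun n z => ph z.1 z.2 (p_ n z) (a_ n z.2) - ph z.1 z.2 (p z) (a_ n z.2)) (cst 0) (cst (M + M)).
- move=> n; apply: measurable_funTS.
  by apply: measurable_funB; apply: measurable_integrand.
- exact: measurable_cst.
- apply: (aeS _ cp) => z H [_ z2].
  have := @cvg_continuous_compact R (fun q => ph z.1 z.2 q.1 q.2) a0 0 (p z)
    (p_ ^~ z) (fun n => a_ n z.2) (@phc _ _) (H z2).
  by apply => n; exact: a01.
- by apply: (slab_integrable (C := `|M + M|)) => //; exact: measurable_cst.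
- by move=> z n _; rewrite (le_trans (ler_normB _ _))// lerD.
by rewrite Rintegral_cst// mul0r.
Qed.

Lemma functional_control_cvg (p : plane R -> R) (a_ : nat -> R -> R) (a : R -> R) :
  borel2 p ->
  (forall n, borel (a_ n)) ->
  borel a ->
  {ae mu, forall s : R, 0 < s < T -> a_ ^~ s @ \oo --> a s} ->
  (fun n => functional p (a_ n)) @ \oo --> functional p a.
Proof.
move=> mp ma_ ma ca.
have [|||||_] := @Rintegral_dominated_cvg _ _ R mu2 slab measurable_slab
  (fun n z => ph z.1 z.2 (p z) (a_ n z.2)) (fun z => ph z.1 z.2 (p z) (a z.2)) (cst M).
- by move=> n; apply: measurable_funTS; exact: measurable_integrand.
- by apply: measurable_funTS; exact: measurable_integrand.
- apply: (aeS _ (ae_snd ca)) => z H [_ /=].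
  rewrite in_itv/= => /H c.
  apply: (@cvg_comp _ _ _ (fun n => (p z, a_ n z.2)) (fun q => ph z.1 z.2 q.1 q.2) _ _ _ _ (@phc _ _ (p z, a z.2))).
  exact: cvg_pair (cvg_cst (p z)) c.
- by apply: (slab_integrable (C := `|M|)) => //; exact: measurable_cst.
- by [].
by [].
Qed.

Lemma functional_midpoint (p : plane R -> R) (a b : R -> R) :
  borel2 p ->
  borel a ->
  borel b ->
  (forall s, a0 <= a s <= 0) -> (forall s, a0 <= b s <= 0) ->
  functional p (fun s => (a s + b s) / 2) <= (functional p a + functional p b) / 2.
Proof.
move=> mp ma mb a01 b01.
have ia := integrable_integrand mp ma; have ib := integrable_integrand mp mb.
have mab : borel (fun s => (a s + b s) / 2).
  by apply: measurable_funM; [exact: measurable_funD|exact: measurable_cst].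
rewrite /functional -RintegralD// -RintegralZr//; last exact: (integrableD measurable_slab ia ib).
apply: le_Rintegral => //.
- exact: (integrable_integrand mp mab).
- apply: (slab_integrable (C := M)).
    apply: measurable_funM; last exact: measurable_cst.
    by apply: measurable_funD; exact: measurable_integrand.
  move=> z; rewrite normrM [`|2^-1|]ger0_norm ?invr_ge0// ler_pdivrMr//.
  by rewrite (le_trans (ler_normD _ _))// mulr_natr mulr2n lerD.
- by move=> z _; exact: phmid.
Qed.

End functional.

(** * Gradients of the reduced value *)

Section reduced_problem.
Context {R : realType} (HL HR : R -> R) (RL RR mL mR cL cR a0 : R) (u0 : R -> R).
Context (hL : hamiltonian HL RL mL cL a0) (hR : hamiltonian HR RR mR cR a0).
Context (u0l : forall y, y <= 0 -> u0 0 <= u0 y)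
        (u0r : forall y, 0 <= y -> u0 0 - RR * y <= u0 y).
Notation mu := (@lebesgue_measure R).
Notation V := (value_of HL HR RL RR u0).

(** Half-lines at positive distance from 0, each with its own semiconcavity constant, exhaust the
    complement of 0. *)
Let right (n : nat) : set R := [set x | n.+1%:R^-1 < x].
Let left (n : nat) : set R := [set x | x < - n.+1%:R^-1].

Let right_open n x : right n x -> exists2 d, 0 < d & forall y, `|y - x| < d -> right n y.
Proof.
rewrite /right/= => nx; exists (x - n.+1%:R^-1); first by rewrite subr_gt0.
move=> y; rewrite ltr_norml; set r := _^-1; lra.
Qed.

Let left_open n x : left n x -> exists2 d, 0 < d & forall y, `|y - x| < d -> left n y.
Proof.
rewrite /left/= => nx; exists (- n.+1%:R^-1 - x); first by rewrite subr_gt0.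
move=> y; rewrite ltr_norml; set r := _^-1; lra.
Qed.

Let right_or_left x : x != 0 -> exists n, right n x \/ left n x.
Proof.
move=> x0; have /ltr_add_invr[n] : 0 < `|x| by rewrite normr_gt0.
rewrite add0r => nx; exists n; move: nx; rewrite /right /left /=; set r := _^-1.
by have [x1|x1] := ltP 0 x; [rewrite gtr0_norm//; left|rewrite ler0_norm//; right; lra].
Qed.

Lemma value_of_derivable_ae F CF t : 0 < t -> (forall s, `|F s| <= CF) ->
  {ae mu, forall x, x != 0 /\ derivable (V F ^~ t) x 1}.
Proof.
move=> t0 FC.
have bad n : {ae mu, forall x, ~ (right n x /\ ~ derivable (V F ^~ t) x 1) /\
    ~ (left n x /\ ~ derivable (V F ^~ t) x 1)}.
  have n0 : 0 < n.+1%:R^-1 :> R by rewrite invr_gt0.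
  have [K HK] := value_of_semiconcave hL hR u0l u0r n0 t0.
  have [K1 K2] := HK F CF FC.
  have c1 := semiconcave_derivable (@right_open n) K1.
  have c2 := semiconcave_derivable (@left_open n) K2.
  have d1 : {ae mu, forall x, ~ (right n x /\ ~ derivable (V F ^~ t) x 1)}.
    by apply: ae_countable; under eq_set do rewrite notK.
  have d2 : {ae mu, forall x, ~ (left n x /\ ~ derivable (V F ^~ t) x 1)}.
    by apply: ae_countable; under eq_set do rewrite notK.
  exact: (aeS2 _ d1 d2).
have zero : {ae mu, forall x : measurableTypeR R, x != 0}.
  apply: ae_countable; rewrite (_ : [set _ | _] = [set 0]); first exact: countable1.
  by apply/seteqP; split => x /=; [move/negP; rewrite negbK => /eqP|move=> ->; rewrite eqxx].
apply: (aeS2 _ zero (ae_foralln bad)) => x x0 nx; split => //.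
apply: contrapT => nd; have [n rl] := right_or_left x0; have [n1 n2] := nx n.
by case: rl => ?; [exact: n1|exact: n2].
Qed.

(** At almost every [x] the values for [F] and for all [F_ n] are differentiable; on a half-line
    containing [x] they share a semiconcavity constant, and [semiconcave_cvg_derive] applies. *)
Lemma value_grad_cvg_ae (F_ : nat -> R -> R) (F : R -> R) (C t : R) (e_ : nat -> R) : 0 < t ->
  (forall n s, `|F_ n s| <= C) -> (forall s, `|F s| <= C) ->
  (forall n s, 0 <= s <= t -> `|F_ n s - F s| <= e_ n) -> e_ @ \oo --> (0 : R) ->
  {ae mu, forall x : measurableTypeR R,
    (fun n => value_grad HL HR RL RR u0 (F_ n) (x, t)) @ \oo --> value_grad HL HR RL RR u0 F (x, t)}.
Proof.
move=> t0 FnC FC Fe e0.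
have cV x : (fun n => V (F_ n) x t) @ \oo --> V F x t.
  apply/cvgrPdist_le => d d0; have d2 : 0 < d / 2 by rewrite divr_gt0.
  move/cvgrPdist_lt : e0 => /(_ _ d2); apply: filterS => n.
  rewrite sub0r normrN => /(le_lt_trans (ler_norm _)) ed.
  have := value_of_close hL hR u0l u0r x t0 (FnC n) FC (Fe n).
  have Fe' s : 0 <= s <= t -> `|F s - F_ n s| <= e_ n by rewrite distrC; exact: Fe.
  have := value_of_close hL hR u0l u0r x t0 FC (FnC n) Fe'.
  rewrite ler_norml; lra.
have dn : {ae mu, forall x n, x != 0 /\ derivable (V (F_ n) ^~ t) x 1}.
  by apply/ae_foralln => n; exact: value_of_derivable_ae t0 (FnC n).
apply: (aeS2 _ dn (value_of_derivable_ae t0 FC)) => x dxn [x0 dx].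
rewrite (value_gradE x0 t0 dx).
under eq_fun do rewrite (value_gradE x0 t0 (dxn _).2).
have [n rl] := right_or_left x0.
have n0 : 0 < n.+1%:R^-1 :> R by rewrite invr_gt0.
have [K HK] := value_of_semiconcave hL hR u0l u0r n0 t0.
have sn k := HK (F_ k) C (FnC k).
have [s1 s2] := HK F C FC.
case: rl => ix.
  exact: (semiconcave_cvg_derive (@right_open n) (fun k => (sn k).1) s1 (fun y _ => cV y) ix
    (fun k => (dxn k).2) dx).
exact: (semiconcave_cvg_derive (@left_open n) (fun k => (sn k).2) s2 (fun y _ => cV y) ix
    (fun k => (dxn k).2) dx).
Qed.

Section cost_formula.
Context (T K M : R) (T0 : 0 < T) (ph : R -> R -> R -> R -> R) (N : set (plane R))
  (psi : R * R * R * R -> R).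
Context (mN : measurable N) (N0 : (mu \x mu)%E N = 0)
  (phm : forall p a, borel2 (fun z => ph z.1 z.2 p a))
  (phc : forall x t, continuous (fun q : R * R => ph x t q.1 q.2))
  (phM : forall x t p a, `|ph x t p a| <= M /\ (K < `|x| -> ph x t p a = 0))
  (psiE : forall x t p a, 0 <= t <= T -> a0 <= a <= 0 -> ~ N (x, t) ->
     psi (x, t, p, a) = ph x t p a).

(** For almost every [t] the section of [N] is null, and for almost every [x] the value is
    differentiable. The iterated completed integrals therefore equal iterated Borel ones, which
    Fubini joins into one over the slab. *)
Lemma cost_functional (B A : R -> R) : borel_control T a0 A ->
  {ae mu, forall s, 0 < s < T -> B s = A s} ->
  cost T HL HR RL RR u0 psi B =
  (functional T K ph (value_grad HL HR RL RR u0 (fun s => int A 0 s)) A)%:E.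
Proof.
move=> [mA A01 Aout] BA.
have FC := control_primitive_bounded T0 mA A01 Aout.
set F := fun s => int A 0 s; set p := value_grad HL HR RL RR u0 F.
have mp : borel2 p.
  exact: (value_grad_measurable hL hR u0l u0r FC).
pose g (z : plane R) := ph z.1 z.2 (p z) (A z.2).
have ig : (product_measure_sf mu mu).-integrable (slab T K) (EFin \o g).
  exact: (integrable_integrand T K phm phc (fun x t p a => (phM x t p a).1) mp mA).
(* For [t] in []0, T[] the restriction to the slab changes nothing, since [ph] vanishes when
   [|x| > K]; integrability comes from the finite measure of the slab. *)
pose G : plane R -> \bar R := (EFin \o g) \_ (slab T K).
have iG : (product_measure_sf mu mu).-integrable setT G.
  by rewrite /G -integrable_mkcond//; exact: measurable_slab.
have mI : measurable (`]0, T[%classic : set (measurableTypeR R)) by [].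
have GE x t : `]0, T[%classic t -> G (x, t) = (g (x, t))%:E.
  move=> tT; rewrite /G patchE; case: ifPn => //; rewrite notin_setE => /= nz.
  rewrite /g/= (phM x t _ _).2// ltNge ler_norml; apply/negP => xK.
  by apply: nz; split => //=; rewrite in_itv.
have G0 x t : ~ `]0, T[%classic t -> G (x, t) = 0%E.
  by move=> nt; rewrite /G patchE; case: ifPn => //; rewrite inE => -[].
pose h t := (\int[mu]_x G (x, t))%E.
have mh : measurable_fun setT (h : measurableTypeR R -> \bar R).
  exact: (measurable_fubini_G iG).
transitivity (\int[mu]_(t in `]0%R, T[) h t)%E; last first.
  rewrite /functional /Rintegral fineK; last exact: (integrable_fin_num (measurable_slab T K) ig).
  rewrite [RHS]integral_mkcond -[RHS](integral21_prod_meas1 iG) integral_mkcond.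
  apply: eq_integral => t _; rewrite patchE; case: ifPn => //.
  rewrite notin_setE => nt; rewrite /fubini_G; apply/esym/integral0_eq => x _; exact: G0.
rewrite /cost; apply: ae_eq_integral_completed => //; first exact: measurable_funTS.
have nN := null_ysection mN N0.
apply: (aeS2 _ BA nN) => t Bt Nt /=.
rewrite in_itv/= => tT; have /andP[t0 tT'] := tT.
have Ns : {ae mu, forall x : measurableTypeR R, ~ N (x, t)}.
  exists (ysection N t); split => //; first exact: measurable_ysection.
  by move=> x /= nn; rewrite /ysection/= inE; apply: contrapT.
apply: ae_eq_integral_completed => //.
  apply: (@eq_measurable_fun _ _ _ _ _ (fun x => (g (x, t))%:E)).
    by move=> x _; rewrite GE//= in_itv.
  apply/measurable_EFinP.
  apply: (measurableT_comp (measurable_integrand phm phc mp mA)).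
  exact: measurable_pair2.
have dV := value_of_derivable_ae t0 FC.
apply: (aeS2 _ Ns dV) => x Nx [x0 dx] _.
rewrite GE/= ?in_itv//; congr EFin; rewrite /g/= Bt//.
(* The formula for the value holds at nonzero points only; within distance [|x|] of [x] all points
   are nonzero. *)
have -> : derive1 (fun y => value HL HR RL RR u0 B y t) x = p (x, t).
  rewrite /p value_gradE//; apply: (@eq_near_derive1 _ _ _ _ `|x|).
    by rewrite normr_gt0.
  move=> y yx; apply: (valueE hL hR u0l u0r T0 mA A01 Aout) => //; first exact: ltW.
  by apply: contraTneq yx => ->; rewrite sub0r normrN ltxx.
by apply: psiE => //; rewrite !ltW.
Qed.

End cost_formula.

(** * Existence of a minimiser *)

Section minimiser.
Context (T K M : R) (T0 : 0 < T) (a00 : a0 <= 0) (ph : R -> R -> R -> R -> R).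
Context (phm : forall p a, borel2 (fun z => ph z.1 z.2 p a))
  (phc : forall x t, continuous (fun q : R * R => ph x t q.1 q.2))
  (phM : forall x t p a, `|ph x t p a| <= M)
  (phmid : forall x t p a b, a0 <= a <= 0 -> a0 <= b <= 0 ->
     ph x t p ((a + b) / 2) <= (ph x t p a + ph x t p b) / 2).

Let bc := borel_control T a0.
Let prim (A : R -> R) (s : R) := int A 0 s.
Let P := value_grad HL HR RL RR u0.
Let J := functional T K ph.
Let r (n : nat) : R := n.+1%:R^-1.

Let r_gt0 n : 0 < r n. Proof. by rewrite invr_gt0. Qed.

Let r_mono n m : (n <= m)%N -> r m <= r n.
Proof. by move=> nm; rewrite lef_pV2 ?posrE// ler_nat. Qed.

Let r_cvg : r @ \oo --> (0 : R).
Proof.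
apply/cvgrPdist_lt => e e0; near=> n.
by rewrite sub0r normrN gtr0_norm//; near: n; exact: (near_infty_natSinv_lt (PosNum e0)).
Unshelve. all: by end_near. Qed.

Let prim_bounded A s : bc A -> `|prim A s| <= - a0 * T.
Proof. by move=> [mA A01 Aout]; exact (control_primitive_bounded T0 mA A01 Aout s). Qed.

Let prim_lip A s1 s2 : bc A -> 0 <= s1 <= T -> 0 <= s2 <= T ->
  `|prim A s2 - prim A s1| <= - a0 * `|s2 - s1|.
Proof.
move=> [mA A01 Aout]; wlog s12 : s1 s2 / s1 <= s2.
  move=> H h1 h2; have [s12|/ltW s21] := leP s1 s2; first exact: H.
  by rewrite distrC (distrC s2); exact: H.
move=> /andP[s1ge _] /andP[s2ge _].
have iA : integrable_itv 0 s2 A := control_integrable 0 s2 mA A01.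
rewrite /prim (int_split iA (_ : 0 <= s1 <= s2)) ?s1ge// addrAC subrr add0r.
have /andP[h1 h2] := control_primitive_incr mA A01 s12.
by rewrite ler0_norm// ger0_norm ?subr_ge0//; nra.
Qed.

Let prim_mid A B s : bc A -> bc B ->
  prim (fun s => (A s + B s) / 2) s = (prim A s + prim B s) / 2.
Proof.
move=> [mA A01 _] [mB B01 _].
have iA := control_integrable 0 s mA A01; have iB := control_integrable 0 s mB B01.
have iAB := integrableD_itv iA iB.
rewrite /prim (@int_eq _ _ (fun s => 2^-1 * (A s + B s))); last by move=> x _; rewrite mulrC.
by rewrite (intZ _ iAB) (intD iA iB) mulrC.
Qed.

Let bc_mid A B : bc A -> bc B -> bc (fun s => (A s + B s) / 2).
Proof.
move=> [mA A01 Aout] [mB B01 Bout]; split.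
- by apply: measurable_funM; [exact: measurable_funD|exact: measurable_cst].
- by move=> s; have := A01 s; have := B01 s; lra.
- by move=> s sT; rewrite Aout// Bout// addr0 mul0r.
Qed.

Let mP F CF : (forall s, `|F s| <= CF) -> borel2 (P F).
Proof. by move=> FC; exact: (value_grad_measurable hL hR u0l u0r FC). Qed.

(** The optimal control will be known to have primitive [F] on [[0, T]] only; the value at time [t]
    sees [F] only up to [t]. *)
Let value_grad_local F G CF CG t x : (forall s, `|F s| <= CF) -> (forall s, `|G s| <= CG) ->
  0 < t -> (forall s, 0 <= s <= t -> F s = G s) -> P F (x, t) = P G (x, t).
Proof.
move=> FC GC t0 FG.
have VE y : value_of HL HR RL RR u0 F y t = value_of HL HR RL RR u0 G y t.
  have e1 s : 0 <= s <= t -> `|F s - G s| <= 0 by move=> st; rewrite FG// subrr normr0.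
  have e2 s : 0 <= s <= t -> `|G s - F s| <= 0 by move=> st; rewrite FG// subrr normr0.
  have := value_of_close hL hR u0l u0r y t0 FC GC e1.
  have := value_of_close hL hR u0l u0r y t0 GC FC e2; lra.
have VF y : value_fun HL HR RL RR u0 F (y, t) = value_fun HL HR RL RR u0 G (y, t).
  by rewrite /value_fun !patchE; case: ifP => // _; exact: VE.
rewrite /P /value_grad; congr fine; congr limn_esup; apply/funext => n.
by rewrite /= !VF.
Qed.

Lemma minimising_control : exists2 A, borel_control T a0 A & forall B, borel_control T a0 B ->
  J (P (prim A)) A <= J (P (prim B)) B.
Proof.
pose cost_of A := J (P (prim A)) A.
pose S := [set cost_of A | A in bc].
have mPb A : bc A -> borel2 (P (prim A)).
  by move=> bA; exact: mP (fun s => prim_bounded s bA).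
have S_inf : has_inf S.
  split.
    exists (cost_of (fun=> 0)), (fun=> 0) => //; split => // s.
    by rewrite a00 lexx.
  exists (- (M * fine (product_measure_sf mu mu (slab T K)))) => _ [A bA <-].
  have [mA _ _] := bA.
  by have := functional_bounded T K phm phc phM (mPb A bA) mA; rewrite ler_norml => /andP[].
pose m := inf S.
have m_le A : bc A -> m <= cost_of A.
  by move=> bA; apply: ge_inf; [case: S_inf|exists A].
have /choice[A_ HA_] : forall n, exists A, bc A /\ cost_of A < m + r n.
  move=> n; have [_ [A bA <-] cA] := inf_adherent (r_gt0 n) S_inf; by exists A.
have bA_ n : bc (A_ n) by case: (HA_ n).
have La0 : 0 <= - a0 by rewrite oppr_ge0.
have [F FC Fcl] := equilipschitz_cluster T0 La0 (fun n s => prim_bounded s (bA_ n))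
  (fun n s1 s2 h1 h2 => prim_lip (bA_ n) h1 h2).
have /choice[k_ Hk] : forall j, exists n, (j <= n)%N /\
    forall s, 0 <= s <= T -> `|prim (A_ n) s - F s| <= r j.
  by move=> j; have [n jn Hn] := Fcl _ (r_gt0 j) j; exists n.
pose B_ j := A_ (k_ j).
have bB_ j : bc (B_ j) by exact: bA_.
pose p := P F.
have mp : borel2 p by exact: mP FC.
have mB_ j : borel (B_ j) by case: (bB_ j).
have B01 j s : a0 <= B_ j s <= 0 by case: (bB_ j) => _ /(_ s).
have cp : {ae product_measure_sf mu mu, forall z, `]0, T[%classic z.2 ->
    (fun j => P (prim (B_ j)) z) @ \oo --> (p z : R)}.
  have mI : measurable (`]0, T[%classic : set (measurableTypeR R)) by [].
  apply: (ae_cvg_product mI (fun j => mPb _ (bB_ j)) mp).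
  apply: aeW => t; rewrite /= in_itv/= => /andP[t0 tT].
  apply: (value_grad_cvg_ae t0 (fun j s => prim_bounded s (bB_ j)) FC _ r_cvg).
  move=> j s /andP[s0 st]; apply: (Hk j).2; by rewrite s0 (le_trans st (ltW tT)).
have cJ := functional_grad_cvg K phm phc phM (fun j => mPb _ (bB_ j)) mp mB_ B01 cp.
pose C j := [set B | bc B /\ (forall s, 0 <= s <= T -> `|prim B s - F s| <= r j) /\ J p B <= m + r j].
have C0 j : C j !=set0.
  have r2 : 0 < r j / 2 by rewrite divr_gt0.
  move/cvgrPdist_lt : cJ => /(_ _ r2) cJ; move/cvgrPdist_lt : r_cvg => /(_ _ r2) cr.
  (* The budget [r j] is split: less than one half for replacing the gradient by [p], and
     [r (k_ i) <= r i < r j / 2] for the distance to the infimum. *)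
  have [i [[ji ri] Ji]] : exists i, ((j <= i)%N /\ r i < r j / 2) /\
      `|J (P (prim (B_ i))) (B_ i) - J p (B_ i)| < r j / 2.
    have : \forall i \near \oo, ((j <= i)%N /\ r i < r j / 2) /\
      `|J (P (prim (B_ i))) (B_ i) - J p (B_ i)| < r j / 2.
      near=> i; split; first split.
      - by near: i; exact: nbhs_infty_ge.
      - apply: le_lt_trans (ler_norm _) _; rewrite -normrN -sub0r; near: i; exact: cr.
      - rewrite -normrN -sub0r; near: i; exact: cJ.
    by case=> i0 _ H; exists i0; apply: H => /=.
  exists (B_ i); split => //; split.
    by move=> s sT; apply: le_trans ((Hk i).2 s sT) _; exact: r_mono.
  have := (HA_ (k_ i)).2; rewrite /cost_of -/(B_ i).
  have := r_mono (Hk i).1; move: Ji ri.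
  move: (J _ (B_ i)) (J p (B_ i)) (r i) (r j) (r (k_ i)) => ? ? ? ? ?.
  rewrite ltr_norml; lra.
have Cnest k l : (k <= l)%N -> C l `<=` C k.
  move=> kl B [bB [BF JB]]; split => //; split.
    by move=> s sT; exact: le_trans (BF s sT) (r_mono kl).
  by apply: le_trans JB _; rewrite lerD2l; exact: r_mono.
have Cmid k A B : C k A -> C k B -> C k (fun s => (A s + B s) / 2).
  move=> [bA [AF JA]] [bB [BF JB]]; split; first exact: bc_mid.
  split.
    move=> s sT; rewrite prim_mid//; have := AF s sT; have := BF s sT.
    move: (prim A s) (prim B s) (F s) (r k) => ? ? ? ?; rewrite !ler_norml; lra.
  have [mA A01 _] := bA; have [mB B01' _] := bB.
  have := functional_midpoint T K phm phc phM phmid mp mA mB A01 B01'.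
  rewrite -/J; move: JA JB; move: (J p A) (J p B) (J p _) (r k) => ? ? ? ?; lra.
have [A [D [bA CD cD]]] := convex_selection T0 a00 (fun k B (CB : C k B) => CB.1) C0 Cnest Cmid.
have bD k : bc (D k) := (CD k).1.
have [mA A01 Aout] := bA.
have mD k : borel (D k) by case: (bD k).
(* The limit of [prim (D k) s] is computed twice, by dominated convergence and from the definition
   of [C k]. *)
have primA s : 0 <= s <= T -> prim A s = F s.
  move=> /andP[s0 sT].
  have mI : measurable (`]0, s[%classic : set (measurableTypeR R)) by [].
  have [|||||_ c1] := @Rintegral_dominated_cvg _ _ R mu _ mI D A (cst (- a0)).
  - by move=> k; apply: measurable_funTS; exact: mD.
  - by apply: measurable_funTS; exact: mA.
  - apply: (aeS _ cD) => x H /=.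
    by rewrite in_itv/= => /andP[x0 xs]; apply: H; rewrite x0 (lt_le_trans xs sT).
  - exact: (@bounded_integrable _ _ _ _ `|- a0| (measurable_cst _) (fun _ _ => lexx _)).
  - move=> x k _; have [_ D01 _] := bD k; have := D01 x; rewrite ler_norml/=; lra.
  have c2 : (fun k => prim (D k) s) @ \oo --> F s.
    apply/cvgrPdist_le => e e0; move/cvgrPdist_lt : r_cvg => /(_ _ e0).
    apply: filterS => k; rewrite sub0r normrN => /(le_lt_trans (ler_norm _)) /ltW re.
    by rewrite distrC (le_trans _ re)//; apply: (CD k).2.1; rewrite s0.
  exact: (cvg_unique _ c1 c2).
have JpA : J p A <= m.
  have cJA := functional_control_cvg (K := K) phm phc phM mp mD mA cD.
  have cm : (fun k => m + r k) @ \oo --> m.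
    by rewrite -[X in _ --> X]addr0; apply: cvgD; [exact: cvg_cst|exact: r_cvg].
  by apply: (ler_cvg_to cJA cm); apply: nearW => k; exact: (CD k).2.2.
exists A => // B bB.
have Pp (z : plane R) : slab T K z -> P (prim A) z = p z.
  case: z => x t -[_ /=]; rewrite in_itv/= => /andP[t0 tT].
  apply: (value_grad_local x (fun s => prim_bounded s bA) FC t0).
  by move=> s /andP[s0 st]; apply: primA; rewrite s0 (le_trans st (ltW tT)).
rewrite [leLHS](eq_functional ph A Pp).
exact: le_trans JpA (m_le B bB).
Unshelve. all: by end_near. Qed.

End minimiser.

End reduced_problem.

Theorem theorem3p1 (R : realType) (T : R) (HL HR : R -> R) (RL RR : R)
    (u0 : R -> R) (psi : R * R * R * R -> R)
    (A0 := flux_min HL HR)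
    (D := [set z : R * R * R * R |
             z.1.1.2 \in `[0, T] /\ z.2 \in `[A0, 0]])
    (T_gt0 : 0 < T)
    (HL_C2 : C2 HL) (HL_convex : uniformly_convex HL)
    (HR_C2 : C2 HR) (HR_convex : uniformly_convex HR)
    (RL_gt0 : 0 < RL) (HL_zeros : HL (- RL) = 0 /\ HL 0 = 0)
    (RR_gt0 : 0 < RR) (HR_zeros : HR (- RR) = 0 /\ HR 0 = 0)
    (u0_lipschitz : lipschitz u0)
    (u0_left : {ae leb, forall x : R, x < 0 ->
       derivable u0 x 1 /\ - RL < derive1 u0 x < 0})
    (u0_right : {ae leb, forall x : R, 0 < x ->
       derivable u0 x 1 /\ - RR < derive1 u0 x < 0})
    (psi_measurable : lebesgue4_measurable_fun D psi)
    (psi_bounded : [bounded psi z | z in D])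
    (psi_support : compact (closed_support D psi))
    (psi_continuous : forall x t : R, t \in `[0, T] ->
       {within [set q : R * R | q.2 \in `[A0, 0]],
         continuous (fun q : R * R => psi (x, t, q.1, q.2))})
    (psi_convex : forall x t p : R, t \in `[0, T] ->
       convex_function (`[A0, 0]%classic : set R^o)
         (fun a : R => psi (x, t, p, a))) :
  exists2 A : R -> R, control T A0 A &
    forall B : R -> R, control T A0 B ->
      (cost T HL HR RL RR u0 psi A <= cost T HL HR RL RR u0 psi B)%E.
Proof.
have [HLRL HL0] := HL_zeros; have [HRRR HR0] := HR_zeros.
have [infL [mL [cL hL]]] := uniformly_convex_hamiltonian HL_C2 HL_convex RL_gt0 HLRL HL0.
have [infR [mR [cR hR]]] := uniformly_convex_hamiltonian HR_C2 HR_convex RR_gt0 HRRR HR0.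
(* Strictness leaves [[A0, 0]] nondegenerate, as [integrand_reduction] requires. *)
have A0_lt0 : A0 < 0 by rewrite /A0 /flux_min gt_max infL infR.
have {}hL : hamiltonian HL RL mL cL A0 by apply: hL; rewrite /A0 /flux_min le_max lexx.
have {}hR : hamiltonian HR RR mR cR A0 by apply: hR; rewrite /A0 /flux_min le_max lexx orbT.
have u0l y : y <= 0 -> u0 0 <= u0 y := nonincreasing_left u0_lipschitz u0_left.
have u0r y : 0 <= y -> u0 0 - RR * y <= u0 y := slope_lower_bound_right u0_lipschitz u0_right.
have [ph [M [K [N [[mN N0 _] phm phc phM [psiE phmid]]]]]] := integrand_reduction A0_lt0
  psi_measurable psi_bounded psi_support psi_continuous psi_convex.
have phM' x t p a : `|ph x t p a| <= M := (phM x t p a).1.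
have [A bA A_min] := minimising_control hL hR u0l u0r K T_gt0 (ltW A0_lt0) phm phc phM' phmid.
have costE := cost_functional hL hR u0l u0r T_gt0 mN N0 phm phc phM psiE.
have [mA A01 _] := bA.
exists A.
  split; last by move=> t _; rewrite in_itv; exact: A01.
  have mI : measurable (`]0, T[%classic : set (measurableTypeR R)) by [].
  exact: (borel_lebesgue_measurable_fun (measurable_funTS mA) mI).
(* Any competitor has the same cost as its Borel representative. *)
move=> B /(control_borel (ltW A0_lt0))[B' [mB B01 Bout BB]].
have bB : borel_control T A0 B' by split.
rewrite (costE B B' bB BB) (costE A A bA); last exact: aeW.
by rewrite lee_fin; exact: A_min.
Qed.
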